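(* Every hyperbolic group is knapsack-tame. That is, let $G$ be a hyperbolic group with finite symmetric generating set $\Sigma$. Then there is a fixed polynomial $p(n)$ (depending only on $G$ and $\Sigma$) such that, for a given knapsack expression $E$ over $G$, one can compute a semilinear representation of the solution set $\mathsf{sol}(E)$ whose magnitude is at most $p(|E|)$.
   Context: Hyperbolic: a finitely generated group $G$ with finite symmetric generating set $\Sigma$ (i.e. $a\in\Sigma$ implies $a^{-1}\in\Sigma$) is hyperbolic if for some $\delta\ge 0$ every geodesic triangle in its Cayley graph (viewed as a geodesic metric space with unit-length edges) is $\delta$-slim, i.e. every point on one side has distance at most $\delta$ from a point on the union of the other two sides. Knapsack expressions: a knapsack expression over $G$ is a formal expression $E=u_1^{x_1}v_1u_2^{x_2}v_2\cdots u_k^{x_k}v_k$ with $k\ge 1$, words $u_i,v_i\in\Sigma^*$, and pairwise distinct variables $x_1,\dots,x_k$ taking values in $\mathbb{N}=\{0,1,2,\dots\}$. Its length is $|E|=\sum_{i=1}^k(|u_i|+|v_i|)$. Let $X_E=\{x_1,\dots,x_k\}$. The solution set $\mathsf{sol}(E)$ is the set of all $\nu\in\mathbb{N}^{X_E}$ such that $u_1^{\nu(x_1)}v_1\cdots u_k^{\nu(x_k)}v_k=1$ in $G$; it is viewed as a subset of $\mathbb{N}^k$. Semilinear sets: a set $A\subseteq\mathbb{N}^k$ is linear if $A=\{v_0+\lambda_1v_1+\cdots+\lambda_nv_n\mid\lambda_1,\dots,\lambda_n\in\mathbb{N}\}$ for some $v_0,\dots,v_n\in\mathbb{N}^k$;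 the tuple $(v_0,\dots,v_n)$ is a linear representation of $A$, and its magnitude is the largest number appearing in one of the vectors. A semilinear set is a finite union of linear sets; a semilinear representation is a list of linear representations of these linear sets, and its magnitude is the maximal magnitude of the linear representations in the list. *)

(* Defs.v *)
From HB Require Import structures.
From mathcomp Require Import all_boot all_order all_algebra finmap.
From mathcomp Require Import classical_sets reals.

Set Implicit Arguments.
Unset Strict Implicit.
Unset Printing Implicit Defensive.

Import Order.TTheory GRing.Theory Num.Theory.

(* Letters are the elements of the finite subset S of G, taken as a subtype. *)
Notation word S := (seq (fset_sub_type S)).

Section Words.
Variables (G : groupType) (S : {fset G}).

Definition word_val (w : word S) : G := (\prod_(a <- w) val a)%g.

Definition symmetric_set : Prop := forall a : G, a \in S -> (a^-1)%g \in S.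

Definition generating_set : Prop := forall g : G, exists w : word S, word_val w = g.

End Words.

Section Hyperbolic.
Variables (R : realType) (G : groupType) (S : {fset G}).
Local Open Scope ring_scope.

(* [EdgePoint g a t] lies on the edge from g to g * a, at distance t from g.
   The points [EdgePoint g a t] and [EdgePoint (g * a) a^-1 (1 - t)] denote the
   same point of the Cayley graph (unless a = 1, when the edge is a loop of
   length 1); they are at [cayley_dist] 0 from each other.  Thus [cayley_dist]
   is a pseudometric, and the Cayley graph is the associated metric space. *)
Inductive cayley_point : Type :=
| Vertex (g : G)
| EdgePoint (g : G) (a : S) (t : R) of 0 < t < 1.

(* The segment from x to the vertex g along an edge containing x has length r. *)
Definition to_vertex (x : cayley_point) (g : G) (r : R) : Prop :=
  match x with
  | Vertex h => g = h /\ r = 0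
  | EdgePoint h a t _ =>
      (g = h /\ r = t) \/ (g = (h * val a)%g /\ r = 1 - t)
  end.

(* x and y lie inside the same edge, and the part of this edge between them has
   length r. *)
Definition along_edge (x y : cayley_point) (r : R) : Prop :=
  match x, y with
  | EdgePoint g a s _, EdgePoint h b t _ =>
      [/\ h = g, b = a & r = `|s - t|] \/
      [/\ val a != 1%g, h = (g * val a)%g, val b = ((val a)^-1)%g &
          r = `|s - (1 - t)|]
  | _, _ => False
  end.

(* Lengths of the paths from x to y that either stay inside an edge or go
   from x to a vertex, follow a word, and go from the vertex reached to y. *)
Definition path_length (x y : cayley_point) (r : R) : Prop :=
  along_edge x y r \/
  exists (g : G) (w : word S) (s t : R),
    [/\ to_vertex x g s, to_vertex y (g * word_val w)%g t &
        r = s + (size w)%:R + t].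

Definition cayley_dist (x y : cayley_point) : R :=
  inf [set r | path_length x y r]%classic.

Record geodesic := Geodesic {
  geo_len : R;
  geo_path :> R -> cayley_point; (* only its values on [0, geo_len] matter *)
  geo_len_ge0 : 0 <= geo_len;
  geo_isometry : forall s t : R, 0 <= s <= geo_len -> 0 <= t <= geo_len ->
    cayley_dist (geo_path s) (geo_path t) = `|s - t|
}.

Definition on_geodesic (c : geodesic) (x : cayley_point) : Prop :=
  exists2 t : R, 0 <= t <= geo_len c & x = c t.

Definition geodesic_triangle (c1 c2 c3 : geodesic) : Prop :=
  [/\ cayley_dist (c1 (geo_len c1)) (c2 0) = 0,
      cayley_dist (c2 (geo_len c2)) (c3 0) = 0 &
      cayley_dist (c3 (geo_len c3)) (c1 0) = 0].

Definition near_union (delta : R) (c c' c'' : geodesic) : Prop :=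
  forall x, on_geodesic c x ->
    exists2 y, on_geodesic c' y \/ on_geodesic c'' y & cayley_dist x y <= delta.

Definition slim_triangle (delta : R) (c1 c2 c3 : geodesic) : Prop :=
  [/\ near_union delta c1 c2 c3, near_union delta c2 c3 c1 &
      near_union delta c3 c1 c2].

Definition hyperbolic : Prop :=
  exists2 delta : R, 0 <= delta &
    forall c1 c2 c3 : geodesic,
      geodesic_triangle c1 c2 c3 -> slim_triangle delta c1 c2 c3.

End Hyperbolic.

(* The expression u_1^x_1 v_1 ... u_k^x_k v_k is the tuple of the pairs
   (u_i, v_i); the variables, being pairwise distinct, are left implicit. *)
Notation knapsack_expr S k := (k.-tuple (word S * word S)).

Section Knapsack.
Variables (G : groupType) (S : {fset G}) (k : nat).

Definition knapsack_length (E : knapsack_expr S k) : nat :=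
  \sum_(i < k) (size (tnth E i).1 + size (tnth E i).2).

Definition knapsack_sol (E : knapsack_expr S k) : set (k.-tuple nat) :=
  [set nu : k.-tuple nat |
    (\prod_(i < k) (word_val (tnth E i).1 ^+ tnth nu i
                    * word_val (tnth E i).2))%g = 1%g]%classic.

End Knapsack.

(* (v_0, v_1 .. v_n) is represented by (v_0, [:: v_1; ..; v_n]). *)
Notation linear_repr k := (k.-tuple nat * seq (k.-tuple nat))%type.
Notation semilinear_repr k := (seq (linear_repr k)).

Section Semilinear.
Variable k : nat.

Definition linear_set (L : linear_repr k) : set (k.-tuple nat) :=
  [set x : k.-tuple nat | exists lambda : 'I_(size L.2) -> nat,
    forall i : 'I_k, tnth x i = tnth L.1 i +
      \sum_(j < size L.2) lambda j * tnth (tnth (in_tuple L.2) j) i]%classic.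

Definition semilinear_set (A : semilinear_repr k) : set (k.-tuple nat) :=
  [set x | exists2 L, L \in A & linear_set L x]%classic.

Definition linear_magnitude (L : linear_repr k) : nat :=
  \max_(v <- L.1 :: L.2) \max_(i < k) tnth v i.

Definition semilinear_magnitude (A : semilinear_repr k) : nat :=
  \max_(L <- A) linear_magnitude L.

End Semilinear.

(* The total recursive functions of Kleene: minimization is only applied to
   functions with a zero for every value of the parameters. *)
Inductive recursive : forall n : nat, (n.-tuple nat -> nat) -> Prop :=
| rec_zero n :
    @recursive n (fun _ => 0)
| rec_succ :
    @recursive 1 (fun x => (thead x).+1)
| rec_proj n (i : 'I_n) :
    @recursive n (fun x => tnth x i)
| rec_comp m n (f : m.-tuple nat -> nat) (g : 'I_m -> n.-tuple nat -> nat) :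
    recursive f -> (forall i, recursive (g i)) ->
    @recursive n (fun x => f [tuple g i x | i < m])
| rec_prim n (f : n.-tuple nat -> nat) (g : n.+2.-tuple nat -> nat)
    (h : n.+1.-tuple nat -> nat) :
    recursive f -> recursive g ->
    (forall x : n.-tuple nat, h [tuple of 0 :: x] = f x) ->
    (forall (y : nat) (x : n.-tuple nat),
       h [tuple of y.+1 :: x] = g [tuple of y :: h [tuple of y :: x] :: x]) ->
    @recursive n.+1 h
| rec_min n (f : n.+1.-tuple nat -> nat) (h : n.-tuple nat -> nat) :
    recursive f ->
    (forall x : n.-tuple nat, f [tuple of h x :: x] = 0) ->
    (forall (x : n.-tuple nat) (y : nat), y < h x -> f [tuple of y :: x] != 0) ->
    @recursive n h.

Definition computable (f : nat -> nat) : Prop :=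
  @recursive 1 (fun x => f (thead x)).

(* Expressions and representations are given to and returned by the algorithm
   as their codes under [pickle].  The pickling of sequences, pairs and tuples
   is the library's explicit Goedel numbering; that of the letters is an
   injection of the finite set S into nat, and two such injections differ by a
   finite table. *)
Definition knapsack_tame (G : groupType) (S : {fset G}) : Prop :=
  exists (p : {poly nat}) (f : nat -> nat),
    computable f /\
    forall (k : nat) (E : knapsack_expr S k), 0 < k ->
      exists A : semilinear_repr k,
        [/\ f (choice.pickle E) = choice.pickle A,
            semilinear_set A = knapsack_sol E &
            semilinear_magnitude A <= (p.[knapsack_length E])%R].

(* Main.v *)
(* In a hyperbolic group the powers of an element are either periodic, with a
   uniformly bounded period, or grow linearly at a uniform rate; in the second
   case a geodesic from P to u^x P stays close to the orbit of P under u. A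
   solution of u_1^(x_1) v_1 ... u_k^(x_k) v_k = 1 is a closed polygon, and the
   sides of a polygon fall, up to pieces of bounded length, into non-crossing
   strips along which two of them run close to each other in opposite
   directions. In a long strip between the sides i and j the pigeonhole
   principle gives a relation with polynomially bounded exponents p and q,
   whence p e_i + q e_j can be subtracted from the solution, any number of times
   up to the length of the strip, or added to it any number of times.
   Non-crossing relations do not interfere with each other, so subtracting as
   often as possible leaves a solution of polynomial size. Thus sol(E) is the
   union of its linear subsets with polynomially bounded base and with
   polynomially bounded periods that have at most two nonzero entries. Whether
   such a linear set consists of solutions is decided by testing the
   coefficients 0 and 1, with Dehn's algorithm for the word problem. *)

From HB Require Import structures.
Require Import Defs.
From mathcomp Require Import all_boot all_order all_algebra finmap.
From mathcomp Require Import boolp classical_sets reals.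
From mathcomp Require Import zify ring lra.

Set Implicit Arguments.
Unset Strict Implicit.
Unset Printing Implicit Defensive.
Import Order.TTheory GRing.Theory Num.Theory.

(** * Word length and the four-point condition *)

(** All bounds have to be polynomial in the length n of the expression, and this shapes the
    geometry. Balls grow exponentially, so pigeonholes cannot be counted in a ball whose radius
    depends on n. In a strip they need not be: an element that moves the ends of a long segment
    little compared with its length sends the midpoint to within 3 K of the segment itself, so the
    image is given by a position along the segment and an element of a ball of fixed radius.
    Likewise the distance from a geodesic to an orbit is bounded by n plus a constant common to all
    elements of linear growth. A second obstacle: relations are found at the large solution but must
    hold at the small one left after subtraction, and they relate conjugates of the u_i by prefixes,
    which change with the exponents. For non-crossing relations both conjugates in a relation change
    by one common conjugation, so it survives. The algorithm does not follow this argument. It tries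
    every linear set within the bound; the geometry only shows that this search misses no
    solution. *)

Record hyp_length (G : groupType) (l : G -> nat) (K : nat) : Prop := HypLength {
  hl1 : l 1%g = 0;
  hl_eq0 : forall g, l g = 0 -> g = 1%g;
  hlV : forall g, l g^-1%g = l g;
  hlM : forall g h, l (g * h)%g <= l g + l h;
  hl_geo : forall g r, r <= l g -> exists2 h, l h = r & l (h^-1 * g)%g = l g - r;
  hl_fin : forall r, exists s : seq G, forall g, l g <= r -> g \in s;
  hl_4pt : forall x y z w : G,
    l (x^-1 * z)%g + l (y^-1 * w)%g <=
    maxn (l (x^-1 * y)%g + l (z^-1 * w)%g) (l (x^-1 * w)%g + l (y^-1 * z)%g) + K
}.

Section WordLength.
Variables (G : groupType) (S : {fset G}).
Hypotheses (symS : symmetric_set S) (genS : generating_set S).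

Lemma word_val_nil : word_val ([::] : word S) = 1%g.
Proof. by rewrite /word_val big_nil. Qed.

Lemma word_val_cons a (w : word S) : word_val (a :: w) = (val a * word_val w)%g.
Proof. by rewrite /word_val big_cons. Qed.

Lemma word_val_cat (v w : word S) : word_val (v ++ w) = (word_val v * word_val w)%g.
Proof. by rewrite /word_val big_cat. Qed.

Lemma length_exists (g : G) : exists n, `[< exists2 w : word S, word_val w = g & size w = n >].
Proof. by have [w <-] := genS g; exists (size w); apply/asboolP; exists w. Qed.

Definition wlen (g : G) : nat := ex_minn (length_exists g).

Lemma wlen_word g : exists2 w : word S, word_val w = g & size w = wlen g.
Proof. by rewrite /wlen; case: ex_minnP => n /asboolP. Qed.

Lemma wlen_le (w : word S) : wlen (word_val w) <= size w.
Proof.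
by rewrite /wlen; case: ex_minnP => n _; apply; apply/asboolP; exists w.
Qed.

Lemma word_inv (w : word S) : exists2 v : word S, word_val v = ((word_val w)^-1)%g & size v = size w.
Proof.
elim: w => [|a w [v vE vs]]; first by exists [::]; rewrite // word_val_nil invg1.
exists (v ++ [:: [` symS (valP a)]%fset]); last by rewrite size_cat /= vs addn1.
by rewrite word_val_cat !word_val_cons word_val_nil mulg1 invgM vE.
Qed.

Lemma wlen1 : wlen 1%g = 0.
Proof. by apply/eqP; rewrite -leqn0 -word_val_nil; apply: (wlen_le [::]). Qed.

Lemma wlen_eq0 g : wlen g = 0 -> g = 1%g.
Proof.
move=> g0; have [w wE] := wlen_word g; rewrite g0 -wE => /size0nil ->.
exact: word_val_nil.
Qed.

Lemma wlenV_le g : wlen g^-1%g <= wlen g.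
Proof.
have [w <- <-] := wlen_word g; have [v <- <-] := word_inv w.
exact: wlen_le.
Qed.

Lemma wlenV g : wlen g^-1%g = wlen g.
Proof. by apply/eqP; rewrite eqn_leq wlenV_le -{1}[g]invgK wlenV_le. Qed.

Lemma wlenM g h : wlen (g * h)%g <= wlen g + wlen h.
Proof.
have [v <- <-] := wlen_word g; have [w <- <-] := wlen_word h.
by rewrite -word_val_cat -size_cat wlen_le.
Qed.

Lemma wlen_fin r : exists s : seq G, forall g, wlen g <= r -> g \in s.
Proof.
suff [s sP] : exists s : seq G, forall w : word S, size w <= r -> word_val w \in s.
  by exists s => g; have [w <- <-] := wlen_word g; apply: sP.
elim: r => [|r [s sP]].
  by exists [:: 1%g] => w; rewrite leqn0 => /nilP ->; rewrite word_val_nil inE.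
exists (1%g :: [seq (a * g)%g | a <- enum_fset S, g <- s]) => -[|a w].
  by rewrite word_val_nil inE eqxx.
move=> /= sw; rewrite word_val_cons inE; apply/orP; right.
by apply/allpairsP; exists (val a, word_val w); split; rewrite ?sP //; exact: valP.
Qed.

Lemma wlen_geo g r : r <= wlen g ->
  exists2 h, wlen h = r & wlen (h^-1 * g)%g = wlen g - r.
Proof.
have [w wE ws] := wlen_word g => rw.
have E : (word_val (take r w) * word_val (drop r w))%g = g.
  by rewrite -word_val_cat cat_take_drop.
have := wlen_le (take r w); have := wlen_le (drop r w).
rewrite size_drop size_takel ws // => h1 h2.
have := wlenM (word_val (take r w)) (word_val (drop r w)); rewrite E => h3.
exists (word_val (take r w)); first by lia.
by rewrite -[X in (_ * X)%g]E mulKg; lia.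
Qed.

Definition geodesic_word (w : word S) := wlen (word_val w) = size w.

Lemma geodesic_take (w : word S) k m : geodesic_word w -> k <= m <= size w ->
  wlen ((word_val (take k w))^-1 * word_val (take m w))%g = m - k.
Proof.
move=> gw /andP[km mw].
set a := take k w; set b := drop k (take m w); set c := drop m w.
have Em : take m w = a ++ b by rewrite /a -(take_takel w km) cat_take_drop.
have Ew : w = a ++ b ++ c by rewrite catA -Em cat_take_drop.
have sa : size a = k by rewrite size_takel //; lia.
have sb : size b = m - k by rewrite size_drop size_takel.
have sc : size c = size w - m by rewrite size_drop.
have ha := wlen_le a; have hb := wlen_le b; have hc := wlen_le c.
move: gw; rewrite /geodesic_word {1}Ew !word_val_cat Em word_val_cat mulKg => gw.
have h1 := wlenM (word_val a) (word_val b * word_val c)%g.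
have h2 := wlenM (word_val b) (word_val c).
lia.
Qed.

End WordLength.

(** * Geodesic words as geodesics of the Cayley graph *)

Section WordGeodesics.
Variables (R : realType) (G : groupType) (S : {fset G}).
Hypotheses (symS : symmetric_set S) (genS : generating_set S).
Local Notation wlen := (wlen genS).
Local Notation cpoint := (cayley_point R S).
Local Open Scope ring_scope.

(** [EdgePoint] needs a proof that t lies strictly between 0 and 1. The default is the initial
    vertex, the right value at t = 0, which is the only excluded value that [wpath] meets on its
    interval. *)
Definition edge_point (g : G) (a : S) (t : R) : cpoint :=
  match @idP (0 < t < 1) with
  | ReflectT h => EdgePoint g a h
  | ReflectF _ => Vertex R S g
  end.

Variables (g0 : G) (w : word S).
Hypothesis gw : geodesic_word genS w.

Definition vert k : G := (g0 * word_val (take k w))%g.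

Definition wpath (t : R) : cpoint :=
  let k := Num.truncn t in
  if drop k w is a :: _ then edge_point (vert k) a (t - k%:R)
  else Vertex R S (vert k).

Lemma vert_dist k m : (k <= m <= size w)%N -> wlen ((vert k)^-1 * vert m)%g = (m - k)%N.
Proof. by move=> km; rewrite /vert invgM -mulgA mulKg; apply: geodesic_take. Qed.

Lemma vert_dist_le k m : (k <= size w)%N -> (m <= size w)%N ->
  `|k%:R - m%:R| <= (wlen ((vert k)^-1 * vert m)%g)%:R :> R.
Proof.
move=> kw mw; case/orP: (leq_total k m) => km.
  by rewrite vert_dist ?km // distrC -natrB // normr_nat.
by rewrite -(wlenV symS) invgM invgK vert_dist ?km // -natrB // normr_nat.
Qed.

Lemma drop_vert k a s : drop k w = a :: s -> (k < size w)%N /\ vert k.+1 = (vert k * val a)%g.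
Proof.
move=> E; have kw : (k < size w)%N.
  by rewrite ltnNge; apply/negP => /drop_oversize; rewrite E.
split=> //; rewrite /vert (take_nth a) // -cats1 word_val_cat word_val_cons word_val_nil mulg1 mulgA.
by rewrite -[k in nth _ _ k]addn0 -nth_drop E.
Qed.

Lemma wpathP t : 0 <= t <= (size w)%:R ->
  (exists k, [/\ (k <= size w)%N, t = k%:R & wpath t = Vertex R S (vert k)]) \/
  (exists k a (h : 0 < t - k%:R < 1), [/\ (k < size w)%N, k%:R < t < k%:R + 1,
     vert k.+1 = (vert k * val a)%g & wpath t = EdgePoint (vert k) a h]).
Proof.
case/andP=> t0 tw; have /andP[k1] := truncn_itv t0; rewrite -natr1 => k2.
have kw : (Num.truncn t <= size w)%N by rewrite -(ler_nat R); apply: le_trans tw.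
rewrite /wpath; set k := Num.truncn t in k1 k2 kw *.
case E: (drop k w) => [|a s].
  left; exists k; split=> //; apply/eqP; rewrite eq_le k1 andbT.
  apply: le_trans tw _; rewrite ler_nat -subn_eq0 -size_drop E //.
have [kw' kv] := drop_vert E.
rewrite /edge_point; case: {-}_ / idP => h.
  by right; exists k, a, h; split=> //; apply/andP; lra.
left; exists k; split=> //; apply/eqP; rewrite eq_le k1 andbT leNgt.
by apply: contra_notN h => h; apply/andP; lra.
Qed.

Lemma to_vertex_wpath t g r : 0 <= t <= (size w)%:R -> to_vertex (wpath t) g r ->
  exists k, [/\ (k <= size w)%N, g = vert k & r = `|t - k%:R|].
Proof.
move=> /wpathP[[k [kw -> ->]] /= [-> ->]|[k [a [h [kw /andP[h1 h2] kv ->]]]] /=].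
  by exists k; split=> //; rewrite subrr normr0.
case=> [[-> ->]|[-> ->]]; first by exists k; split; rewrite 1?ltnW // ger0_norm //; lra.
exists k.+1; split=> //; rewrite -natr1 ler0_norm; lra.
Qed.

Lemma wpath_to_vertex t : 0 <= t <= (size w)%:R ->
  exists k m, [/\ (k <= m <= k.+1)%N, (m <= size w)%N, k%:R <= t <= m%:R,
    to_vertex (wpath t) (vert k) (t - k%:R) & to_vertex (wpath t) (vert m) (m%:R - t)].
Proof.
move=> /wpathP[[k [kw -> ->]] |[k [a [h [kw /andP[h1 h2] kv ->]]]]].
  by exists k, k; rewrite leqnn leqnSn lexx; split=> //=; rewrite subrr.
exists k, k.+1; rewrite leqnSn leqnn -natr1; split => //=; first by apply/andP; lra.
  by left.
by right; split; [exact: kv | rewrite opprB addrAC addrC addrA].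
Qed.

Lemma wpath_lower s t r : 0 <= s <= (size w)%:R -> 0 <= t <= (size w)%:R ->
  path_length (wpath s) (wpath t) r -> `|s - t| <= r.
Proof.
move=> sw tw [|[g [v [s' [t' [vs vt ->]]]]]]; last first.
  have [k [kw kE ->]] := to_vertex_wpath sw vs.
  have [m [mw mE ->]] := to_vertex_wpath tw vt.
  have : (wlen ((vert k)^-1 * vert m)%g <= size v)%N.
    by rewrite -kE -mE mulKg wlen_le.
  rewrite -(ler_nat R); move: (vert_dist_le kw mw) => h1 h2.
  have h3 := le_trans h1 h2.
  have -> : s - t = (s - k%:R) + (k%:R - m%:R) + (m%:R - t) by ring.
  rewrite (distrC t); apply: le_trans (ler_normD _ _) _; rewrite lerD2r.
  by apply: le_trans (ler_normD _ _) _; rewrite lerD2l.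
have [[k [kw -> ->]]|[k [a [h [kw /andP[h1 h2] kv ->]]]]] //= := wpathP sw.
have [[m [mw -> ->]]|[m [b [h' [mw /andP[h1' h2'] mv ->]]]]] //= := wpathP tw.
case=> [[E _ ->]|[_ E bE _]].
  have : `|k%:R - m%:R| <= (0 : nat)%:R :> R.
    by rewrite (le_trans (vert_dist_le (ltnW kw) (ltnW mw))) // E mulVg wlen1.
  by rewrite normr_le0 subr_eq0 => /eqP E'; rewrite E' opprB addrA subrK lexx.
(* Remaining case: the second edge is the first one reversed. It then starts where edge k ends, so
   it is the next edge, and the word returns to [vert k] after two letters, which a geodesic word
   cannot do. *)
have km : m = k.+1.
  have : `|k.+1%:R - m%:R| <= (0 : nat)%:R :> R.
    by rewrite (le_trans (vert_dist_le kw (ltnW mw))) // kv E mulVg wlen1.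
  by rewrite normr_le0 subr_eq0 eqr_nat => /eqP.
have D : wlen ((vert k)^-1 * vert m.+1)%g = (m.+1 - k)%N.
  by apply: vert_dist; apply/andP; split=> //; rewrite km ltnW ?leqnSn.
have E' : vert m.+1 = vert k by rewrite mv E (_ : val b = (val a)^-1)%g // mulgK.
by move: D; rewrite E' mulVg wlen1 km -addn2 addKn.
Qed.

Lemma wpath_between s t k m : (k <= m <= size w)%N ->
  to_vertex (wpath s) (vert k) (k%:R - s) -> to_vertex (wpath t) (vert m) (t - m%:R) ->
  path_length (wpath s) (wpath t) (t - s).
Proof.
move=> /andP[km mw] vs vt.
right; exists (vert k), (drop k (take m w)), (k%:R - s), (t - m%:R); split=> //.
  suff -> : (vert k * word_val (drop k (take m w)))%g = vert m by [].
  by rewrite /vert -mulgA -word_val_cat -[in X in X ++ _](take_takel w km) cat_take_drop.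
rewrite size_drop size_takel // natrB //; ring.
Qed.

Lemma wpath_upper s t : 0 <= s <= t -> t <= (size w)%:R ->
  path_length (wpath s) (wpath t) (t - s).
Proof.
move=> /andP[s0 st] tw.
have sw : 0 <= s <= (size w)%:R by rewrite s0 (le_trans st).
have tw' : 0 <= t <= (size w)%:R by rewrite tw (le_trans s0).
have [[k [kw sE Es]]|[k [a [h [kw /andP[h1 h2] kv Es]]]]] := wpathP sw;
have [[m [mw tE Et]]|[m [b [h' [mw /andP[h1' h2'] mv Et]]]]] := wpathP tw'.
- have km : (k <= m)%N by rewrite -(ler_nat R) -sE -tE.
  apply: (@wpath_between _ _ k m); first by rewrite km.
    by rewrite Es sE subrr.
  by rewrite Et tE subrr.
- have km : (k <= m)%N by rewrite -ltnS -(ltr_nat R) -sE -natr1; apply: le_lt_trans h2'.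
  apply: (@wpath_between _ _ k m); first by rewrite km ltnW.
    by rewrite Es sE subrr.
  by rewrite Et; left.
- have km : (k < m)%N by rewrite -(ltr_nat R) -tE; apply: lt_le_trans st.
  apply: (@wpath_between _ _ k.+1 m); first by rewrite km.
    by rewrite Es; right; split; [|rewrite -natr1; ring].
  by rewrite Et tE subrr.
have: (k <= m)%N.
  by rewrite -ltnS -(ltr_nat R) -natr1; apply: lt_trans h1 (le_lt_trans st h2').
rewrite leq_eqVlt => /orP[/eqP km|km]; last first.
  apply: (@wpath_between _ _ k.+1 m); first by rewrite km ltnW.
    by rewrite Es; right; split; [|rewrite -natr1; ring].
  by rewrite Et; left.
subst m; rewrite Es Et; left; left; split=> //.
  by apply/val_inj/(mulgI (vert k)); rewrite -kv -mv.
rewrite ler0_norm; [ring | lra].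
Qed.

Lemma along_edge_sym (x y : cpoint) r : along_edge x y r -> along_edge y x r.
Proof.
case: x y => [g|g a s hs] [h|h b t ht] //= [[-> -> ->]|[a1 -> bE ->]].
  by left; rewrite distrC.
right; split=> //=; rewrite ?bE ?invgK ?mulgK ?invg_eq1 //.
have -> : t - (1 - s) = s - (1 - t) by ring.
by [].
Qed.

Lemma path_length_sym (x y : cpoint) r : path_length x y r -> path_length y x r.
Proof.
case=> [/along_edge_sym|[g [v [s [t [vs vt ->]]]]]]; first by left.
have [v' vE vS] := word_inv symS v.
right; exists (g * word_val v)%g, v', t, s; rewrite vE mulgK vS; split=> //; ring.
Qed.

Lemma wpath_isometry s t : 0 <= s <= (size w)%:R -> 0 <= t <= (size w)%:R ->
  cayley_dist (wpath s) (wpath t) = `|s - t|.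
Proof.
move=> sw tw.
have P : path_length (wpath s) (wpath t) `|s - t|.
  case/andP: (sw) => s0 sw'; case/andP: (tw) => t0 tw'.
  case: (leP s t) => st.
    by rewrite distrC ger0_norm ?subr_ge0 //; apply: wpath_upper => //; rewrite s0.
  apply: path_length_sym; rewrite ger0_norm ?subr_ge0 ?(ltW st) //.
  by apply: wpath_upper => //; rewrite t0 ltW.
apply/eqP; rewrite eq_le; apply/andP; split.
  by apply: ge_inf => //; exists `|s - t| => r; apply: wpath_lower.
by apply: lb_le_inf; [exists `|s - t| | move=> r; apply: wpath_lower].
Qed.

Definition word_geodesic : geodesic R S :=
  Geodesic (ler0n R (size w)) wpath_isometry.

Lemma word_geodesic_vert k : (k <= size w)%N -> word_geodesic k%:R = Vertex R S (vert k).
Proof.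
move=> kw; rewrite /= /wpath natrK /edge_point; case: drop => // a s.
case: {-}_ / idP => // h; exfalso; move: (h); rewrite subrr ltxx //.
Qed.

End WordGeodesics.

(** * From slim triangles to the four-point condition *)

Section Slim.
Variables (R : realType) (G : groupType) (S : {fset G}).
Hypotheses (symS : symmetric_set S) (genS : generating_set S) (hypS : hyperbolic R S).
Local Notation wlen := (wlen genS).
Local Notation d x y := (wlen (x^-1 * y)%g).
Local Open Scope ring_scope.

(** The added 1 is the slack with which the infimum [cayley_dist] is approached. A path from a
    vertex to a point of the geodesic passes through a vertex of the geodesic next to that point, so
    the edge itself costs nothing. *)
Lemma vertex_near g0 w (gw : geodesic_word genS w) p (delta : R) y :
  on_geodesic (word_geodesic R symS g0 gw) y -> cayley_dist (Vertex R S p) y <= delta ->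
  exists2 k, (k <= size w)%N & (d p (vert g0 w k))%:R <= delta + 1.
Proof.
move=> [t tw ->] pd.
have [|e] := @inf_adherent R [set r | path_length (Vertex R S p) (word_geodesic R symS g0 gw t) r]%classic 1 ltr01.
  split; last by exists 0 => r [//|[g [v [s' [t' [vs vt ->]]]]]];
    case: vs => _ ->; have [k [_ _ ->]] := to_vertex_wpath tw vt; rewrite add0r addr_ge0.
  have [k [m [_ mw _ _ vt]]] := wpath_to_vertex g0 tw.
  have [v vE] := genS (p^-1 * vert g0 w m)%g.
  eexists; right; exists p, v, 0; eexists; split; [by [] | | reflexivity].
  by rewrite vE mulVKg; exact: vt.
case=> [//|[g [v [s' [t' [vs vt ->]]]]]] lt.
case: vs => ? ?; subst g s'; have [k [kw kE tE]] := to_vertex_wpath tw vt.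
exists k => //; rewrite -kE mulKg; apply: (@le_trans _ _ (size v)%:R).
  by rewrite ler_nat wlen_le.
move: (lt) (normr_ge0 (t - k%:R)); rewrite add0r tE => {}lt n0.
have : inf [set r | path_length (Vertex R S p) (word_geodesic R symS g0 gw t) r]%classic <= delta.
  exact: pd.
lra.
Qed.

Lemma vertex_dist0 g : cayley_dist (Vertex R S g) (Vertex R S g) = 0.
Proof.
have P : path_length (Vertex R S g) (Vertex R S g) 0.
  right; exists g, [::], 0, 0; split=> //=; last by rewrite !addr0.
  by rewrite word_val_nil mulg1.
have L : lbound [set r | path_length (Vertex R S g) (Vertex R S g) r]%classic 0.
  by move=> r [//|[h [v [s' [t' [[_ ->] [_ ->] ->]]]]]]; rewrite addr0 add0r.
apply/eqP; rewrite eq_le; apply/andP; split.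
  by apply: ge_inf => //; exists 0.
by apply: lb_le_inf => //; exists 0.
Qed.

Lemma geodesic_to x y : exists2 w : word S, geodesic_word genS w & y = (x * word_val w)%g.
Proof.
have [w wE ws] := wlen_word genS (x^-1 * y)%g.
by exists w; [rewrite /geodesic_word wE ws | rewrite wE mulVKg].
Qed.

(** The side from x to y can be chosen through p: a geodesic word to p followed by one from p to y
    is geodesic because p lies between x and y. *)
Lemma slim_vertices : exists delta : nat, forall x y z p : G,
  (d x p + d p y = d x y)%N ->
  exists2 q, ((d x q + d q z = d x z) \/ (d z q + d q y = d z y))%N & (d p q <= delta)%N.
Proof.
case: hypS => delta d0 slim; exists (Num.truncn (delta + 1)).+1 => x y z p xpy.
have [w1 gw1 pE] := geodesic_to x p; have [w2 gw2 yE] := geodesic_to p y.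
have [w3 gw3 zE] := geodesic_to y z; have [w4 gw4 xE] := geodesic_to z x.
have gw : geodesic_word genS (w1 ++ w2).
  rewrite /geodesic_word word_val_cat size_cat -gw1 -gw2.
  have <- : (x^-1 * p = word_val w1)%g by rewrite pE mulKg.
  have <- : (p^-1 * y = word_val w2)%g by rewrite yE mulKg.
  by rewrite mulgA mulgK xpy.
have T : geodesic_triangle (word_geodesic R symS x gw) (word_geodesic R symS y gw3)
   (word_geodesic R symS z gw4).
  have E0 g v (gv : geodesic_word genS v) : word_geodesic R symS g gv 0 = Vertex R S g.
    by rewrite -[0]/(0%:R) word_geodesic_vert // /vert take0 word_val_nil mulg1.
  have E1 g v (gv : geodesic_word genS v) :
      word_geodesic R symS g gv (geo_len (word_geodesic R symS g gv)) = Vertex R S (g * word_val v)%g.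
    by rewrite [geo_len _]/= word_geodesic_vert // /vert take_size.
  by split; rewrite E0 E1 ?word_val_cat ?mulgA -?pE -?yE -?zE -?xE vertex_dist0.
have [/(_ (Vertex R S p)) + _ _] := slim _ _ _ T.
case.
  exists (size w1)%:R; first by rewrite ler0n ler_nat size_cat leq_addr.
  by rewrite word_geodesic_vert ?size_cat ?leq_addr // /vert take_size_cat // pE.
have bound q : (d p q)%:R <= delta + 1 -> (d p q <= (Num.truncn (delta + 1)).+1)%N.
  move=> h; rewrite -(ler_nat R); apply: le_trans h _.
  by apply: ltW; rewrite (andP (truncn_itv _)).2 // addr_ge0.
have on g v (gv : geodesic_word genS v) k : (k <= size v)%N ->
    (d g (vert g v k) + d (vert g v k) (g * word_val v) = d g (g * word_val v))%N.
  move=> kv; have h1 := @vert_dist G S genS g v gv 0 k; have h2 := @vert_dist G S genS g v gv k (size v).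
  move: h1 h2; rewrite /vert take0 word_val_nil mulg1 take_size => -> // ->; last by rewrite kv leqnn.
  by rewrite mulKg gv subn0 subnKC.
have sym a b : d a b = d b a by rewrite -(wlenV symS) invgM invgK.
move=> q [on2|on3] pq; [have [k kw dk] := vertex_near on2 pq | have [k kw dk] := vertex_near on3 pq].
  exists (vert y w3 k); last exact: bound.
  by right; have := on y _ gw3 _ kw; rewrite -zE sym [d _ z]sym addnC [d y z]sym.
exists (vert z w4 k); last exact: bound.
by left; have := on z _ gw4 _ kw; rewrite -xE sym [d _ x]sym addnC [d z x]sym.
Qed.

End Slim.

Section FourPoint.
Variables (G : groupType) (S : {fset G}).
Hypotheses (symS : symmetric_set S) (genS : generating_set S).
Local Notation wlen := (wlen genS).
Local Notation d x y := (wlen (x^-1 * y)%g).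

Lemma wdist_sym x y : d x y = d y x.
Proof. by rewrite -(wlenV symS) invgM invgK. Qed.

Lemma wdist_triangle x y z : d x z <= d x y + d y z.
Proof. by rewrite -(mulVKg y z) mulgA mulKg wlenM. Qed.

Variable delta : nat.
Hypothesis slim : forall x y z p : G, d x p + d p y = d x y ->
  exists2 q, (d x q + d q z = d x z \/ d z q + d q y = d z y) & d p q <= delta.

Lemma slim_detour x y z p : d x p + d p y = d x y ->
  d x p + d p z <= d x z + 2 * delta \/ d y p + d p z <= d y z + 2 * delta.
Proof.
move=> /(@slim _ _ z)[q [H|H] pq]; [left|right].
  have := wdist_triangle x q p; have := wdist_triangle p q z; have := wdist_sym p q; lia.
have := wdist_triangle y q p; have := wdist_triangle p q z; have := wdist_sym p q.
have := wdist_sym y q; have := wdist_sym z q; have := wdist_sym y z; lia.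
Qed.

(** On a geodesic from x to z, p is the last vertex with the first alternative of [slim_detour].
    Unless p is z, the next vertex has the second one, and one step back costs at most 2. *)
Lemma slim_center x y z : exists p, [/\ d x p + d p z = d x z,
  d x p + d p y <= d x y + 2 * delta + 2 & d z p + d p y <= d z y + 2 * delta + 2].
Proof.
have [w wE ws] := wlen_word genS (x^-1 * z)%g.
pose p r := (x * word_val (take r w))%g.
have gw : geodesic_word genS w by rewrite /geodesic_word wE ws.
have pd r m : r <= m <= d x z -> d (p r) (p m) = m - r.
  by move=> rm; rewrite /p invgM -mulgA mulKg geodesic_take // ws.
have p0 : p 0 = x by rewrite /p take0 word_val_nil mulg1.
have pz : p (d x z) = z by rewrite /p -ws take_size wE mulVKg.
have dx r : r <= d x z -> d x (p r) = r by move=> h; rewrite -{1}p0 pd ?subn0.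
have dz r : r <= d x z -> d (p r) z = d x z - r by move=> h; rewrite -{1}pz pd ?h //=.
pose N r := (r <= d x z) && (d x (p r) + d (p r) y <= d x y + 2 * delta).
have N0 : exists r, N r by exists 0; rewrite /N dx //= p0 //; lia.
have Nb r : N r -> r <= d x z by case/andP.
case: (ex_maxnP N0 Nb) => r /andP[rz Nr] rmax; exists (p r); rewrite dx // dz //.
rewrite dx // in Nr; have zp := dz _ rz; rewrite wdist_sym in zp.
split; [lia|lia|rewrite zp].
case: (ltnP r (d x z)) => rz'; last first.
  have rE : r = d x z by lia.
  rewrite rE pz; lia.
have := @slim_detour x z y (p r.+1); rewrite dx // dz // => -[|H|H]; first by lia.
  have := rmax r.+1; rewrite /N rz' /= dx // => /(_ H); lia.
have := wdist_sym z (p r.+1); rewrite dz // => zp1.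
have := @wdist_triangle (p r) (p r.+1) y; rewrite pd ?leqnSn //; lia.
Qed.

(** Let p be a centre of x, y, z. By [slim_detour] the way to w through p is nearly shortest from x
    or from z, and the way to y through p is nearly shortest from both. The lengths from p to x, y,
    z, w add up to at least the left-hand side and regroup into one of the two sums. *)
Lemma wlen_4pt x y z w : d x z + d y w <= maxn (d x y + d z w) (d x w + d y z) + (4 * delta + 4).
Proof.
have [p [pE h1 h2]] := slim_center x y z.
have := wdist_triangle y p w; have := wdist_sym y p; have := wdist_sym p z; have := wdist_sym z y.
by case: (@slim_detour x z w p pE); lia.
Qed.

End FourPoint.

(** The real-valued Cayley graph is left behind here; the geometry that follows rests on
    [hyp_length] alone. *)
Lemma hyperbolic_length (R : realType) (G : groupType) (S : {fset G})
    (symS : symmetric_set S) (genS : generating_set S) :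
  hyperbolic R S -> exists K, hyp_length (wlen genS) K.
Proof.
move=> hypS; have [delta slim] := slim_vertices symS genS hypS.
exists (4 * delta + 4); split.
- exact: wlen1.
- exact: wlen_eq0.
- exact: wlenV.
- exact: wlenM.
- exact: wlen_geo.
- exact: wlen_fin.
- by move=> x y z w; apply: wlen_4pt.
Qed.

(** * Powers and their orbits *)

Lemma pigeonhole (T : eqType) (s : seq T) (f : nat -> T) :
  (forall i, i <= size s -> f i \in s) -> exists i j, [/\ i < j, j <= size s & f i = f j].
Proof.
move=> fs; pose t := [seq f i | i <- iota 0 (size s).+1].
have nu : ~~ uniq t.
  apply/negP => ut; have := @uniq_leq_size _ t s ut; rewrite size_map size_iota ltnn.
  suff : {subset t <= s} by move=> h /(_ h).
  by move=> y /mapP[i]; rewrite mem_iota => /andP[_ h] ->; apply: fs.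
have [i [j [ij js]]] := elimT (uniqPn (f 0)) nu.
move: js; rewrite size_map size_iota => js.
rewrite !(nth_map 0) ?size_iota ?(ltn_trans ij) // !nth_iota ?(ltn_trans ij) //.
by exists i, j.
Qed.

Section Geometry.
Variables (G : groupType) (l : G -> nat) (K : nat).
Hypothesis hypl : hyp_length l K.

Definition gmul (x y : G) : G := (x * y)%g.
Definition ginv (x : G) : G := (x^-1)%g.
Definition gpow (x : G) (n : nat) : G := (x ^+ n)%g.
Definition gone : G := 1%g.
Definition dist (x y : G) : nat := l (gmul (ginv x) y).
Local Notation d := dist.
Local Notation "x ** y" := (gmul x y) (at level 40, left associativity).
Local Notation "x ^^ n" := (gpow x n) (at level 29, left associativity).
Implicit Types (x y z w a b p g h u : G) (m n r : nat).

Lemma gmulA x y z : x ** (y ** z) = x ** y ** z. Proof. exact: mulgA. Qed.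
Lemma gmul1 x : x ** gone = x. Proof. exact: mulg1. Qed.
Lemma g1mul x : gone ** x = x. Proof. exact: mul1g. Qed.
Lemma gmulV x : x ** ginv x = gone. Proof. exact: mulgV. Qed.
Lemma gVmul x : ginv x ** x = gone. Proof. exact: mulVg. Qed.
Lemma gmulK x y : ginv x ** (x ** y) = y. Proof. exact: mulKg. Qed.
Lemma gmulVK x y : x ** (ginv x ** y) = y. Proof. exact: mulVKg. Qed.
Lemma gpow0 x : x ^^ 0 = gone. Proof. by []. Qed.
Lemma gpow1 x : x ^^ 1 = x. Proof. by []. Qed.
Lemma gpowS x n : x ^^ n.+1 = x ** x ^^ n. Proof. exact: expgS. Qed.
Lemma gpowD x m n : x ^^ (m + n) = x ^^ m ** x ^^ n. Proof. exact: expgnDr. Qed.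
Lemma gpowM x m n : x ^^ (m * n) = x ^^ m ^^ n. Proof. exact: expgnA. Qed.
Lemma gpow_one n : gone ^^ n = gone. Proof. exact: expg1n. Qed.
Lemma gmul_inj g x y : g ** x = g ** y -> x = y. Proof. exact: mulgI. Qed.
Lemma gmul_injr g x y : x ** g = y ** g -> x = y. Proof. exact: mulIg. Qed.
Lemma gpow_conj u x n : (ginv x ** (u ** x)) ^^ n = ginv x ** (u ^^ n ** x).
Proof. by rewrite /gpow /gmul -[(ginv x * (u * x))%g]/(u ^ x)%g -conjXg. Qed.

Lemma dxx x : d x x = 0. Proof. by rewrite /d gVmul (hl1 hypl). Qed.
Lemma d_sym x y : d x y = d y x.
Proof. by rewrite /d -(hlV hypl) /gmul /ginv invgM invgK. Qed.
Lemma d_tri y x z : d x z <= d x y + d y z.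
Proof. by rewrite /d -{1}(gmulVK y z) gmulA (hlM hypl). Qed.
Lemma d_mul g x y : d (g ** x) (g ** y) = d x y.
Proof. by rewrite /d /gmul /ginv invgM -mulgA mulKg. Qed.
Lemma d_eq0 x y : d x y = 0 -> x = y.
Proof. by move=> /(hl_eq0 hypl) /mulg1_eq; rewrite /ginv invgK. Qed.
Lemma d_4pt x y z w : d x z + d y w <= maxn (d x y + d z w) (d x w + d y z) + K.
Proof. exact: (hl_4pt hypl). Qed.
Lemma d1 g : d gone g = l g. Proof. by rewrite /d /gmul /ginv /gone invg1 mul1g. Qed.

Lemma l_gpow u n : l (u ^^ n) <= n * l u.
Proof.
elim: n => [|n IH]; first by rewrite gpow0 (hl1 hypl).
by rewrite gpowS mulSn (leq_trans (hlM hypl _ _)) // leq_add2l.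
Qed.

Lemma d_gpow u x n : d x (u ^^ n ** x) <= n * d x (u ** x).
Proof. by rewrite /d -gpow_conj l_gpow. Qed.

Lemma d_geo x y r : r <= d x y -> exists p, d x p = r /\ d p y = d x y - r.
Proof.
move=> /(hl_geo hypl)[h hr hd]; exists (x ** h).
rewrite /d gmulK; split=> //; rewrite -hd.
by rewrite /gmul /ginv invgM -mulgA.
Qed.

(** Two uses of the four-point condition replace the end a' by a and then b' by b, each at the cost
    K. The depth M + K of y excludes the other alternative both times. *)
Lemma quadrilateral a b a' b' y M : d a' y + d y b' = d a' b' ->
  d a a' <= M -> d b b' <= M -> M + K < d a' y -> M + K < d y b' ->
  d a y + d y b <= d a b + 2 * K.
Proof.
move=> y1 a1 b1 ya yb.
have := d_4pt a a' y b'; have := d_4pt a y b' b.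
have := d_tri a a' y; have := d_tri b y b'; have := d_tri b' a b.
have := d_sym b' b; have := d_sym b' y; have := d_sym y a'; have := d_sym a a'; have := d_sym y b; lia.
Qed.

Lemma near_geodesic a b p y e : d a p + d p b = d a b -> d a y + d y b <= d a b + e ->
  d p y <= (d a y - d a p) + (d a p - d a y) + e + K.
Proof.
move=> ap ay; have := d_4pt p a y b; have := d_sym p y; have := d_sym p a.
have := d_sym a y; lia.
Qed.

(** The distances a m from x to g^m x increase strictly. In the four-point condition for x, g x, g^2
    x and g^(m+2) x, one alternative would give a (m+1) < a m because a 2 exceeds a 1 + K; the other
    gives a (m+1) < a (m+2). *)
Lemma two_step_growth g x : d x (g ** x) + K < d x (g ** (g ** x)) ->
  forall m, m <= d x (g ^^ m ** x).
Proof.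
move=> h; pose a m := d x (g ^^ m ** x).
have e m : g ^^ m.+1 ** x = g ** (g ^^ m ** x) by rewrite gpowS gmulA.
have a1 : a 1 = d x (g ** x) by rewrite /a gpow1.
suff A m : a m < a m.+1 by elim=> // m IH; apply: leq_ltn_trans IH (A m).
elim: m => [|m IH].
  rewrite {1}/a gpow0 g1mul dxx a1.
  have := d_tri (g ** x) x (g ** (g ** x)); rewrite d_mul; lia.
have := d_4pt x (g ** x) (g ** (g ** x)) (g ^^ m.+2 ** x).
rewrite !e !d_mul -!e -/(a m) -/(a m.+1) -/(a m.+2) -a1; move: h; rewrite -a1; lia.
Qed.

(** High powers outweigh the change of base point from x to 1. If j l(u^N) were less than N, the
    M-th power would fall short by M in all, while the base point accounts for only 2 l(x) = M -
    1. *)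
Lemma growth_stable u j x : (forall m, m <= d x (u ^^ (j * m) ** x)) ->
  forall N, N <= j * l (u ^^ N).
Proof.
move=> gr N; rewrite leqNgt; apply/negP => lt.
pose M := (l x).*2.+1.
have := gr (N * M).
have -> : j * (N * M) = N * (j * M) by rewrite mulnCA.
rewrite gpowM; set v := _ ^^ _ => h1.
have h2 : l v <= j * M * l (u ^^ N) by apply: l_gpow.
have h3 := d_tri (v ** gone) x (v ** x).
have h4 := d_tri gone x (v ** gone).
rewrite d_mul !gmul1 (d_sym gone x) in h3; rewrite gmul1 in h4; have h5 := d_sym x gone; rewrite (d1 x) in h5.
have h6 : j * M * l (u ^^ N) <= (N - 1) * M.
  by rewrite -mulnA (mulnC M) mulnA leq_mul2r; apply/orP; right; lia.
have h7 : N * M = (N - 1) * M + M by rewrite mulnBl mul1n subnK // leq_pmull //; lia.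
have hM : M = (l x).*2.+1 by [].
rewrite d1 in h4; clearbody M; lia.
Qed.

(* u^j moves the midpoint of [a, b] along the geodesic; a translation of more
   than 5K + 1 is doubled by u^(2j), up to an additive error K. *)
Lemma long_segment_dichotomy (u a b : G) J0 M :
  (forall s, s <= 2 * J0 -> d a (u ^^ s ** a) <= M /\ d b (u ^^ s ** b) <= M) ->
  8 * M + 20 * K + 20 <= d a b ->
  (exists y, forall s, s <= J0 -> d y (u ^^ s ** y) <= 8 * K + 1) \/
  exists j y, 0 < j <= J0 /\ d y (u ^^ j ** y) + K < d y (u ^^ j ** (u ^^ j ** y)).
Proof.
move=> moves ab; pose r := (d a b)./2.
have [|y [ay yb]] := @d_geo a b r; first by rewrite /r; lia.
have rb : 4 * M + 10 * K + 9 <= r /\ r <= d a b - r by rewrite /r; lia.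
have near s : s <= 2 * J0 -> d a (u ^^ s ** y) + d (u ^^ s ** y) b <= d a b + 2 * K.
  move=> /moves[ma mb].
  apply: (@quadrilateral _ _ (u ^^ s ** a) (u ^^ s ** b) _ M) => //; rewrite !d_mul; lia.
pose t s := (d a (u ^^ s ** y) - r) + (r - d a (u ^^ s ** y)).
have yy s : s <= 2 * J0 -> d y (u ^^ s ** y) <= t s + 3 * K.
  by move=> /near ns; have := @near_geodesic a b y (u ^^ s ** y) (2 * K); rewrite /t; lia.
case: (boolP (all (fun s => t s <= 5 * K + 1) (iota 0 J0.+1))) => [/allP small|/allPn[j]].
  left; exists y => s sJ; have := yy s; have := small s; rewrite mem_iota; lia.
rewrite mem_iota -ltnNge => jJ tj; right; exists j, y.
have j0 : 0 < j.
  by case: j tj {jJ} => // ; rewrite /t gpow0 g1mul; lia.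
split; first by lia.
have j2 : j <= 2 * J0 by lia.
have j22 : j + j <= 2 * J0 by lia.
have [ma _] := moves _ j2; have yj := yy _ j2; have n2 := near _ j22.
rewrite gpowD -gmulA in n2; move: tj yj; rewrite /t.
set v := u ^^ j in ma n2 * => tj yj.
have := d_4pt a (v ** a) (v ** y) (v ** (v ** y)).
have := d_4pt a (v ** a) (v ** (v ** y)) (v ** y).
have := d_tri (v ** a) a (v ** y); have := d_tri a (v ** a) (v ** y).
have := d_tri y a (v ** (v ** y)); have := d_sym y a.
have := d_sym (v ** y) (v ** (v ** y)); have := d_sym a (v ** a).
have := d_tri (v ** (v ** y)) a y; have := d_sym y (v ** (v ** y)).
rewrite !d_mul; lia.
Qed.

Lemma ball_pigeonhole R : exists N, forall (f : nat -> G),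
  (forall i, i <= N -> l (f i) <= R) -> exists i j, [/\ i < j, j <= N & f i = f j].
Proof.
by have [s sP] := hl_fin hypl R; exists (size s) => f fR; apply: (@pigeonhole _ s) => i /fR /sP.
Qed.

Lemma gpow_period u i j : i < j -> u ^^ i = u ^^ j -> u ^^ (j - i) = gone.
Proof.
move=> ij E; apply: (@gmul_inj (u ^^ i)).
by rewrite -gpowD subnKC ?(ltnW ij) // -E gmul1.
Qed.

(* All the centres of a minimal ball containing a bounded orbit are at
   distance at most 2K + 1 from each other, and u permutes them. *)
Lemma bounded_orbit_center u R : (forall N, l (u ^^ N) <= R) ->
  exists x, forall s, d x (u ^^ s ** x) <= 2 * K + 1.
Proof.
move=> bnd; have [N /(_ (fun i => u ^^ i) (fun i _ => bnd i))[i [j [ij _ E]]]] := ball_pigeonhole R.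
have uP := gpow_period ij E; set P := j - i in uP; have P0 : 0 < P by rewrite subn_gt0.
pose Q rho := `[< exists x, forall n, d x (u ^^ n) <= rho >].
have exQ : exists rho, Q rho.
  by exists R; apply/asboolP; exists gone => n; rewrite d1.
case: (ex_minnP exQ) => rho /asboolP[x xrho] rmin; exists x => s.
rewrite leqNgt; apply/negP => far.
have xrho' n : d (u ^^ s ** x) (u ^^ n) <= rho.
  (* As u^P = 1, adding [s * P] keeps the exponent nonnegative. *)
  have -> : u ^^ n = u ^^ s ** u ^^ (n + s * P - s).
    rewrite -gpowD; have -> : s + (n + s * P - s) = n + s * P.
      by have := leq_pmulr s P0; lia.
    by rewrite gpowD mulnC gpowM uP gpow_one gmul1.
  by rewrite d_mul.
have [|m [m1 m2]] := @d_geo x (u ^^ s ** x) (d x (u ^^ s ** x))./2; first by lia.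
have := rmin rho.-1.
have : Q rho.-1; last by move=> Qr /(_ Qr) h; have := xrho 0; have := xrho' 0;
  have := d_tri (u ^^ 0) x (u ^^ s ** x); have := d_sym (u ^^ 0) (u ^^ s ** x); lia.
apply/asboolP; exists m => n.
have := d_4pt x m (u ^^ s ** x) (u ^^ n); have := xrho n; have := xrho' n.
have := d_sym x m; lia.
Qed.

(** If the powers up to J0 all move some y by at most 8 K + 1, two of them agree. Such a y is a
    centre of the orbit if the powers of u are bounded, and may come from a long segment otherwise.
    J0 depends only on the ball of radius 8 K + 1, hence not on u. *)
Lemma torsion_or_linear : exists J, 0 < J /\ forall u,
  (exists p : nat, 0 < p <= J /\ u ^^ p = gone) \/ (forall N, N <= J * l (u ^^ N)).
Proof.
have [J0 J0P] := ball_pigeonhole (8 * K + 1).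
exists J0.+1; split=> // u.
have tors y : (forall s, s <= J0 -> d y (u ^^ s ** y) <= 8 * K + 1) ->
    exists p : nat, 0 < p <= J0.+1 /\ u ^^ p = gone.
  move=> yP; have [i [j [ij jJ E]]] := J0P (fun s => ginv y ** (u ^^ s ** y)) yP.
  exists (j - i); split; first by lia.
  by apply: gpow_period ij _; apply: (@gmul_injr y); apply: (@gmul_inj (ginv y)).
pose M := 2 * J0 * l u.
case: (pselect (exists N, 8 * M + 20 * K + 20 <= l (u ^^ N))) => [[N big]|bnd]; last first.
  left; have [|x xP] := @bounded_orbit_center u (8 * M + 20 * K + 20).
    by move=> N; rewrite leqNgt; apply/negP => lt; apply: bnd; exists N; apply: ltnW.
  by apply: (tors x) => s _; apply: leq_trans (xP s) _; lia.
have mv s : s <= 2 * J0 -> l (u ^^ s) <= M.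
  by move=> sJ; apply: leq_trans (l_gpow _ _) _; rewrite leq_mul2r sJ orbT.
(* u^s commutes with u^N, so it moves both ends of the segment from 1 to u^N by the same distance
   l(u^s). *)
case: (@long_segment_dichotomy u gone (u ^^ N) J0 M).
- move=> s /mv sM; rewrite gmul1 d1; split=> //.
  by rewrite -gpowD addnC gpowD -{1}[u ^^ N]gmul1 d_mul d1.
- by rewrite d1.
- by move=> [y /tors]; left.
move=> [j [y [/andP[j0 jJ] gr]]]; right => n.
have : n <= j * l (u ^^ n).
  by apply: (@growth_stable u j y) => m; rewrite gpowM; apply: two_step_growth.
by move/leq_trans; apply; rewrite leq_mul2r ltnW ?orbT.
Qed.

End Geometry.

Local Notation "x ** y" := (gmul x y) (at level 40, left associativity).
Local Notation "x ^^ n" := (gpow x n) (at level 29, left associativity).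

(** * Stability of geodesics along orbits *)

Section Geometry2.
Variables (G : groupType) (l : G -> nat) (K : nat).
Hypothesis hypl : hyp_length l K.
Local Notation d := (dist l).
Implicit Types (x y z w a b h u g : G) (m n r : nat).
Let d_sym := d_sym hypl.
Let d_tri := d_tri hypl.
Let d_mul := d_mul l.
Let d_4pt := d_4pt hypl.

(** At a time t where the loop is farthest from its start, the four-point condition with the points
    K + 1 steps before and after would make one of them farther still. So t is within K of an end,
    the whole loop is within K of its start, and it is too short not to be trivial. This gives the
    window of Dehn's algorithm. *)
Lemma local_geodesic_loop (c : nat -> G) N : c N = c 0 ->
  (forall i j, i <= j <= N -> j - i <= 2 * K + 2 -> d (c i) (c j) = j - i) -> N = 0.
Proof.
move=> cN loc.
have [t tN tmax] : exists2 t, t <= N & forall i, i <= N -> d (c 0) (c i) <= d (c 0) (c t).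
  have ex0 : exists i : 'I_N.+1, true by exists ord0.
  case: (@arg_maxnP _ (@ord0 N) xpredT (fun i => d (c 0) (c i)) isT) => t _ tm.
  by exists t; [rewrite -ltnS | move=> i iN; have := tm (@Ordinal N.+1 i iN) isT].
have small : d (c 0) (c t) <= K -> N = 0.
  move=> tK; case: (leqP N K) => NK.
    by have := loc 0 N; rewrite cN (dxx hypl) => h; rewrite -[N]subn0 -h //; lia.
  by have := tmax K.+1; have := loc 0 K.+1; lia.
case: (leqP t K) => t1; first by apply: small; rewrite loc; lia.
case: (leqP (N - t) K) => t2.
  by apply: small; rewrite d_sym -cN loc; lia.
have := d_4pt (c 0) (c (t - K.+1)) (c t) (c (t + K.+1)).
have := tmax (t - K.+1); have := tmax (t + K.+1).
have := loc (t - K.+1) (t + K.+1); have := loc (t - K.+1) t; have := loc t (t + K.+1).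
have := d_sym (c (t - K.+1)) (c t); lia.
Qed.

(* t halvings of the path, each of which costs K in the four-point condition *)
Lemma log_path (c : nat -> G) p t i e :
  (forall j, i <= j < i + 2 ^ t -> d p (c j) + d p (c j.+1) >= d (c j) (c j.+1) + e) ->
  d (c i) (c (i + 2 ^ t)) + e <= d p (c i) + d p (c (i + 2 ^ t)) + 2 * t * K.
Proof.
elim: t i => [|t IH] i H.
  by have := H i; rewrite addn1; lia.
have h1 : d (c i) (c (i + 2 ^ t)) + e <= d p (c i) + d p (c (i + 2 ^ t)) + 2 * t * K.
  by apply: IH => j ij; apply: H; rewrite expnS; lia.
have h2 : d (c (i + 2 ^ t)) (c (i + 2 ^ t + 2 ^ t)) + e <=
   d p (c (i + 2 ^ t)) + d p (c (i + 2 ^ t + 2 ^ t)) + 2 * t * K.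
  by apply: IH => j ij; apply: H; rewrite expnS; lia.
have -> : i + 2 ^ t.+1 = i + 2 ^ t + 2 ^ t by rewrite expnS; lia.
have := d_4pt (c i) p (c (i + 2 ^ t + 2 ^ t)) (c (i + 2 ^ t)).
have := d_sym (c i) p; have := d_sym (c (i + 2 ^ t)) (c (i + 2 ^ t + 2 ^ t)).
have : 2 * t.+1 * K = 2 * t * K + 2 * K by lia.
have := d_sym p (c (i + 2 ^ t + 2 ^ t)).
set A := 2 * t.+1 * K; set B := 2 * t * K; lia.
Qed.

(** Exponential against linear growth: this closes the estimate of [geodesic_near_orbit], where a
    path of about c D steps is halved t times. *)
Lemma log_bound (c : nat) : exists B, forall D, exists t, c * D.+1 <= 2 ^ t /\ c * t <= D + B.
Proof.
case: c => [|c]; first by exists 0 => D; exists 0; rewrite !mul0n.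
pose t0 := c.+1 * c.+2; exists (c.+1 * t0) => D; pose q := D %/ c.+1.
exists (q + t0); split; last by rewrite mulnDr leq_add2r mulnC leq_trunc_div.
have qD : D < q.+1 * c.+1 by rewrite mulSn addnC -ltn_subLR ?leq_trunc_div // /q;
  have := ltn_pmod D (ltn0Sn c); have := divn_eq D c.+1; lia.
rewrite expnD.
have h1 : q.+1 <= 2 ^ q by apply: ltn_expl.
have h2 : t0 <= 2 ^ t0 by apply/ltnW/ltn_expl.
apply: leq_trans (leq_mul h1 h2); rewrite /t0; nia.
Qed.

Definition linear_growth J h := forall y n, n <= J * d y (h ^^ n ** y).

(** Since J is the same for all elements, a change of base point is absorbed by conjugating u. *)
Lemma torsion_or_linear_growth : exists J, 0 < J /\ forall u,
  (exists p : nat, 0 < p <= J /\ u ^^ p = gone G) \/ linear_growth J u.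
Proof.
have [J [J0 JP]] := torsion_or_linear hypl; exists J; split=> // u.
case: (pselect (exists p : nat, 0 < p <= J /\ u ^^ p = gone G)) => [|nt]; [by left|right=> y n].
case: (JP (ginv y ** (u ** y))) => [[p [pJ E]]|/(_ n)]; last by rewrite gpow_conj.
case: nt; exists p; split=> //; move: E; rewrite gpow_conj => E.
by apply: (@gmul_injr _ y); apply: (@gmul_inj _ (ginv y)); rewrite E g1mul gVmul.
Qed.

Definition discrete_geodesic (c : nat -> G) L := forall i j, i <= j <= L -> d (c i) (c j) = j - i.

Lemma discrete_geodesicP c L i j : discrete_geodesic c L -> i <= L -> j <= L ->
  d (c i) (c j) = (j - i) + (i - j).
Proof.
move=> cg iL jL; case: (leqP i j) => ij; first by rewrite cg ?ij //; lia.
by rewrite d_sym cg; lia.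
Qed.

(** Let D be the least radius that works and [c i0] a point with no orbit point of the segment
    nearer than D. A detour leaves c about 2 D before i0, follows the orbit and comes back about 2 D
    after. By linear growth it has at most 6 J D + 2 steps, and each step has excess at least 2 D -
    n as seen from [c i0]. By [log_path] 2 D - n is then at most 2 K t with t logarithmic in D,
    whence D <= n + B. *)
Lemma geodesic_near_orbit J : exists B, forall h P n (x : nat) c L,
  linear_growth J h -> d P (h ** P) <= n ->
  discrete_geodesic c L -> c 0 = P -> c L = h ^^ x ** P ->
  forall i, i <= L -> exists2 m, m <= x & d (c i) (h ^^ m ** P) <= n + B.
Proof.
have [B BP] := log_bound (6 * J + 2 + 2 * K); exists B => h P n x c L lin hn cg c0 cL.
pose o m := h ^^ m ** P.
pose Q D := `[< forall i, i <= L -> exists2 m, m <= x & d (c i) (o m) <= D >].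
have o0 : o 0 = P by rewrite /o gpow0 g1mul.
have exQ : exists D, Q D.
  by exists L; apply/asboolP => i iL; exists 0 => //; rewrite o0 -c0 (discrete_geodesicP cg); lia.
case: (ex_minnP exQ) => D /asboolP QD Dmin.
suff DB : D <= n + B by move=> i /QD[m mx dm]; exists m => //; apply: leq_trans dm DB.
have [i0 i0L far] : exists2 i0, i0 <= L & forall m, m <= x -> D <= d (c i0) (o m).
  case: D Dmin {QD} => [|D] Dmin; first by exists 0.
  apply: contrapT => H; have := Dmin D; rewrite ltnn => H'; suff: false by [].
  apply: H'; apply/asboolP => i iL; apply: contrapT => H''; apply: H; exists i => // m mx.
  by rewrite ltnNge; apply/negP => le; apply: H''; exists m.
(* If fewer than 2 D steps precede i0, the detour starts at the end of c, which is itself an orbit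
   point. *)
have [i1 [a [ii1 ax a1 a2 a3]]] : exists (i1 a : nat), [/\ i1 <= i0 <= i1 + 2 * D, a <= x,
    d (c i1) (o a) <= D, d (c i1) (o a) + 2 * D <= d (c i0) (c i1) + d (c i0) (o a) & D <= d (c i0) (c i1)].
  case: (leqP (2 * D) i0) => Di.
    have [|m mx dm] := QD (i0 - 2 * D); first by lia.
    exists (i0 - 2 * D), m; have := far m mx.
    by have := discrete_geodesicP cg i0L (_ : i0 - 2 * D <= L); split=> //; lia.
  exists 0, 0; rewrite o0 c0 (dxx hypl); have := far 0; rewrite o0; split=> //; lia.
have [i2 [b [ii2 bx b1 b2 b3]]] : exists (i2 b : nat), [/\ i0 <= i2 <= minn L (i0 + 2 * D), b <= x,
    d (c i2) (o b) <= D, d (c i2) (o b) + 2 * D <= d (c i0) (c i2) + d (c i0) (o b) & D <= d (c i0) (c i2)].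
  case: (leqP (i0 + 2 * D) L) => Di.
    have [|m mx dm] := QD (i0 + 2 * D); first by lia.
    exists (i0 + 2 * D), m; have := far m mx.
    by have := discrete_geodesicP cg i0L (_ : i0 + 2 * D <= L); split=> //; lia.
  exists L, x; rewrite cL (dxx hypl); have := far x; rewrite /o; split=> //; lia.
pose w := (b - a) + (a - b).
have wD : w <= J * (6 * D).
  have dab : d (o a) (o b) <= 6 * D.
    have := d_tri (c i1) (o a) (o b); have := d_tri (c i2) (c i1) (o b).
    have := d_sym (o a) (c i1); rewrite (discrete_geodesicP cg); lia.
  have e m k : d (o m) (o (k + m)) = d (o m) (h ^^ k ** o m).
    by rewrite /o gpowD -gmulA.
  apply: leq_trans (_ : J * d (o a) (o b) <= _); last by rewrite leq_mul2l dab orbT.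
  rewrite /w; case: (leqP a b) => ab.
    by have := lin (o a) (b - a); rewrite -e subnK //; lia.
  by have := lin (o b) (a - b); rewrite -e subnK ?(ltnW ab) // [d (o b) _]d_sym; lia.
pose idx k := if a <= b then a + k else a - k.
(* The final point is repeated to pad the detour to 2^t steps. *)
pose q j := if j is k.+1 then if k <= w then o (idx k) else c i2 else c i1.
have [t [t1 t2]] := BP D.
have tw : w + 2 <= 2 ^ t.
  apply: leq_trans t1; move: wD; rewrite mulnA (mulnC J) => wD; nia.
have := @log_path q (c i0) t 0 (2 * D - n).
have qt : q (2 ^ t) = c i2.
  rewrite /q; case E: (2 ^ t) => [|k]; first by lia.
  by have -> : (k <= w) = false by lia.
rewrite add0n qt [q 0]/= => H.
have := H _; rewrite (discrete_geodesicP cg (_ : i1 <= L) (_ : i2 <= L)); [|lia..].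
rewrite (discrete_geodesicP cg i0L (_ : i1 <= L)); [|lia].
rewrite (discrete_geodesicP cg i0L (_ : i2 <= L)); [|lia].
suff /[swap]/[apply] : forall j, 0 <= j < 2 ^ t ->
    d (q j) (q j.+1) + (2 * D - n) <= d (c i0) (q j) + d (c i0) (q j.+1).
  have : (6 * J + 2 + 2 * K) * t = 6 * J * t + 2 * t + 2 * t * K by lia.
  by set X := 6 * J * t; set Y := 2 * t * K; lia.
have oo k : k <= x -> D <= d (c i0) (o k) by apply: far.
have oS k : d (o k) (o k.+1) <= n by rewrite /o -addn1 gpowD -gmulA d_mul gpow1.
have idx0 : idx 0 = a by rewrite /idx addn0 subn0 if_same.
have idxw : idx w = b by rewrite /idx /w; case: leqP; lia.
have idxx k : k <= w -> idx k <= x by rewrite /idx /w; case: (leqP a b); lia.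
have idxS k : k < w -> d (o (idx k)) (o (idx k.+1)) <= n.
  rewrite /idx /w; case: (leqP a b) => ab kw; first by rewrite addnS oS.
  by rewrite d_sym; have -> : a - k = (a - k.+1).+1 by lia.
move=> [|j] jt.
  by rewrite [q 0]/= [q 1]/= idx0; lia.
rewrite [q j.+1]/= [q j.+2]/=; case: (leqP j w) => jw; last first.
  have -> : (j < w) = false by lia.
  by rewrite (dxx hypl); lia.
case: (ltnP j w) => jw'.
  have := d_tri (c i0) (o (idx j)) (o (idx j.+1)); have := d_sym (c i0) (o (idx j)).
  by have := oo _ (idxx _ jw); have := oo _ (idxx _ jw'); have := idxS _ jw'; lia.
have -> : j = w by lia.
by rewrite idxw; have := d_sym (o b) (c i2); lia.
Qed.

End Geometry2.

Definition poly_bounded (f : nat -> nat) := exists c, forall n, f n <= c * n.+1 ^ c.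

Lemma poly_bounded_const c : poly_bounded (fun=> c).
Proof. by exists c => n; rewrite leq_pmulr // expn_gt0. Qed.

Lemma poly_bounded_id : poly_bounded id.
Proof. by exists 1 => n; rewrite mul1n expn1. Qed.

Lemma poly_bounded_add f g : poly_bounded f -> poly_bounded g ->
  poly_bounded (fun n => f n + g n).
Proof.
move=> [a fa] [b gb]; exists (a + b) => n; rewrite mulnDl.
by apply: leq_add; [apply: leq_trans (fa n) _|apply: leq_trans (gb n) _];
  rewrite leq_mul2l leq_pexp2l ?orbT // ?leq_addr ?leq_addl.
Qed.

Lemma poly_bounded_mul f g : poly_bounded f -> poly_bounded g ->
  poly_bounded (fun n => f n * g n).
Proof.
move=> [a fa] [b gb]; exists (a * b + a + b) => n.
apply: leq_trans (leq_mul (fa n) (gb n)) _; rewrite mulnACA -expnD.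
apply: leq_mul; first by rewrite -addnA leq_addr.
by rewrite leq_pexp2l // -addnA leq_addl.
Qed.

Ltac poly_bound := repeat first [ assumption | exact: poly_bounded_id
  | exact: poly_bounded_const | apply: poly_bounded_mul | apply: poly_bounded_add ].

Section Geometry3.
Variables (G : groupType) (l : G -> nat) (K : nat).
Hypothesis hypl : hyp_length l K.
Local Notation d := (dist l).
Let d_sym := d_sym hypl.
Let d_tri := d_tri hypl.
Let d_mul := d_mul l.

(* c follows the orbit of P under h from P to h^x P, and m i is the exponent reached at time i. *)
Record orbit_geodesic (A : nat) (h P : G) (x : nat) (c : nat -> G) (L : nat) (m : nat -> nat) : Prop :=
  OrbitGeodesic {
  og_geo : discrete_geodesic l c L;
  og_m0 : m 0 = 0;
  og_mL : m L = x;
  og_mono : forall i j, i <= j <= L -> m i <= m j;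
  og_near : forall i, i <= L -> d (c i) (h ^^ m i ** P) <= A }.

Lemma d_orbit h P m k : d (h ^^ m ** P) (h ^^ (m + k) ** P) = d P (h ^^ k ** P).
Proof. by rewrite gpowD -gmulA d_mul. Qed.

Lemma d_orbit_le h P n m k : d P (h ** P) <= n ->
  d (h ^^ m ** P) (h ^^ k ** P) <= ((m - k) + (k - m)) * n.
Proof.
move=> hn; have E j : d P (h ^^ j ** P) <= j * n.
  by apply: leq_trans (d_gpow hypl _ _ _) _; rewrite leq_mul2l hn orbT.
case: (leqP m k) => mk.
  by rewrite -{1}(subnKC mk) d_orbit; have -> : m - k + (k - m) = k - m by lia.
rewrite d_sym -{1}(subnKC (ltnW mk)) d_orbit.
by have -> : m - k + (k - m) = m - k by lia.
Qed.

Lemma d_orbit_ge J h P m k : linear_growth l J h ->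
  (m - k) + (k - m) <= J * d (h ^^ m ** P) (h ^^ k ** P).
Proof.
move=> lin; case: (leqP m k) => mk.
  rewrite -{3}(subnKC mk) d_orbit; have := lin P (k - m); lia.
rewrite d_sym -{3}(subnKC (ltnW mk)) d_orbit; have := lin P (m - k); lia.
Qed.

(** The exponents m0 of near orbit points need not increase, so m is their running maximum. After a
    drop, m0 must climb back towards its final value x by steps of at most s, so it passes within s
    of the old value; a geodesic can come back that close only after a bounded time ([coarse]).
    Hence m stays close to m0 along the orbit. *)
Lemma orbit_geodesic_exists J : exists2 A, poly_bounded A & forall h P n (x : nat) c L,
  linear_growth l J h -> d P (h ** P) <= n -> discrete_geodesic l c L ->
  c 0 = P -> c L = h ^^ x ** P -> exists m, orbit_geodesic (A n) h P x c L m.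
Proof.
have [B BP] := geodesic_near_orbit hypl J.
exists (fun n => 3 * (n + B) + J * (1 + 2 * (n + B)) * n); first by poly_bound.
move=> h P n x c L lin hn cg c0 cL; set A0 := n + B; set s := J * (1 + 2 * A0).
pose o m := h ^^ m ** P.
have near := BP h P n x c L lin hn cg c0 cL.
have [m0 [m00 m0L m0x m0n]] : exists m0 : nat -> nat, [/\ m0 0 = 0, m0 L = x,
   forall i, i <= L -> m0 i <= x & forall i, i <= L -> d (c i) (o (m0 i)) <= A0].
  have ex i : exists m, i <= L -> [/\ m <= x, i = 0 -> m = 0, i = L -> m = x & d (c i) (o m) <= A0].
    case: (ltnP 0 i) => i0.
      case: (ltnP i L) => iL; last first.
        by exists x => iL'; rewrite (_ : i = L) ?cL ?(dxx hypl); [split=> //; lia | lia].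
      by have [m mx dm] := near i (ltnW iL); exists m => _; split=> //; lia.
    have -> : i = 0 by lia.
    case: (posnP L) => L0; last first.
      by exists 0 => _; rewrite c0 /o gpow0 g1mul (dxx hypl); split=> //; lia.
    exists 0 => _; suff x0 : x = 0 by rewrite x0 c0 /o gpow0 g1mul (dxx hypl); split.
    apply/eqP; rewrite -leqn0; have := lin P x.
    by rewrite -cL L0 c0 (dxx hypl) muln0.
  have [m0 m0P] := choice ex; exists m0; split.
  - by have [_ ->] := m0P 0 isT.
  - by have [_ _ -> //] := m0P L (leqnn L).
  - by move=> i /m0P[].
  - by move=> i /m0P[].
have step i : i < L -> m0 i.+1 <= m0 i + s.
  move=> iL; have := d_orbit_ge P (m0 i) (m0 i.+1) lin.
  have : d (o (m0 i)) (o (m0 i.+1)) <= 1 + 2 * A0.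
    have := m0n i (ltnW iL); have := m0n _ iL.
    have := d_tri (c i) (o (m0 i)) (o (m0 i.+1)); have := d_tri (c i.+1) (c i) (o (m0 i.+1)).
    have := d_sym (o (m0 i)) (c i); have := cg i i.+1; lia.
  rewrite -(leq_pmul2l (_ : 0 < J.+1)) // /s /o => h1 h2.
  have : J * d (h ^^ m0 i ** P) (h ^^ m0 i.+1 ** P) <= J * (1 + 2 * A0).
    by rewrite leq_mul2l -(leq_pmul2l (_ : 0 < J.+1)) ?h1 ?orbT.
  lia.
have coarse i j : i < j <= L -> m0 j < m0 i -> j - i <= 2 * A0 + s * n.
  move=> /andP[ij jL] mij.
  have [k [jk kL mk mk']] : exists k, [/\ j < k, k <= L, m0 i <= m0 k & m0 k <= m0 i + s].
    pose Q k := (j < k <= L) && (m0 i <= m0 k).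
    have exQ : exists k, Q k.
      exists L; rewrite /Q m0L m0x ?leqnn; last by lia.
      rewrite !andbT ltn_neqAle jL andbT; apply: contraTneq mij => ->.
      by rewrite m0L -leqNgt m0x; lia.
    case: (ex_minnP exQ) => k /andP[/andP[jk kL] mk] kmin; exists k; split=> //.
    case: k jk kL mk kmin => // k jk kL mk kmin; apply: leq_trans (step k kL) _.
    rewrite leq_add2r leqNgt; apply/negP => mk1.
    have : k = j \/ j < k by lia.
    case=> [kj|jk']; first by move: mk1 mij; rewrite kj; lia.
    by have := kmin k; rewrite /Q jk' (ltnW kL) (ltnW mk1) => /(_ isT); lia.
  have iL : i <= L by lia.
  have := cg i k; have := m0n i iL; have := m0n k kL.
  have := d_tri (o (m0 i)) (c i) (c k); have := d_tri (o (m0 k)) (o (m0 i)) (c k).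
  have := d_sym (o (m0 k)) (c k); have := d_orbit_le (m0 i) (m0 k) hn.
  have : (m0 i - m0 k + (m0 k - m0 i)) * n <= s * n by rewrite leq_mul2r; apply/orP; right; lia.
  rewrite /o; lia.
pose m := fix m i := if i is j.+1 then maxn (m j) (m0 j.+1) else m0 0.
have mmax i : (exists2 j, j <= i & m i = m0 j) /\ m0 i <= m i.
  elim: i => [|i [[j ji IH] _]]; first by split=> //; exists 0.
  split; last by rewrite /= leq_maxr.
  case: (leqP (m i) (m0 i.+1)) => mi.
    by exists i.+1 => //=; apply/maxn_idPr.
  by exists j; [lia | rewrite /= -IH; apply/maxn_idPl/ltnW].
have mmono i j : i <= j -> m i <= m j.
  by move/subnKC <-; elim: (j - i) => [|k IH]; rewrite ?addn0 // addnS /= leq_max IH.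
exists m; split=> //.
- by have [[j jL E] mL] := mmax L; move: mL (m0x j jL); rewrite E m0L; lia.
- by move=> i j /andP[/mmono].
- move=> i iL; have [[j ji E] mi] := mmax i; rewrite E.
  case: (leqP (m0 j) (m0 i)) => mji.
    have -> : m0 j = m0 i by lia.
    by have := m0n i iL; rewrite /o -/s; lia.
  have ij : j < i by case: (ltngtP j i) ji mji => // ->; rewrite ltnn.
  have := coarse j i; rewrite ij iL => /(_ isT mji).
  have := m0n j (leq_trans ji iL); have := d_tri (c j) (c i) (o (m0 j)).
  by have := d_sym (c i) (c j); have := cg j i; rewrite /o; lia.
Qed.

End Geometry3.

(** * Strips in polygons *)

(* The part [ss, ss + sl] of side si runs close to the part [sr, sr + sl] of
   side sj in the opposite direction. *)
Record strip := Strip { si : nat; ss : nat; sj : nat; sr : nat; sl : nat }.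

(** With the sides of the polygon arranged on a circle, the chords i j and i' j' do not cross;
    common ends are allowed. *)
Definition pair_nested (i j i' j' : nat) :=
  (i < i' < j -> i <= j' <= j) /\ (i < j' < j -> i <= i' <= j).

(* An entry (i, s, n) of a stack, the top of which comes first, is the part [s, s + n] of side i. *)
Notation stack := (seq (nat * nat * nat)).
Definition stack_length (st : stack) := sumn [seq e.2 | e <- st].

(** The offset o is counted from the bottom of the stack and stands for the distance from the first
    corner. The border point of two entries lies on both. *)
Fixpoint on_stack (st : stack) (i q o : nat) : Prop :=
  if st is (i', s, n) :: st' then
    (i = i' /\ exists2 t, t <= n & q = s + t /\ o = stack_length st' + t) \/ on_stack st' i q o
  else False.

(** Cancellation of a new side against the stack, as of letters in a free group: what side a
    retraces is removed, and each removed piece is recorded as a strip. *)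
Fixpoint pop (st : stack) (b r a : nat) : seq strip * stack :=
  if st is (i, s, n) :: st' then
    if b <= n then ([:: Strip i (s + (n - b)) a r b], (i, s, n - b) :: st')
    else ((Strip i s a r n) :: (pop st' (b - n) (r + n) a).1, (pop st' (b - n) (r + n) a).2)
  else ([::], [::]).

(** The function [w i] will be the exponent reached along side i, so each strip accounts for a share
    of the exponent on its left and on its right side. *)
Definition left_weight (w : nat -> nat -> nat) i (rs : seq strip) :=
  sumn [seq (si r == i) * (w i (ss r + sl r) - w i (ss r)) | r <- rs].
Definition right_weight (w : nat -> nat -> nat) i (rs : seq strip) :=
  sumn [seq (sj r == i) * (w i (sr r + sl r) - w i (sr r)) | r <- rs].
Definition stack_weight (w : nat -> nat -> nat) i (st : stack) :=
  sumn [seq (e.1.1 == i) * (w i (e.1.2 + e.2) - w i e.1.2) | e <- st].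

Section Pop.
Variables (w : nat -> nat -> nat).
Hypothesis wmono : forall a i j, i <= j -> w a i <= w a j.

Lemma pop_length st b r a : b <= stack_length st ->
  stack_length (pop st b r a).2 = stack_length st - b.
Proof.
rewrite /stack_length; elim: st b r => [|[[i s] n] st IH] b r /=; first by rewrite leqn0 => /eqP ->.
by case: (leqP b n) => /= bn bt; [lia | rewrite IH; lia].
Qed.

Lemma pop_on_stack st b r a i q o : on_stack (pop st b r a).2 i q o -> b <= stack_length st ->
  on_stack st i q o /\ o <= stack_length st - b.
Proof.
rewrite /stack_length; elim: st b r => [|[[i' s] n] st IH] b r //=.
case: (leqP b n) => /= bn.
  case=> [[-> [t tn [-> ->]]]|H] bt; first by split; [left; split=> //; exists t | rewrite /stack_length]; lia.
  split; first by right.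
  have : o <= stack_length st; last by rewrite /stack_length; lia.
  elim: st H {IH bt} => [|[[i'' s'] n'] st IH] //= [[_ [t tn [_ ->]]]|/IH].
    by rewrite /stack_length /=; lia.
  by rewrite /stack_length /=; lia.
move=> H bt; have [|H1 H2] := IH _ _ H; first by lia.
by split; [right | lia].
Qed.

(** Pieces leave the stack end first, so the two sides of a strip are run through in opposite
    directions: whence [sl x - t]. *)
Lemma pop_strips st b r a x : List.In x (pop st b r a).1 -> b <= stack_length st ->
  [/\ sj x = a, r <= sr x, sr x + sl x <= r + b &
   forall t, t <= sl x -> on_stack st (si x) (ss x + (sl x - t)) (stack_length st - (sr x - r) - t)].
Proof.
rewrite /stack_length; elim: st b r => [|[[i s] n] st IH] b r //=.
case: (leqP b n) => /= bn.
  case=> // <- bt /=; split=> //= t tb; left; split=> //; exists (n - t); first by lia.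
  by rewrite /stack_length; lia.
case=> [<- bt /=|H bt].
  split=> //= [|t tn]; first by lia.
  by left; split=> //; exists (n - t); rewrite /stack_length; lia.
have [|h1 h2 h3 h4] := IH _ _ H; first by lia.
split=> //; [lia | lia | move=> t tl; right].
by have := h4 t tl; congr (on_stack _ _ _ _); lia.
Qed.

Lemma pop_stack_weight st b r a i : b <= stack_length st ->
  left_weight w i (pop st b r a).1 + stack_weight w i (pop st b r a).2 = stack_weight w i st.
Proof.
rewrite /stack_length /left_weight /stack_weight.
elim: st b r => [|[[i' s] n] st IH] b r //=.
case: (leqP b n) => /= bn bt; last by rewrite -addnA IH //; lia.
rewrite addn0 addnA -mulnDr; congr (_ * _ + _).
have h1 : w i s <= w i (s + (n - b)) by apply: wmono; lia.
have h2 : w i (s + (n - b)) <= w i (s + n) by apply: wmono; lia.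
have -> : s + (n - b) + b = s + n by lia.
lia.
Qed.

Lemma pop_right_weight st b r a : b <= stack_length st ->
  right_weight w a (pop st b r a).1 = w a (r + b) - w a r.
Proof.
rewrite /stack_length /right_weight.
elim: st b r => [|[[i' s] n] st IH] b r /=; first by rewrite leqn0 => /eqP ->; rewrite addn0 subnn.
case: (leqP b n) => /= bn bt; rewrite eqxx mul1n ?addn0 // IH; last by lia.
have h1 : w a r <= w a (r + n) by apply: wmono; lia.
have h2 : w a (r + n) <= w a (r + b) by apply: wmono; lia.
have -> : r + n + (b - n) = r + b by lia.
lia.
Qed.

Lemma pop_right_weight_other st b r a i : i != a -> right_weight w i (pop st b r a).1 = 0.
Proof.
move=> ia; rewrite /right_weight; elim: st b r => [|[[i' s] n] st IH] b r //=.
by case: ifP => _ /=; rewrite eq_sym (negbTE ia) ?IH.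
Qed.

Lemma pop_left_weight_other st b r a i : i \notin [seq e.1.1 | e <- st] ->
  left_weight w i (pop st b r a).1 = 0.
Proof.
rewrite /left_weight; elim: st b r => [|[[i' s] n] st IH] b r //=.
rewrite inE negb_or => /andP[ii' /IH H].
by case: ifP => _ /=; rewrite eq_sym (negbTE ii') ?H.
Qed.

Lemma pop_size st b r a :
  size (pop st b r a).1 + size (pop st b r a).2 <= (size st).+1.
Proof.
elim: st b r => [|[[i' s] n] st IH] b r //=.
by case: ifP => _ //=; have := IH (b - n) (r + n); lia.
Qed.

Definition indices (st : stack) := [seq e.1.1 | e <- st].

Lemma pop_indices st b r a : subseq (indices (pop st b r a).2) (indices st).
Proof.
elim: st b r => [|[[i' s] n] st IH] b r //=.
case: ifP => _ /=; first by rewrite eqxx.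
by apply: subseq_trans (IH _ _) (subseq_cons _ _).
Qed.

Lemma pop_strip_index st b r a x : sorted (fun i j => j < i) (indices st) ->
  List.In x (pop st b r a).1 ->
  si x \in indices st /\ (forall i, i \in indices (pop st b r a).2 -> i <= si x).
Proof.
have tr : transitive (fun i j : nat => j < i) by move=> ? ? ? h1 h2; apply: ltn_trans h2 h1.
elim: st b r => [|[[i' s] n] st IH] b r //= srt.
have lt i : i \in indices st -> i < i' by move/(allP (order_path_min tr srt)).
case: ifP => _ /=.
  by case=> // <- /=; rewrite inE eqxx; split=> // i /orP[/eqP -> //|/lt/ltnW].
case=> [<- /=|/(IH _ _ (path_sorted srt))[h1 h2]].
  by rewrite inE eqxx; split=> // i /(mem_subseq (pop_indices _ _ _ _))/lt/ltnW.
by rewrite inE h1 orbT.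
Qed.

End Pop.

Section Polygon.
Variables (G : groupType) (l : G -> nat) (K : nat).
Hypothesis hypl : hyp_length l K.
Local Notation d := (dist l).
Let d_sym := d_sym hypl.
Let d_tri := d_tri hypl.
Let d_4pt := d_4pt hypl.

Let d_4or x y z t : d x z + d y t <= d x y + d z t + K \/ d x z + d y t <= d x t + d y z + K.
Proof. by have := d_4pt x y z t; lia. Qed.

Variables (P : nat -> G) (L : nat -> nat) (c : nat -> nat -> G) (w : nat -> nat -> nat).
Hypothesis cgeo : forall a, discrete_geodesic l (c a) (L a).
Hypothesis c0 : forall a, c a 0 = P a.
Hypothesis cL : forall a, c a (L a) = P a.+1.
Hypothesis wmono : forall a i j, i <= j -> w a i <= w a j.

(** Empty words add nothing to the length of an expression, so the number of sides is not bounded by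
    that length. The number of sides of positive length is, and only these may contribute to the
    errors. *)
Definition nontrivial_sides a := count (fun b => 0 < L b) (iota 0 a).

Lemma nontrivial_sidesS a : nontrivial_sides a.+1 = nontrivial_sides a + (0 < L a).
Proof. by rewrite /nontrivial_sides -(addn1 a) iotaD count_cat /= addn0. Qed.

Definition strip_error e := e * K + 8 * e + 6 * K + 2.

Definition good_strip a e r :=
  [/\ si r < sj r < a, ss r + sl r <= L (si r), sr r + sl r <= L (sj r) &
   forall t, t <= sl r ->
     d (c (si r) (ss r + (sl r - t))) (c (sj r) (sr r + t)) <= strip_error e].

(** The stack is a broken copy of a geodesic from [P 0] to [P a]: its length is the distance and its
    offsets are distances from [P 0], with errors linear in the number of nontrivial sides. By
    [inv_free] no strip encloses a side still on the stack, so strips made later do not cross the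
    present ones. By [inv_weight] strips and stack together use up every side. *)
Record stack_inv (a : nat) (st : stack) (rs : seq strip) : Prop := StackInv {
  inv_length : let D := d (P 0) (P a) in let e := nontrivial_sides a in
    stack_length st <= D + e /\ D <= stack_length st + e;
  inv_points : forall i q o, on_stack st i q o ->
    let D := d (P 0) (P a) in let e := nontrivial_sides a in
    [/\ i < a, q <= L i, d (P 0) (c i q) <= o + e + K /\ o <= d (P 0) (c i q) + e + K &
     d (P 0) (c i q) + d (c i q) (P a) <= D + (e * K + 4 * e + 3 * K)];
  inv_strips : forall r, List.In r rs -> good_strip a (nontrivial_sides a) r;
  inv_nested : forall r r', List.In r rs -> List.In r' rs ->
    pair_nested (si r) (sj r) (si r') (sj r');
  inv_free : forall r i, List.In r rs -> i \in indices st -> ~ (si r < i < sj r);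
  inv_sorted : sorted (fun i j => j < i) (indices st);
  inv_indices : forall i, i \in indices st -> i < a;
  inv_weight : forall i, i < a ->
    left_weight w i rs + right_weight w i rs + stack_weight w i st = w i (L i) - w i 0;
  inv_size : size rs + size st <= 2 * nontrivial_sides a }.

Lemma stack_inv0 : stack_inv 0 [::] [::].
Proof. by split=> //=; rewrite (dxx hypl). Qed.

Lemma side_dist a q : q <= L a -> d (c a q) (P a) = q /\ d (c a q) (P a.+1) = L a - q.
Proof. by move=> qL; rewrite -c0 -cL d_sym !cgeo; lia. Qed.

Lemma left_weight_cat i rs rs' : left_weight w i (rs ++ rs') = left_weight w i rs + left_weight w i rs'.
Proof. by rewrite /left_weight map_cat sumn_cat. Qed.

Lemma right_weight_cat i rs rs' : right_weight w i (rs ++ rs') = right_weight w i rs + right_weight w i rs'.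
Proof. by rewrite /right_weight map_cat sumn_cat. Qed.

Lemma left_weight0 i rs : (forall r, List.In r rs -> si r != i) -> left_weight w i rs = 0.
Proof.
elim: rs => //= r rs IH H; rewrite /left_weight /= (negbTE (H r (or_introl erefl))) mul0n add0n.
by apply: IH => r' r'rs; apply: H; right.
Qed.

Lemma right_weight0 i rs : (forall r, List.In r rs -> sj r != i) -> right_weight w i rs = 0.
Proof.
elim: rs => //= r rs IH H; rewrite /right_weight /= (negbTE (H r (or_introl erefl))) mul0n add0n.
by apply: IH => r' r'rs; apply: H; right.
Qed.

Lemma stack_weight0 i st : i \notin indices st -> stack_weight w i st = 0.
Proof.
elim: st => //= e st IH; rewrite inE negb_or eq_sym => /andP[h /IH].
by rewrite /stack_weight /= (negbTE h) mul0n add0n.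
Qed.

Lemma stack_inv_step a st rs : stack_inv a st rs -> exists st' rs', stack_inv a.+1 st' rs'.
Proof.
move=> I; have esS := nontrivial_sidesS a; set e := nontrivial_sides a in esS.
have Iw0 : a \notin indices st by apply/negP => /(inv_indices I); rewrite ltnn.
have Iwl : left_weight w a rs = 0.
  by apply: left_weight0 => r /(inv_strips I)[h _ _ _]; lia.
have Iwr : right_weight w a rs = 0.
  by apply: right_weight0 => r /(inv_strips I)[h _ _ _]; lia.
case: (posnP (L a)) => La.
  have Pa : P a.+1 = P a by rewrite -cL La c0.
  have eE : nontrivial_sides a.+1 = e by rewrite esS La addn0.
  exists st, rs; split; rewrite ?eE ?Pa.
  - exact: inv_length I.
  - by move=> i q o /(inv_points I)[h1 h2 h3 h4]; split=> //; lia.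
  - by move=> r /(inv_strips I)[h1 h2 h3 h4]; split=> //; lia.
  - exact: inv_nested I.
  - exact: inv_free I.
  - exact: inv_sorted I.
  - by move=> i /(inv_indices I); lia.
  - move=> i; rewrite ltnS leq_eqVlt => /orP[/eqP ->|]; last by move=> ia; exact: (inv_weight I ia).
    by rewrite Iwl Iwr stack_weight0 // La subnn.
  - exact: inv_size I.
have {}esS : nontrivial_sides a.+1 = e.+1 by rewrite esS La addn1.
set D := d (P 0) (P a); set D' := d (P 0) (P a.+1); set T := stack_length st.
have [TD DT] : T <= D + e /\ D <= T + e by apply: inv_length I.
have Ld : d (P a) (P a.+1) = L a by rewrite -c0 -cL cgeo //; lia.
have t1 : D' <= D + L a by rewrite -Ld; apply: d_tri.
have t2 : D <= D' + L a by rewrite -Ld [d (P a) _]d_sym; apply: d_tri.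
have t3 : L a <= D + D' by rewrite -Ld /D [d (P 0) (P a)]d_sym; apply: d_tri.
(* al is what remains on the stack, ideally half of D + D' - L a, the Gromov product at [P 0] of the
   two ends of side a. In the last two cases this would cancel more than all of side a or less than
   nothing. *)
have [al [b [alb bL albP]]] : exists al b, [/\ T = al + b, b <= L a &
    [\/ 2 * al + L a <= D + D' <= 2 * al + L a + 1, b = L a /\ D + D' <= 2 * al + L a + 1 |
        b = 0 /\ 2 * al + L a <= D + D']].
  case: (leqP T (D + D' - L a)./2) => h1.
    by exists T, 0; split; [lia | lia | constructor 3; lia].
  case: (leqP T (L a + (D + D' - L a)./2)) => h2.
    by exists (D + D' - L a)./2, (T - (D + D' - L a)./2); split; [lia | lia | constructor 1; lia].
  by exists (T - L a), (L a); split; [lia | lia | constructor 2; lia].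
have bT : b <= T by lia.
pose rs1 := (pop st b 0 a).1; pose st1 := (pop st b 0 a).2.
have st1T : stack_length st1 = al by rewrite pop_length // -/T; lia.
pose st2 := (a, b, L a - b) :: st1.
have st2T : stack_length st2 = L a - b + al by rewrite -st1T.
(* By the four-point condition a point of side a lies, up to K, between [P 0] and [P a] or between
   [P 0] and [P a.+1]. *)
have near q : q <= L a -> let x := d (P 0) (c a q) in
   [/\ D <= x + q, D' + q <= x + L a & x + q <= D + K \/ x + L a <= D' + q + K].
  move=> qL x; have [s1 s2] := side_dist qL.
  have := d_tri (c a q) (P 0) (P a); have := d_tri (c a q) (P 0) (P a.+1).
  have := d_sym (P a) (c a q); rewrite -/D -/D' -/x s1 s2 => e1 e2 e3.
  split; [lia | lia |].
  by case: (d_4or (P 0) (P a) (c a q) (P a.+1)); rewrite -/D -/D' -/x ?s2 ?e1 Ld; [left | right]; lia.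
have rs1P x : List.In x rs1 -> si x \in indices st /\ good_strip a.+1 e.+1 x.
  move=> xrs; have [sjx srx slx onx] := pop_strips xrs bT.
  have [six _] := pop_strip_index (inv_sorted I) xrs; split=> //.
  have ia := inv_indices I six.
  have [_ q0 _ _] := inv_points I (onx 0 (leq0n _)).
  split; rewrite ?sjx; [lia | by move: q0; rewrite subn0 | lia | move=> t tl].
  have [_ _ [p1 p2] p3] := inv_points I (onx t tl).
  have qL : sr x + t <= L a by lia.
  have [n1 n2 n3] := near _ qL; have [s1 s2] := side_dist qL.
  move: (c (si x) _) (c a _) p1 p2 p3 n1 n2 n3 s1 s2 => p q p1 p2 p3 n1 n2 n3 s1 s2.
  rewrite -/D -/T -/e in p1 p2 p3; rewrite /strip_error mulSn.
  have := d_4or p (P 0) q (P a); have := d_sym p (P 0).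
  rewrite -/D; move: (e * K) p1 p2 p3 => eK p1 p2 p3 g1.
  by rewrite g1 s1; case: n3 => n3; case: albP => albP; case=> g3; lia.
have rs1nested x r : List.In x rs1 -> List.In r rs ->
    pair_nested (si x) (sj x) (si r) (sj r) /\ pair_nested (si r) (sj r) (si x) (sj x).
  move=> xrs rrs; have [six _] := rs1P x xrs; have [sjx _ _ _] := pop_strips xrs bT.
  have := inv_free I rrs six; have [h _ _ _] := inv_strips I rrs.
  rewrite /pair_nested sjx; move: (inv_indices I six) => h'; split; split; lia.
have st1sub : {subset indices st1 <= indices st} by apply/mem_subseq/pop_indices.
exists st2, (rs1 ++ rs); split; rewrite ?esS.
- by rewrite -/D' st2T; case: albP; lia.
- move=> i q o [[-> [t tn [-> ->]]]|H].
    have qL : b + t <= L a by lia.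
    have [n1 n2 n3] := near _ qL; have [s1 s2] := side_dist qL.
    rewrite st1T s2 -/D' mulSn.
    move: n1 n2 n3; set x := d _ _; move: (e * K) => eK n1 n2 n3.
    by split=> //; case: n3 => n3; case: albP => albP; lia.
  have [/(inv_points I)[h1 h2 [h3 h4] h5] oal] := pop_on_stack H bT.
  have g2 := d_4or (c i q) (P 0) (P a.+1) (P a).
  rewrite (d_sym (c i q) (P 0)) (d_sym (P a.+1)) -/D -/D' Ld in g2.
  rewrite -/D -/T -/e in h3 h4 h5 oal; rewrite -/D'; lazy zeta; rewrite (mulSn e K).
  move: (e * K) h5 => eK h5; split=> //; [lia | lia |].
  by case: g2 => g2; case: albP => albP; lia.
- move=> r /List.in_app_iff[/rs1P[] //|/(inv_strips I)[h1 h2 h3 h4]].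
  split=> //; [lia | move=> t tl; apply: leq_trans (h4 t tl) _].
  by rewrite /strip_error -/e (mulSn e K); lia.
- move=> r r' /List.in_app_iff[rr|rr] /List.in_app_iff[rr'|rr'].
  + have [_ [h _ _ _]] := rs1P _ rr; have [_ [h' _ _ _]] := rs1P _ rr'.
    have [s1 _ _ _] := pop_strips rr bT; have [s2 _ _ _] := pop_strips rr' bT.
    by rewrite /pair_nested; split; lia.
  + by have [] := rs1nested _ _ rr rr'.
  + by have [] := rs1nested _ _ rr' rr.
  + exact: (inv_nested I rr rr').
- move=> r i /List.in_app_iff[rr|rr].
    have [s1 _ _ _] := pop_strips rr bT; have [_ h] := pop_strip_index (inv_sorted I) rr.
    by rewrite inE => /orP[/eqP ->|/h hi] /andP[]; rewrite ?s1 ?ltnn // ltnNge hi.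
  rewrite inE => /orP[/eqP ->|/st1sub]; last by move=> ist; apply: (inv_free I rr ist).
  by have [/andP[_ h] _ _ _] := inv_strips I rr; case/andP => _ /(ltn_trans h); rewrite ltnn.
- have tr : transitive (fun i j : nat => j < i) by move=> ? ? ? h1 h2; apply: ltn_trans h2 h1.
  rewrite /= (path_sortedE tr); apply/andP; split.
    by apply/allP => i /st1sub /(inv_indices I).
  exact: subseq_sorted tr _ _ (pop_indices _ _ _ _) (inv_sorted I).
- by move=> i; rewrite inE => /orP[/eqP -> //|/st1sub /(inv_indices I)]; lia.
- move=> i; rewrite ltnS leq_eqVlt left_weight_cat right_weight_cat => /orP[/eqP ->|ia].
    rewrite Iwl Iwr pop_left_weight_other // /stack_weight /= eqxx mul1n.
    rewrite -/(stack_weight w a st1) stack_weight0 ?(contra (st1sub a)) //.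
    rewrite /rs1 pop_right_weight // add0n subnKC //.
    have h1 : w a 0 <= w a b by apply: wmono.
    have h2 : w a b <= w a (L a) by apply: wmono.
    rewrite !add0n; lia.
  rewrite /rs1 pop_right_weight_other ?(ltn_eqF ia) // /stack_weight /= gtn_eqF //.
  rewrite -/(stack_weight w i st1) -(inv_weight I ia) -(pop_stack_weight wmono 0 a i bT) -/st1; lia.
- by rewrite size_cat /= mulnS; have := pop_size st b 0 a; have := inv_size I; rewrite -/rs1 -/st1 -/e; lia.
Qed.

(** For a closed polygon the distance from [P 0] to [P N] is 0, so the stack is no longer than the
    error in its length. *)
Lemma polygon_strips N : P N = P 0 -> exists st rs, [/\ stack_inv N st rs & stack_length st <= nontrivial_sides N].
Proof.
move=> PN; have [st [rs I]] : exists st rs, stack_inv N st rs.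
  elim: N {PN} => [|N [st [rs I]]]; last exact: stack_inv_step I.
  by exists [::], [::]; apply: stack_inv0.
by exists st, rs; split=> //; have [] := inv_length I; rewrite PN (dxx hypl).
Qed.

End Polygon.

(** * Relations in long strips *)

Section Strips.
Variables (G : groupType) (l : G -> nat) (K : nat).
Hypothesis hypl : hyp_length l K.
Local Notation d := (dist l).
Let d_sym := d_sym hypl.
Let d_tri := d_tri hypl.
Let d_mul := d_mul l.

Lemma gpow_addC (h : G) m n : h ^^ m ** h ^^ n = h ^^ n ** h ^^ m.
Proof. by rewrite -!gpowD addnC. Qed.

Lemma d_ginv g (y : G) : d y (ginv g ** y) = d y (g ** y).
Proof. by rewrite -(d_mul g) gmulVK d_sym. Qed.

Lemma orbit_displacement A h P x c L m n : orbit_geodesic l A h P x c L m -> d P (h ** P) <= n ->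
  forall t k, t <= L -> d (c t) (h ^^ k ** c t) <= 2 * A + k * n.
Proof.
move=> og hn t k tL; have near := og_near og tL.
set o := h ^^ m t ** P in near.
have h1 : d (h ^^ k ** c t) (h ^^ k ** o) <= A by rewrite d_mul.
have h2 : d o (h ^^ k ** o) <= k * n.
  rewrite /o gmulA gpow_addC -gmulA d_mul.
  by apply: leq_trans (d_gpow hypl _ _ _) _; rewrite leq_mul2l hn orbT.
have := d_tri o (c t) (h ^^ k ** c t); have := d_tri (h ^^ k ** o) o (h ^^ k ** c t).
have := d_sym (h ^^ k ** o) (h ^^ k ** c t); lia.
Qed.

Lemma linear_growth_gap J h y i j : linear_growth l J h ->
  (i - j) + (j - i) <= J * d (h ^^ i ** y) (h ^^ j ** y).
Proof. exact: (d_orbit_ge hypl). Qed.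

Section Strip.
Variables (J A D n : nat) (h P : G) (x : nat) (c : nat -> G) (L : nat) (m : nat -> nat).
Variables (h' P' : G) (x' : nat) (c' : nat -> G) (L' : nat) (m' : nat -> nat).
Hypotheses (og : orbit_geodesic l A h P x c L m) (og' : orbit_geodesic l A h' P' x' c' L' m').
Hypothesis lin' : linear_growth l J h'.
Hypotheses (hn : d P (h ** P) <= n) (hn' : d P' (h' ** P') <= n).
Variables (s r len : nat).
Hypotheses (sL : s + len <= L) (rL : r + len <= L').
Hypothesis strip : forall t, t <= len -> d (c (s + (len - t))) (c' (r + t)) <= D.

Let w := m (s + len) - m s.
Let w' := m' (r + len) - m' r.

(** The exponent is rounded down to a multiple of p, to which a relation involving h^p applies; the
    rounding costs p n. *)
Lemma strip_shift p : 0 < p -> d (h ^^ (w %/ p * p) ** c s) (c (s + len)) <= 2 * A + p * n.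
Proof.
move=> p0; set u := w %/ p * p.
have ms : m s <= m (s + len) by apply: (og_mono og); lia.
have h1 : d (h ^^ u ** c s) (h ^^ (m s + u) ** P) <= A.
  by rewrite addnC gpowD -gmulA d_mul; apply: (og_near og); lia.
have h2 := og_near og sL.
have h3 := d_orbit_le hypl (m s + u) (m (s + len)) hn.
have uw : u <= w by apply: leq_trunc_div.
have wp : w - u <= p by rewrite /u; have := ltn_pmod w p0; have := divn_eq w p; lia.
have h4 : ((m s + u - m (s + len)) + (m (s + len) - (m s + u))) * n <= p * n.
  by rewrite leq_mul2r; apply/orP; right; rewrite /w in uw wp *; lia.
have := d_tri (h ^^ (m s + u) ** P) (h ^^ u ** c s) (c (s + len)).
have := d_tri (h ^^ m (s + len) ** P) (h ^^ (m s + u) ** P) (c (s + len)).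
have := d_sym (h ^^ m (s + len) ** P) (c (s + len)); lia.
Qed.

Lemma strip_shift' : d (h' ^^ w' ** c (s + len)) (c s) <= 2 * A + 2 * D.
Proof.
have ms : m' r <= m' (r + len) by apply: (og_mono og'); lia.
have h0 := strip (leq0n len); rewrite subn0 addn0 in h0.
have h1 := strip (leqnn len); rewrite subnn addn0 in h1.
have h2 : d (h' ^^ w' ** c (s + len)) (h' ^^ w' ** c' r) <= D by rewrite d_mul.
have h3 : d (h' ^^ w' ** c' r) (h' ^^ m' (r + len) ** P') <= A.
  rewrite (_ : m' (r + len) = w' + m' r); last by rewrite /w' subnK.
  by rewrite gpowD -gmulA d_mul; apply: (og_near og'); lia.
have h4 := og_near og' rL.
have := d_tri (h' ^^ w' ** c' r) (h' ^^ w' ** c (s + len)) (c s).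
have := d_tri (h' ^^ m' (r + len) ** P') (h' ^^ w' ** c' r) (c s).
have := d_tri (c' (r + len)) (h' ^^ m' (r + len) ** P') (c s).
have := d_sym (c' (r + len)) (c s); have := d_sym (c' (r + len)) (h' ^^ m' (r + len) ** P'); lia.
Qed.

(** With k = w / p, the element h^(kp) carries [c s] to the end of the strip and h'^w' carries the
    end back, both up to a bounded error. Since h^(kp) is inverse to h'^(kq), the powers kq and w'
    of h' almost agree on the end, and linear growth compares the exponents. *)
Lemma strip_weights p q : 0 < p -> h ^^ p ** h' ^^ q = gone G ->
  let e := J * (4 * A + 2 * D + p * n) in
  w %/ p * q <= w' + e /\ w' <= w %/ p * q + e.
Proof.
move=> p0 hh e; set k := w %/ p.
have hk : h ^^ (k * p) ** h' ^^ (k * q) = gone G.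
  have hE : h' ^^ q = ginv (h ^^ p) by apply: (@gmul_inj _ (h ^^ p)); rewrite gmulV.
  by rewrite mulnC gpowM (mulnC k) gpowM hE /gmul /gpow /ginv /gone expVgn mulgV.
have h1 : d (c s) (h' ^^ (k * q) ** c (s + len)) <= 2 * A + p * n.
  rewrite -(d_mul (h ^^ (k * p))) gmulA hk g1mul; exact: strip_shift.
have h2 := strip_shift'.
have h3 := linear_growth_gap (c (s + len)) (k * q) w' lin'.
have h4 : d (h' ^^ (k * q) ** c (s + len)) (h' ^^ w' ** c (s + len)) <= 4 * A + 2 * D + p * n.
  have := d_tri (c s) (h' ^^ (k * q) ** c (s + len)) (h' ^^ w' ** c (s + len)).
  have := d_sym (c s) (h' ^^ (k * q) ** c (s + len)).
  have := d_sym (c s) (h' ^^ w' ** c (s + len)); lia.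
have : J * d (h' ^^ (k * q) ** c (s + len)) (h' ^^ w' ** c (s + len)) <= e.
  by rewrite leq_mul2l h4 orbT.
move: h3; set X := J * _; set Y := k * q; lia.
Qed.

(** The two sides run in opposite directions. If h^p = h'^q, the movements along the strip and back
    add up to the power w' + k q of h' instead of cancelling, so w' is bounded, and with it the
    strip. *)
Lemma strip_direction p q : 0 < p -> h ^^ p = h' ^^ q ->
  len <= J * (4 * A + 2 * D + p * n) * n + 2 * A.
Proof.
move=> p0 hh; set k := w %/ p.
have hk : h ^^ (k * p) = h' ^^ (k * q) by rewrite mulnC gpowM hh -gpowM mulnC.
have h1 := strip_shift p0; rewrite -/k hk in h1.
have h2 := strip_shift'.
have h3 : d (h' ^^ (w' + k * q) ** c s) (h' ^^ w' ** c (s + len)) <= 2 * A + p * n.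
  by rewrite gpowD -gmulA d_mul.
have h4 : d (c s) (h' ^^ (w' + k * q) ** c s) <= 4 * A + 2 * D + p * n.
  have := d_tri (h' ^^ w' ** c (s + len)) (c s) (h' ^^ (w' + k * q) ** c s).
  have := d_sym (c s) (h' ^^ w' ** c (s + len)).
  have := d_sym (h' ^^ w' ** c (s + len)) (h' ^^ (w' + k * q) ** c s); lia.
have h5 : w' <= J * (4 * A + 2 * D + p * n).
  apply: leq_trans (_ : w' + k * q <= _); first exact: leq_addr.
  by apply: leq_trans (lin' (c s) _) _; rewrite leq_mul2l h4 orbT.
have ms : m' r <= m' (r + len) by apply: (og_mono og'); lia.
have h6 := d_orbit_le hypl (m' r) (m' (r + len)) hn'.
have h7 : (m' r - m' (r + len) + (m' (r + len) - m' r)) * n <= J * (4 * A + 2 * D + p * n) * n.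
  by rewrite leq_mul2r; apply/orP; right; rewrite /w' in h5; lia.
have h8 : r <= L' by lia.
have n1 := og_near og' h8; have n2 := og_near og' rL.
have := og_geo og' (_ : r <= r + len <= L').
have := d_tri (h' ^^ m' r ** P') (c' r) (c' (r + len)).
have := d_tri (h' ^^ m' (r + len) ** P') (h' ^^ m' r ** P') (c' (r + len)).
have := d_sym (h' ^^ m' (r + len) ** P') (c' (r + len)).
move: h6 h7; set X := _ * n; set Y := _ * n; lia.
Qed.

Variable ball : seq G.
Hypothesis ballP : forall g, l g <= 3 * K -> g \in ball.

(** The number of pigeonholes in [strip_commensurable]: 2 M + 1 positions along the strip, with M =
    2A + 2D + 3K, times the size b of a ball of radius 3 K. *)
Definition strip_exponent b A D := (2 * (2 * A + 2 * D + 3 * K) + 1) * b.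
(** Bounds the displacement of all points of the strip under the elements [k i] of
    [strip_commensurable]. *)
Definition strip_move J b A D n :=
  let S := strip_exponent b A D in
  4 * A + 2 * D + S * n + J * (4 * A + S * n + 3 * K + 2 * D) * n.
(** The first summand puts the midpoint deep enough for [quadrilateral]; the others exceed the bound
    of [strip_direction]. *)
Definition strip_long J b A D n :=
  2 * (strip_move J b A D n + K + 2) +
  J * (4 * A + 2 * D + strip_exponent b A D * n) * n + 2 * A.

(** h^i moves the midpoint y along the strip and a power of h' moves it back, so that [k i]
    displaces y by at most M, a bound free of i and of S. As [k i] moves the ends little compared
    with the length, the image of y is within 3 K of c (2 K from [quadrilateral], K from
    [near_geodesic]), at a position within M of y. That leaves S possible images for S + 1 indices,
    and two elements with equal images of y are equal. *)
Lemma strip_commensurable : strip_long J (size ball) A D n < len ->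
  exists p q, [/\ 0 < p <= strip_exponent (size ball) A D,
    0 < q <= J * (2 * A + strip_exponent (size ball) A D * n) &
    h ^^ p ** h' ^^ q = gone G].
Proof.
rewrite /strip_long /strip_move; set S := strip_exponent _ _ _; set T := J * (4 * A + _ + _ + _).
set c1 := J * _ * n => long.
pose M2 := 4 * A + 2 * D + S * n + T * n.
pose hl := len./2; pose y := c (s + hl); pose a := c s; pose b := c (s + len).
have hl1 : M2 + K < hl by rewrite /hl /M2; lia.
have hl2 : M2 + K < len - hl by rewrite /hl /M2; lia.
have hlL : hl <= len by lia.
have geo i j : i <= j <= len -> d (c (s + i)) (c (s + j)) = j - i.
  by move=> ij; rewrite (og_geo og); lia.
have day : d a y = hl by have := geo 0 hl; rewrite addn0 subn0; apply.
have dyb : d y b = len - hl by apply: geo; lia.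
have dab : d a b = len by have := geo 0 len; rewrite addn0 subn0; apply; lia.
have near g M : M <= M2 -> d a (g ** a) <= M -> d b (g ** b) <= M -> forall o, d y (g ** y) <= o ->
    exists2 t, t <= len & [/\ d (c (s + t)) (g ** y) <= 3 * K, t = d a (g ** y) & t <= hl + o /\ hl <= t + o].
  move=> MM ga gb o yo; exists (d a (g ** y)).
    have := d_tri (g ** a) a (g ** y); rewrite d_mul day; lia.
  have h1 : d a (g ** y) + d (g ** y) b <= d a b + 2 * K.
    by apply: (@quadrilateral _ _ _ hypl _ _ (g ** a) (g ** b) _ M) => //;
      rewrite !d_mul ?day ?dyb ?dab //; lia.
  have tl : d a (g ** y) <= len.
    by have := d_tri (g ** a) a (g ** y); rewrite d_mul day; lia.
  split=> //; last first.
    have := d_tri y a (g ** y); have := d_tri (g ** y) a y; have := d_sym y (g ** y); lia.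
  have e1 : d a (c (s + d a (g ** y))) = d a (g ** y).
    by have := geo 0 (d a (g ** y)); rewrite addn0 subn0; apply.
  have e2 : d (c (s + d a (g ** y))) b = len - d a (g ** y) by apply: geo; lia.
  have e3 : d a (c (s + d a (g ** y))) + d (c (s + d a (g ** y))) b = d a b by rewrite e1 e2 dab subnKC.
  have := near_geodesic hypl e3 h1; rewrite e1; lia.
have st t : t <= len -> d (c (s + t)) (c' (r + (len - t))) <= D.
  by move=> tl; have := strip (leq_subr t len); rewrite subKn.
pose b0 := m' (r + (len - hl)).
pose o k := h' ^^ k ** P'.
have nearo t : t <= len -> d (c (s + t)) (o (m' (r + (len - t)))) <= D + A.
  move=> tl; have h1 : r + (len - t) <= L' by lia.
  by have := d_tri (c' (r + (len - t))) (c (s + t)) (o (m' (r + (len - t))));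
    have := st t tl; have := og_near og' h1; rewrite /o; lia.
have Sn i : i <= S -> i * n <= S * n by move=> iS; rewrite leq_mul2r iS orbT.
have mv i t : i <= S -> t <= len -> d (c (s + t)) (h ^^ i ** c (s + t)) <= 2 * A + S * n.
  move=> iS tl; have h1 : s + t <= L by lia.
  by have := orbit_displacement og hn i h1; have := Sn i iS; lia.
have cs : c (s + 0) = c s by rewrite addn0.
(* h' moves the geodesic c back by as much as h^i moves it forward *)
have back i : exists bi, i <= S -> d (h ^^ i ** y) (o bi) <= 3 * K + D + A /\
    bi - b0 + (b0 - bi) <= T.
  case: (leqP i S) => [iS|]; last by exists 0.
  have [|||t tl [t1 _ _]] := @near (h ^^ i) (2 * A + S * n) _ _ _ (d y (h ^^ i ** y)) (leqnn _).
  - by rewrite /M2; lia.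
  - by have := mv i 0 iS (leq0n _); rewrite cs.
  - exact: mv.
  exists (m' (r + (len - t))) => _.
  have h1 : d (h ^^ i ** y) (o (m' (r + (len - t)))) <= 3 * K + D + A.
    have := d_tri (c (s + t)) (h ^^ i ** y) (o (m' (r + (len - t)))).
    by have := d_sym (c (s + t)) (h ^^ i ** y); have := nearo t tl; lia.
  split=> //; rewrite /b0; have lg := linear_growth_gap P' (m' (r + (len - t))) (m' (r + (len - hl))) lin'.
  apply: leq_trans lg _; rewrite /T leq_mul2l; apply/orP; right.
  have := d_tri (h ^^ i ** y) (o (m' (r + (len - t)))) (o (m' (r + (len - hl)))).
  have := d_tri y (h ^^ i ** y) (o (m' (r + (len - hl)))).
  have := d_sym (h ^^ i ** y) (o (m' (r + (len - t)))); have := d_sym y (h ^^ i ** y).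
  by have := nearo hl hlL; have := mv i hl iS hlL; rewrite -/y /o in h1 *; lia.
have [B BP] := choice back.
(* b0 is the exponent of h' beside y and [B i] the one beside [h ^^ i ** y], so this element returns
   y close to itself. *)
pose k i := h' ^^ b0 ** (ginv (h' ^^ B i) ** h ^^ i).
have kmove i t : i <= S -> t <= len -> d (c (s + t)) (k i ** c (s + t)) <= M2.
  move=> iS tl; have [_ Bi] := BP i iS; set z := c (s + t).
  pose v := h' ^^ b0 ** ginv (h' ^^ B i).
  have vk : k i ** z = v ** (h ^^ i ** z) by rewrite /k /v -!gmulA.
  have tL : r + (len - t) <= L' by lia.
  have h1 : d (c' (r + (len - t))) (v ** c' (r + (len - t))) <= 2 * A + T * n.
    set z' := c' _.
    have disp j : j <= T -> d z' (h' ^^ j ** z') <= 2 * A + T * n.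
      move=> jT; apply: leq_trans (orbit_displacement og' hn' j tL) _.
      by rewrite leq_add2l leq_mul2r jT orbT.
    rewrite /v; case: (leqP (B i) b0) => Bb.
      rewrite -(subnK Bb) gpowD -!gmulA gmulVK; apply: disp; lia.
    rewrite -(subnK (ltnW Bb)) addnC gpowD.
    have -> : h' ^^ b0 ** ginv (h' ^^ b0 ** h' ^^ (B i - b0)) = ginv (h' ^^ (B i - b0)).
      rewrite -gpowD addnC gpowD; rewrite /gmul /ginv invgM mulVKg //.
    by rewrite d_ginv; apply: disp; lia.
  have h2 := st t tl; rewrite -/z in h2.
  have h3 : d (v ** c' (r + (len - t))) (v ** z) <= D by rewrite d_mul d_sym.
  have h4 : d (v ** z) (v ** (h ^^ i ** z)) <= 2 * A + S * n by rewrite d_mul; apply: mv.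
  rewrite vk; move: h1 h2 h3 h4; set z' := c' _ => h1 h2 h3 h4.
  have := d_tri z' z (v ** (h ^^ i ** z)); have := d_tri (v ** z') z' (v ** (h ^^ i ** z)).
  by have := d_tri (v ** z) (v ** z') (v ** (h ^^ i ** z)); rewrite /M2; lia.
pose M := 2 * A + 2 * D + 3 * K.
have kM i : i <= S -> d y (k i ** y) <= M.
  move=> iS; have [h1 _] := BP i iS; have h2 := nearo hl hlL.
  have h3 : d (ginv (h' ^^ B i) ** (h ^^ i ** y)) P' <= 3 * K + D + A.
    by rewrite -(d_mul (h' ^^ B i)) gmulVK.
  have h4 : d (k i ** y) (o b0) <= 3 * K + D + A by rewrite /k /o -!gmulA d_mul.
  by have := d_tri (o b0) y (k i ** y); have := d_sym (k i ** y) (o b0); rewrite /M -/y -/b0 in h2 *; lia.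
have ty i : exists t : nat * G, i <= S ->
    t \in [seq (j, g) | j <- iota 0 (2 * M + 1), g <- ball] /\
    k i ** y = c (s + (t.1 + hl - M)) ** t.2.
  case: (leqP i S) => [iS|]; last by exists (0, gone G).
  have [||t tl [t1 _ [t2 t3]]] := @near (k i) M2 (leqnn _) _ _ M (kM i iS).
  - by have := kmove i 0 iS (leq0n _); rewrite cs.
  - exact: kmove.
  (* Positions are stored relative to hl - M, which makes them at most 2 M; the second component is
     the difference of length at most 3 K. *)
  exists (t + M - hl, ginv (c (s + t)) ** (k i ** y)) => _; split.
    apply/allpairsP; exists (t + M - hl, ginv (c (s + t)) ** (k i ** y)); split=> //=.
      by rewrite mem_iota; lia.
    exact: ballP.
  rewrite /=; have -> : t + M - hl + hl - M = t by lia.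
  by rewrite gmulVK.
have [ft ftP] := choice ty.
have Ssize : size [seq (j, g) | j <- iota 0 (2 * M + 1), g <- ball] = S.
  by rewrite size_allpairs size_iota.
have [i [j [ij jS E]]] : exists i j, [/\ i < j, j <= S & ft i = ft j].
  have [|i [j [ij jS E]]] := @pigeonhole _ [seq (j, g) | j <- iota 0 (2 * M + 1), g <- ball] ft.
    by move=> i; rewrite Ssize => /ftP[].
  by exists i, j; rewrite -Ssize.
have kk : k i = k j.
  have [_ e1] := ftP i (ltnW (leq_trans ij jS)); have [_ e2] := ftP j jS.
  by apply: (@gmul_injr _ y); rewrite e1 e2 E.
have {}kk : ginv (h' ^^ B i) = ginv (h' ^^ B j) ** h ^^ (j - i).
  apply: (@gmul_injr _ (h ^^ i)); rewrite -gmulA -gpowD subnK ?(ltnW ij) //.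
  exact: gmul_inj kk.
have hp : h ^^ (j - i) = h' ^^ B j ** ginv (h' ^^ B i) by rewrite kk gmulVK.
have p0 : 0 < j - i by rewrite subn_gt0.
have pS : j - i <= S by lia.
exists (j - i); case: (leqP (B i) (B j)) => Bij; last first.
  exists (B i - B j).
  have hh : h ^^ (j - i) ** h' ^^ (B i - B j) = gone G.
    rewrite hp -{1}(subnK (ltnW Bij)) gpowD.
    by rewrite /gmul /ginv invgM mulVKg mulVg.
  split=> //; first by rewrite p0.
  rewrite subn_gt0 Bij /=; apply: leq_trans (lin' y _) _; rewrite leq_mul2l; apply/orP; right.
  rewrite -(d_mul (h ^^ (j - i))) gmulA hh g1mul d_sym; exact: mv.
(* Here a positive power of h would be a nonnegative power of h', the sign that [strip_direction]
   excludes in a strip of this length. *)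
exfalso; have : h ^^ (j - i) = h' ^^ (B j - B i).
  by rewrite hp -{1}(subnK Bij) gpowD -gmulA gmulV gmul1.
move/(strip_direction p0) => le; move: long; rewrite ltnNge => /negP; apply.
apply: leq_trans le _.
have : J * (4 * A + 2 * D + (j - i) * n) * n <= c1.
  by rewrite /c1 leq_mul2r leq_mul2l leq_add2l leq_mul2r pS !orbT.
by move: (J * _ * n) => X; lia.
Qed.

End Strip.
End Strips.

(** * Pumping solutions *)

(* (i, j, p, q) stands for the vector with p at i and q at j (p + q at i if i = j). *)
Notation pump := (nat * nat * nat * nat)%type.

Definition add_pump (r : pump) (x : nat -> nat) (a : nat) : nat :=
  let: (i, j, p, q) := r in x a + ((a == i) * p + (a == j) * q).

Definition add_pumps (rs : seq pump) (x : nat -> nat) := foldr add_pump x rs.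

Section Prefixes.
Variables (G : groupType) (u v : nat -> G).

Fixpoint prefix_val (x : nat -> nat) (i : nat) : G :=
  if i is j.+1 then prefix_val x j ** u j ^^ x j ** v j else gone G.
Local Notation pv := prefix_val.

Definition gconj (g h : G) : G := g ** h ** ginv g.
(** Side i of the polygon runs along the orbit of its first corner under this element. Inserting p
    more copies of [u i] multiplies everything after them from the left by its p-th power. *)
Definition axis (x : nat -> nat) i := gconj (pv x i) (u i).

Definition pump_ok (x : nat -> nat) (r : pump) :=
  let: (i, j, p, q) := r in axis x i ^^ p ** axis x j ^^ q = gone G.

Lemma gconj_pow g (h : G) n : gconj g h ^^ n = gconj g (h ^^ n).
Proof.
elim: n => [|n IH]; first by rewrite /gconj !gpow0 gmul1 gmulV.
by rewrite !gpowS IH /gconj -!gmulA gmulK.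
Qed.

Lemma gconj_mul g (h h' : G) : gconj g h ** gconj g h' = gconj g (h ** h').
Proof. by rewrite /gconj -!gmulA gmulK. Qed.

Lemma gconj_eq1 g (h : G) : gconj g h = gone G <-> h = gone G.
Proof.
split=> [E|->]; last by rewrite /gconj gmul1 gmulV.
by apply: (@gmul_inj _ g); apply: (@gmul_injr _ (ginv g)); rewrite gmul1 gmulV.
Qed.

Lemma gconjM g g' (h : G) : gconj g (gconj g' h) = gconj (g ** g') h.
Proof. by rewrite /gconj /gmul /ginv invgM !mulgA. Qed.

Lemma gconj_id g (h : G) : g ** h = h ** g -> gconj g h = h.
Proof. by rewrite /gconj => ->; rewrite -gmulA gmulV gmul1. Qed.

Lemma axis_pow x i p : axis x i ^^ p ** pv x i = pv x i ** u i ^^ p.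
Proof. by rewrite /axis gconj_pow /gconj -gmulA gVmul gmul1. Qed.

Lemma prefix_val_ext x y k : (forall i, i < k -> x i = y i) -> pv x k = pv y k.
Proof. by elim: k => //= k IH H; rewrite IH ?H // => i ik; apply: H; lia. Qed.

(** Both axes are taken at the old x: the insertion at i acts from the left on what the insertion at
    j has already changed. *)
Lemma prefix_add_pump x i j p q a : i <= j -> pv (add_pump (i, j, p, q) x) a =
  (if i < a then axis x i ^^ p else gone G) **
  ((if j < a then axis x j ^^ q else gone G) ** pv x a).
Proof.
move=> ij; elim: a => [|a IH]; first by rewrite /= !g1mul.
rewrite [LHS]/= IH {IH} [pv x a.+1]/=.
have jump r m z : pv x a ** (u a ^^ (x a + (r + m)) ** z) =
    axis x a ^^ r ** (pv x a ** (u a ^^ (x a + m) ** z)).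
  have -> : x a + (r + m) = r + (x a + m) by lia.
  by rewrite gpowD -gmulA (gmulA (pv x a)) -axis_pow -!gmulA.
rewrite ltnS [j < a.+1]ltnS.
case: (ltngtP a i) => ai; case: (ltngtP a j) => aj; rewrite /= ?g1mul -?gmulA.
all: try lia.
- by rewrite !mul0n !addn0.
- by rewrite !mul0n !addn0.
- by rewrite !mul0n !addn0.
- by rewrite mul0n mul1n add0n -[q in LHS]addn0 jump addn0 -aj.
- by rewrite mul0n mul1n jump addn0 -ai.
by rewrite !mul1n jump -[q in LHS]addn0 jump addn0 -ai -aj.
Qed.

Lemma axis_eq_pow x a i j p q : i <= j -> pump_ok x (i, j, p, q) -> j < a ->
  pv (add_pump (i, j, p, q) x) a = pv x a.
Proof.
move=> ij ok ja; rewrite prefix_add_pump // ja (leq_ltn_trans ij ja) gmulA.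
by rewrite (ok : _ = _) g1mul.
Qed.

Lemma axis_add_pump_out x i j p q a : i <= j -> pump_ok x (i, j, p, q) -> ~~ (i < a < j) ->
  axis (add_pump (i, j, p, q) x) a = axis x a.
Proof.
move=> ij ok aij; rewrite {1}/axis prefix_add_pump //.
case: (ltnP i a) => ia; last by rewrite ltnNge (leq_trans ia ij) /= !g1mul.
case: (ltnP j a) => ja; first by rewrite gmulA (ok : _ = _) g1mul.
(* The end j is conjugated by the power of axis i, but by [pump_ok] this is the inverse of a power
   of axis j itself, and commutes with it. *)
have -> : a = j by lia.
rewrite g1mul -gconjM -/(axis x j) gconj_id //.
have -> : axis x i ^^ p = ginv (axis x j ^^ q).
  by apply: (@gmul_injr _ (axis x j ^^ q)); rewrite gVmul; exact: ok.
rewrite -[X in _ ** X]gpow1 -{1}[axis x j]gpow1.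
by rewrite /gmul /ginv /gpow -expVgn; apply: commuteX2; apply/commute_sym/commuteV.
Qed.

Lemma axis_add_pump_in x i j p q a : i <= a <= j ->
  axis (add_pump (i, j, p, q) x) a = gconj (axis x i ^^ p) (axis x a).
Proof.
case/andP=> ia aj; rewrite {1}/axis prefix_add_pump ?(leq_trans ia aj) //.
rewrite [j < a]ltnNge aj g1mul; case: (ltngtP i a) ia => // [_ _|<- _].
  by rewrite -gconjM.
by rewrite g1mul -/(axis x i) gconj_id // -[X in _ ** X]gpow1 -{2}[axis x i]gpow1 gpow_addC.
Qed.

Lemma pump_ok_self x i j p q : i <= j ->
  pump_ok (add_pump (i, j, p, q) x) (i, j, p, q) <-> pump_ok x (i, j, p, q).
Proof.
move=> ij; rewrite /pump_ok !axis_add_pump_in ?leqnn ?ij // !gconj_pow gconj_mul.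
exact: gconj_eq1.
Qed.

(** As the pairs do not cross, either the axes at i' and j' are both conjugated by the same element,
    or both stay as they are. At i and j this conjugation changes nothing, so common ends do no
    harm. *)
Lemma pump_ok_other x i j p q i' j' p' q' : i <= j -> pair_nested i j i' j' ->
  pump_ok x (i, j, p, q) ->
  pump_ok (add_pump (i, j, p, q) x) (i', j', p', q') <-> pump_ok x (i', j', p', q').
Proof.
move=> ij [n1 n2] ok.
case: (boolP (i < i' < j)) => i'in.
  rewrite /pump_ok !axis_add_pump_in ?n1 //; last by lia.
  by rewrite !gconj_pow gconj_mul; apply: gconj_eq1.
case: (boolP (i < j' < j)) => j'in.
  rewrite /pump_ok !axis_add_pump_in ?n2 //; last by lia.
  by rewrite !gconj_pow gconj_mul; apply: gconj_eq1.
by rewrite /pump_ok !axis_add_pump_out.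
Qed.

Definition nested_pumps (rs : seq pump) := forall r r', r \in rs -> r' \in rs ->
  r.1.1.1 <= r.1.1.2 /\ pair_nested r.1.1.1 r.1.1.2 r'.1.1.1 r'.1.1.2.

(** An equivalence because the relations are found at the given solution and needed at the reduced
    one. *)
Lemma pump_ok_add_pumps rs ts x : nested_pumps rs -> {subset ts <= rs} ->
  (forall r, r \in rs -> pump_ok (add_pumps ts x) r) <-> (forall r, r \in rs -> pump_ok x r).
Proof.
move=> nest; elim: ts => [|t ts IH] sub; first by [].
have trs : t \in rs by apply: sub; rewrite inE eqxx.
have {IH} <- : (forall r, r \in rs -> pump_ok (add_pumps ts x) r) <->
    (forall r, r \in rs -> pump_ok x r) by apply: IH => r rts; apply: sub; rewrite inE rts orbT.
rewrite /=; move: (add_pumps ts x) => y; case: t trs {sub} => [[[i j] p] q] trs.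
have [ij _] := nest _ _ trs trs.
split=> H [[[i' j'] p'] q'] rrs; have [_ nst] := nest _ _ trs rrs;
  have := @pump_ok_other y i j p q i' j' p' q' ij nst.
  by move=> <-; [apply: H | apply/(pump_ok_self _ _ _ ij)/H].
by move=> ->; apply: H.
Qed.

Lemma prefix_add_pumps rs ts x k : nested_pumps rs -> {subset ts <= rs} ->
  (forall r, r \in rs -> r.1.1.2 < k /\ pump_ok x r) -> pv (add_pumps ts x) k = pv x k.
Proof.
move=> nest; elim: ts => [//|t ts IH] sub ok /=.
have sub' : {subset ts <= rs} by move=> r rts; apply: sub; rewrite inE rts orbT.
have trs : t \in rs by apply: sub; rewrite inE eqxx.
rewrite -IH //; have [h _] := pump_ok_add_pumps x nest sub'.
have [tk _] := ok t trs; have [ij _] := nest _ _ trs trs.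
have {}h : pump_ok (add_pumps ts x) t.
  by apply: (pump_ok_add_pumps x nest sub').2 => // r /ok[].
case: t {sub trs} h tk ij => [[[i j] p] q] h tk ij; exact: axis_eq_pow.
Qed.

End Prefixes.

Lemma map_In (T : Type) (U : eqType) (f : T -> U) (s : seq T) y :
  y \in map f s -> exists2 x, List.In x s & y = f x.
Proof.
elim: s => //= x s IH; rewrite inE => /orP[/eqP ->|/IH[z zs ->]]; first by exists x; [left|].
by exists z; [right|].
Qed.

Lemma In_filter (T : Type) (a : pred T) (s : seq T) x : List.In x (filter a s) <-> List.In x s /\ a x.
Proof.
elim: s => /= [|y s IH]; first by split=> [|[]].
case: ifP => ay /=; rewrite IH.
  by split=> [[<-|[]]|[[->|]]]; [split; [left|] | split; [right|] | left | right].
by split=> [[]|[[<-|]]]; [split; [right|] | rewrite ay | ].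
Qed.

Lemma mem_flatten_nseq (T : Type) (U : eqType) (f : T -> U) (m : T -> nat) (s : seq T) :
  {subset flatten [seq nseq (m x) (f x) | x <- s] <= map f s}.
Proof.
move=> y; elim: s => //= x s IH; rewrite mem_cat inE mem_nseq => /orP[/andP[_ ->] //|/IH ->].
by rewrite orbT.
Qed.

Definition pump_vec (r : pump) (a : nat) : nat :=
  (a == r.1.1.1) * r.1.2 + (a == r.1.1.2) * r.2.

Lemma add_pumpsE rs x a : add_pumps rs x a = x a + sumn [seq pump_vec r a | r <- rs].
Proof.
elim: rs => [|[[[i j] p] q] rs IH] /=; first by rewrite addn0.
by rewrite IH /pump_vec /=; lia.
Qed.

Lemma sumn_flatten_nseq (T : Type) (f : T -> pump) (m : T -> nat) (s : seq T) a :
  sumn [seq pump_vec r a | r <- flatten [seq nseq (m x) (f x) | x <- s]] =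
  sumn [seq m x * pump_vec (f x) a | x <- s].
Proof.
elim: s => //= x s IH; rewrite map_cat sumn_cat IH; congr (_ + _).
by rewrite map_nseq sumn_nseq mulnC.
Qed.

(** * Reducing a solution to polynomial size *)

Section Solutions.
Variables (G : groupType) (l : G -> nat) (K : nat).
Hypothesis hypl : hyp_length l K.
Local Notation d := (dist l).
Let d_sym := d_sym hypl.
Let d_tri := d_tri hypl.
Let d_mul := d_mul l.

Lemma geodesic_function y z :
  exists c, [/\ c 0 = y, c (d y z) = z & discrete_geodesic l c (d y z)].
Proof.
move: {2}(d y z) (erefl (d y z)) => n; elim: n z => [|n IH] z dn.
  exists (fun=> y); rewrite dn; split=> //; first exact: d_eq0 hypl _ _ dn.
  by move=> i j ij; rewrite (dxx hypl); lia.
have [|p [yp pz]] := @d_geo _ _ _ hypl y z n; first by rewrite dn.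
have [c [c0 cn cg]] := IH p yp; rewrite yp in cn cg; rewrite dn subSnn in pz.
exists (fun i => if i <= n then c i else z); rewrite dn /= ltnn; split=> //.
have toz i : i <= n -> d (c i) z = n.+1 - i.
  move=> iL; have := cg 0 i; have := cg i n; rewrite c0 cn.
  by have := d_tri (c i) y z; have := d_tri p (c i) z; lia.
move=> i j /andP[ij jn]; case: (leqP j n) => jn'.
  by rewrite (leq_trans ij jn') cg //; lia.
have -> : j = n.+1 by lia.
case: (leqP i n) => i_n; first exact: toz.
by rewrite (dxx hypl); lia.
Qed.

Lemma linear_growth_conj J (g h : G) : linear_growth l J h -> linear_growth l J (gconj g h).
Proof.
move=> lin y m; have := lin (ginv g ** y) m.
by rewrite gconj_pow /gconj -(d_mul g (ginv g ** y)) gmulVK !gmulA.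
Qed.

Section Sides.
Variables (u v : nat -> G) (x : nat -> nat).
(** The polygon has 2 k sides: side 2 i is spanned by u_i^(x_i) and side 2 i + 1 by v_i. *)
Definition corner a := if odd a then prefix_val u v x a./2 ** u a./2 ^^ x a./2 else prefix_val u v x a./2.
Definition side_length a := d (corner a) (corner a.+1).

Lemma corner_even i : corner (2 * i) = prefix_val u v x i.
Proof. by rewrite /corner mul2n odd_double doubleK. Qed.

Lemma corner_odd i : corner (2 * i).+1 = prefix_val u v x i ** u i ^^ x i.
Proof. by rewrite /corner mul2n /= odd_double /= uphalf_double. Qed.

Lemma corner_odd_next i : corner (2 * i).+2 = prefix_val u v x i.+1.
Proof. by rewrite -corner_even; congr corner; lia. Qed.

Lemma side_length_even i : side_length (2 * i) = l (u i ^^ x i).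
Proof. by rewrite /side_length corner_even corner_odd /dist gmulK. Qed.

Lemma side_length_odd i : side_length (2 * i).+1 = l (v i).
Proof. by rewrite /side_length corner_odd corner_odd_next /dist /= gmulK. Qed.

Lemma nontrivial_sides_le k : nontrivial_sides side_length (2 * k) <= \sum_(i < k) (l (u i) + l (v i)).
Proof.
elim: k => [|k IH]; first by rewrite muln0.
rewrite mulnS add2n !nontrivial_sidesS big_ord_recr /= -addnA leq_add //.
rewrite side_length_even side_length_odd; have := l_gpow hypl (u k) (x k).
case: (l (u k)) => [|n]; first by rewrite muln0; lia.
lia.
Qed.

End Sides.

Section Linear.
Variables (J b n A : nat) (k : nat) (u v : nat -> G) (x : nat -> nat) (lin : pred nat).
Hypotheses (size_uv : \sum_(i < k) (l (u i) + l (v i)) <= n) (sol : prefix_val u v x k = gone G).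
Hypothesis linP : forall i, i < k -> lin i -> linear_growth l J (u i).
Hypothesis nlinP : forall i, i < k -> ~~ lin i -> x i <= J.
Variable ball : seq G.
Hypothesis ballP : forall g, l g <= 3 * K -> g \in ball.
Hypothesis orbitP : forall h P (x : nat) c L, linear_growth l J h -> d P (h ** P) <= n ->
  discrete_geodesic l c L -> c 0 = P -> c L = h ^^ x ** P -> exists m, orbit_geodesic l A h P x c L m.

(** Besides making strips long, this exceeds the length J n + n of any side not subject to linear
    growth, so that a long strip lies between two sides of linear growth. *)
Definition long_threshold J b A D n := strip_long K J b A D n + J * n + n.
Definition pump_bound J b A D n :=
  strip_exponent K b A D + J * (2 * A + strip_exponent K b A D * n).
(** The first summand bounds what a long strip retains after subtraction, the second the whole
    exponent of a short strip. *)
Definition residue_bound J b A D n :=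
  let S := strip_exponent K b A D in
  let E := J * (4 * A + 2 * D + S * n) in
  (E + 1) * (pump_bound J b A D n + 1) + J * (2 * A + long_threshold J b A D n).
Local Notation D := (strip_error K n).
Local Notation B := (long_threshold J (size ball) A D n).
Local Notation M := (pump_bound J (size ball) A D n).
Local Notation R := (residue_bound J (size ball) A D n).

Let P := corner u v x.
Let L := side_length u v x.
Let side_lin a := [&& ~~ odd a, a./2 < k & lin a./2].

Let luv i : i < k -> l (u i) <= n /\ l (v i) <= n.
Proof.
move=> ik; have := size_uv; rewrite (bigD1 (Ordinal ik)) //=; lia.
Qed.

Let side_short a : a < 2 * k -> ~~ side_lin a -> L a <= J * n + n.
Proof.
rewrite /side_lin /L => ak; have a2k : a./2 < k by lia.
have [lu lv] := luv a2k; rewrite a2k /= negb_and negbK => /orP[oa|nl].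
  have -> : a = (2 * a./2).+1 by have := odd_double_half a; rewrite oa -mul2n; lia.
  by rewrite side_length_odd; lia.
case: (boolP (odd a)) => oa.
  have -> : a = (2 * a./2).+1 by have := odd_double_half a; rewrite oa -mul2n; lia.
  by rewrite side_length_odd; lia.
have -> : a = 2 * a./2 by have := odd_double_half a; rewrite (negbTE oa) -mul2n; lia.
rewrite side_length_even; apply: leq_trans (l_gpow hypl _ _) _.
have := nlinP a2k nl; have : x a./2 * l (u a./2) <= J * n by apply: leq_mul => //; apply: nlinP.
lia.
Qed.

Record side_data (a : nat) (c : nat -> G) (m : nat -> nat) : Prop := SideData {
  sd_0 : c 0 = P a;
  sd_L : c (L a) = P a.+1;
  sd_geo : discrete_geodesic l c (L a);
  sd_lin : side_lin a -> orbit_geodesic l A (axis u v x a./2) (P a) (x a./2) c (L a) m;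
  sd_nlin : ~~ side_lin a -> m = (fun=> 0) }.

Let side_data_exists a : exists cm, side_data a cm.1 cm.2.
Proof.
have [c [c0 cL cg]] := geodesic_function (P a) (P a.+1).
case: (boolP (side_lin a)) => sl; last first.
  by exists (c, fun=> 0); split=> // h; rewrite h in sl.
have /and3P[oa a2k al] := sl.
have aE : a = 2 * a./2 by have := odd_double_half a; rewrite (negbTE oa) -mul2n; lia.
have Pa : P a = prefix_val u v x a./2 by rewrite /P aE corner_even -aE.
have PS : P a.+1 = axis u v x a./2 ^^ x a./2 ** P a.
  by rewrite Pa axis_pow /P aE corner_odd -aE.
have [|||m mP] := @orbitP (axis u v x a./2) (P a) (x a./2) c (L a) _ _ cg c0.
- by apply: linear_growth_conj; apply: linP.
- rewrite -[axis _ _ _ _]gpow1 Pa axis_pow gpow1 /dist gmulK.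
  by have [] := luv a2k.
- by rewrite cL PS.
by exists (c, m); split=> //; rewrite sl.
Qed.

Let e := nontrivial_sides L (2 * k).
Let e_n : e <= n.
Proof. exact: leq_trans (nontrivial_sides_le _ _ _ _) size_uv. Qed.

(** Each long strip gives up its relation as often as both of its weights allow, up to an error E.
    What remains of x i are the residues of at most 2 n strips and the weight of the short pieces on
    the final stack. *)
Lemma linear_solutions : exists x0 rs ts,
  [/\ nested_pumps rs,
   forall r, r \in rs -> [/\ r.1.1.2 < k, r.1.2 <= M, r.2 <= M & pump_ok u v x0 r],
   {subset ts <= rs}, x = add_pumps ts x0 &
   forall i, i < k -> x0 i <= J + 2 * n * (2 * R + J * (2 * A + n))].
Proof.
have [cm cmP] := choice side_data_exists.
(* The minimum extends m beyond the end of the side as a constant, since [polygon_strips] asks for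
   monotonicity on all of nat. *)
pose c a := (cm a).1; pose m a i := (cm a).2 (minn i (L a)).
have sdP a : side_data a (c a) (cm a).2 by apply: cmP.
have mmono a i j : i <= j -> m a i <= m a j.
  move=> ij; rewrite /m; case: (boolP (side_lin a)) => sl.
    by apply: (og_mono (sd_lin (sdP a) sl)); lia.
  by rewrite (sd_nlin (sdP a) sl).
have cg a : discrete_geodesic l (c a) (L a) := sd_geo (sdP a).
have c0 a : c a 0 = P a := sd_0 (sdP a).
have cL a : c a (L a) = P a.+1 := sd_L (sdP a).
have P0 : P (2 * k) = P 0 by rewrite /P corner_even sol.
have [st [rs0 [I ste]]] := polygon_strips hypl cg c0 cL mmono P0.
have I' : stack_inv l K P L c m (2 * k) st rs0 := I.
have gs r (H : List.In r rs0) := inv_strips I' H.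
have mlin a i : side_lin a -> i <= L a -> m a i = (cm a).2 i.
  by move=> _ iL; rewrite /m (minn_idPl iL).
have mgap a i len : i + len <= L a -> m a (i + len) - m a i <= J * (2 * A + len).
  move=> iL; case: (boolP (side_lin a)) => sl; last by rewrite /m (sd_nlin (sdP a) sl).
  have og := sd_lin (sdP a) sl; have /and3P[_ ak al] := sl.
  have iL' : i <= L a by lia.
  rewrite !mlin //; set h := axis u v x a./2 in og.
  have hl : linear_growth l J h by apply: linear_growth_conj; apply: linP.
  have gap := linear_growth_gap hypl (P a) ((cm a).2 (i + len)) ((cm a).2 i) hl.
  have n1 := og_near og iL; have n2 := og_near og iL'; have g := og_geo og.
  have : d (h ^^ (cm a).2 (i + len) ** P a) (h ^^ (cm a).2 i ** P a) <= 2 * A + len.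
    have := d_tri (c a (i + len)) (h ^^ (cm a).2 (i + len) ** P a) (h ^^ (cm a).2 i ** P a).
    have := d_tri (c a i) (c a (i + len)) (h ^^ (cm a).2 i ** P a).
    have := d_sym (h ^^ (cm a).2 (i + len) ** P a) (c a (i + len)).
    have := d_sym (c a i) (c a (i + len)); have := g i (i + len); lia.
  rewrite -/h in gap *; move: gap; set X := d _ _ => gap le.
  have : J * X <= J * (2 * A + len) by rewrite leq_mul2l le orbT.
  move: gap; set Y := J * X; set Z := J * (_ + _); lia.
pose wl r := m (si r) (ss r + sl r) - m (si r) (ss r).
pose wr r := m (sj r) (sr r + sl r) - m (sj r) (sr r).
have DD : strip_error K (nontrivial_sides L (2 * k)) <= D.
  have h1 : e * K <= n * K by rewrite leq_mul2r e_n orbT.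
  by rewrite /strip_error -/e; move: h1 e_n; set X := e * K; set Y := n * K; lia.
have data r : exists t : nat * nat * nat, List.In r rs0 ->
   [/\ [/\ t.2 * t.1.1 <= wl r, wl r <= t.2 * t.1.1 + R, t.2 * t.1.2 <= wr r & wr r <= t.2 * t.1.2 + R],
     (sl r <= B -> t.2 = 0) &
     (B < sl r -> [/\ side_lin (si r), side_lin (sj r), t.1.1 <= M, t.1.2 <= M &
        pump_ok u v x ((si r)./2, (sj r)./2, t.1.1, t.1.2)])].
  case: (pselect (List.In r rs0)) => [rrs|]; last by exists (0, 0, 0).
  have [/andP[ij jk] iL jL close] := gs r rrs.
  case: (leqP (sl r) B) => long.
    exists (0, 0, 0) => _; split=> //; rewrite mul0n !add0n; split=> //.
      apply: leq_trans (mgap _ _ _ iL) _; rewrite /residue_bound.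
      by apply: leq_trans (leq_addl _ _); rewrite leq_mul2l leq_add2l long orbT.
    apply: leq_trans (mgap _ _ _ jL) _; rewrite /residue_bound.
    by apply: leq_trans (leq_addl _ _); rewrite leq_mul2l leq_add2l long orbT.
  have sli : side_lin (si r).
    apply: contraT => nl; have := side_short (ltn_trans ij jk) nl; move: long; rewrite /long_threshold; lia.
  have slj : side_lin (sj r).
    apply: contraT => nl; have := side_short jk nl; move: long; rewrite /long_threshold; lia.
  have ogi := sd_lin (sdP (si r)) sli; have ogj := sd_lin (sdP (sj r)) slj.
  have [/and3P[_ ik il] /and3P[_ jk' jl]] := (sli, slj).
  have linJ : linear_growth l J (axis u v x (sj r)./2) by apply: linear_growth_conj; apply: linP.
  have near a : side_lin a -> d (P a) (axis u v x a./2 ** P a) <= n.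
    move=> /and3P[oa ak _].
    have aE : a = 2 * a./2 by have := odd_double_half a; rewrite (negbTE oa) -mul2n; lia.
    have -> : P a = prefix_val u v x a./2 by rewrite /P {1}aE corner_even.
    by rewrite -[axis _ _ _ _]gpow1 axis_pow gpow1 /dist gmulK; have [] := luv ak.
  have close' t : t <= sl r -> d (c (si r) (ss r + (sl r - t))) (c (sj r) (sr r + t)) <= D.
    by move=> tl; apply: leq_trans (close t tl) DD.
  have long' : strip_long K J (size ball) A D n < sl r by move: long; rewrite /long_threshold; lia.
  have [p [q [/andP[p0 pS] /andP[q0 qQ] pq]]] :=
    strip_commensurable hypl ogi ogj linJ (near _ sli) (near _ slj) iL jL close' ballP long'.
  have [w1 w2] := strip_weights hypl ogi ogj linJ (near _ sli) (near _ slj) iL jL close' p0 pq.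
  have wlE : wl r = (cm (si r)).2 (ss r + sl r) - (cm (si r)).2 (ss r).
    by rewrite /wl !mlin //; lia.
  have wrE : wr r = (cm (sj r)).2 (sr r + sl r) - (cm (sj r)).2 (sr r).
    by rewrite /wr !mlin //; lia.
  rewrite -wlE -wrE in w1 w2.
  set E := J * _ in w1 w2; set E' := J * (4 * A + 2 * D + strip_exponent K (size ball) A D * n).
  have EE : E <= E' by rewrite leq_mul2l leq_add2l leq_mul2r pS !orbT.
  have pM : p <= M by rewrite /pump_bound; lia.
  have qM : q <= M by rewrite /pump_bound; lia.
  have RE : (E' + 1) * (M + 1) <= R by rewrite /residue_bound leq_addr.
  (* With z = wl r / p, only z q <= wr r + E is known. Using E copies fewer keeps the subtracted
     amount below wr r, because q > 0. *)
  exists (p, q, wl r %/ p - E) => _; split=> /=; [|by []|by split].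
  have dm := divn_eq (wl r) p; have mp := ltn_pmod (wl r) p0.
  set z := wl r %/ p in w1 w2 dm *.
  have pR : (E + 1) * p <= R by apply: leq_trans RE; apply: leq_mul; lia.
  have qR : E + E * q <= R by apply: leq_trans RE; have := leq_mul EE qM; lia.
  have qE : E <= E * q by apply: leq_pmulr.
  case: (leqP z E) => zE.
    have -> : z - E = 0 by lia.
    rewrite !mul0n !add0n; split=> //; last by have := leq_mul zE (leqnn q); lia.
    by have := leq_mul zE (leqnn p); lia.
  rewrite !mulnBl.
  have h1 : E * p <= z * p by rewrite leq_mul2r ltnW ?orbT.
  have h2 : E * q <= z * q by rewrite leq_mul2r (ltnW zE) orbT.
  by split; lia.
have [t tP] := choice data.
pose pm r : pump := ((si r)./2, (sj r)./2, (t r).1.1, (t r).1.2).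
pose rsl := [seq r <- rs0 | B < sl r].
pose rs := map pm rsl.
pose ts := flatten [seq nseq (t r).2 (pm r) | r <- rsl].
pose SL a := sumn [seq (t r).2 * pump_vec (pm r) a | r <- rsl].
have rslP r : List.In r rsl -> List.In r rs0 /\ B < sl r by move/In_filter.
(* only even sides carry long strips, so that si r = 2 a iff a = (si r)./2 *)
have SLE a : SL a = sumn [seq (si r == 2 * a) * ((t r).2 * (t r).1.1) + (sj r == 2 * a) * ((t r).2 * (t r).1.2) | r <- rs0].
  rewrite /SL /rsl; elim: rs0 tP {I I' gs rs ts SL rsl rslP data} => //= r rs0 IH tP.
  have {}IH := IH (fun r' H => tP r' (or_intror H)).
  have [_ h1 h2] := tP r (or_introl erefl).
  case: ltnP => [/h2[sli slj _ _ _]|/h1 ->]; last by rewrite !mul0n !muln0 !add0n; exact: IH.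
  rewrite /= IH; congr (_ + _); rewrite /pump_vec /=.
  have half s : side_lin s -> (a == s./2) = (s == 2 * a).
    move=> /and3P[os _ _]; have := odd_double_half s; rewrite (negbTE os) add0n -mul2n => sE.
    by apply/eqP/eqP; lia.
  rewrite !half // mulnDr !(mulnCA (t r).2) //.
(* A strip has at most R left over at each of its two ends. *)
have SLw a : left_weight m (2 * a) rs0 + right_weight m (2 * a) rs0 <= SL a + size rs0 * (2 * R) /\
    SL a <= left_weight m (2 * a) rs0 + right_weight m (2 * a) rs0.
  rewrite SLE /left_weight /right_weight; move: (2 * a) => a'.
  elim: rs0 tP {I I' gs rs ts SL rsl rslP data SLE} => //= r rs0 IH tP.
  have [IH1 IH2] := IH (fun r' H => tP r' (or_intror H)).
  have [[h1 h2 h3 h4] _ _] := tP r (or_introl erefl).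
  move: IH1 IH2; rewrite (mulSn (size rs0)); set X := sumn _; set Y := sumn _; set Z := sumn _ => IH1 IH2.
  move: h1 h2 h3 h4; rewrite /wl /wr.
  move: R IH1 => R0 IH1; case: (si r =P a') => [->|_]; case: (sj r =P a') => [->|_]; rewrite ?mul1n ?mul0n => h1 h2 h3 h4; lia.
have SL0 a : k <= a -> SL a = 0.
  move=> ka; rewrite SLE; elim: rs0 gs {I I' rs ts SL rsl rslP data SLE SLw tP} => //= r rs0 IH gs.
  rewrite IH; last by move=> r' H; apply: gs; right.
  have [ij _ _ _] := gs r (or_introl erefl).
  have -> : (si r == 2 * a) = false by lia.
  by have -> : (sj r == 2 * a) = false by lia.
have wE i : i < k -> left_weight m (2 * i) rs0 + right_weight m (2 * i) rs0 + stack_weight m (2 * i) st =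
    if lin i then x i else 0.
  move=> ik; have i2 : (2 * i)./2 = i by rewrite mul2n doubleK.
  have i2k : 2 * i < 2 * k by lia.
  rewrite (inv_weight I' i2k); have sle : side_lin (2 * i) = lin i.
    by rewrite /side_lin i2 ik mul2n odd_double.
  case: ifP => li; rewrite -sle in li.
    have og := sd_lin (sdP _) li.
    by rewrite !mlin // (og_m0 og) (og_mL og) i2 subn0.
  by rewrite /m (sd_nlin (sdP _) (negbT li)).
have stw i : stack_weight m i st <= size st * (J * (2 * A + n)).
  have pts := inv_points I'; move: ste; rewrite /stack_weight -/e.
  elim: st pts {I I' wE} => //= [[[j s] len] st] IH pts ste.
  have h1 : j < 2 * k /\ s + len <= L j.
    have [] := pts j (s + len) (stack_length st + len); last by [].
    by left; split=> //; exists len.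
  rewrite mulSn leq_add //; last first.
    apply: IH => [j' q o H|]; first by apply: pts; right.
    by move: ste; rewrite /stack_length /=; lia.
  case: (j =P i) => [<-|_]; rewrite ?mul0n // mul1n.
  apply: leq_trans (mgap _ _ _ h1.2) _; rewrite leq_mul2l leq_add2l; apply/orP; right.
  by move: ste e_n; rewrite /stack_length /= -/e; lia.
pose x0 a := x a - SL a.
have SLx a : SL a <= x a.
  case: (ltnP a k) => ak; last by rewrite SL0.
  have [_ le] := SLw a; have := wE a ak; case: (lin a) => H; first by lia.
  by move: H le; lia.
have xE : x = add_pumps ts x0.
  by apply: funext => a; rewrite add_pumpsE sumn_flatten_nseq -/(SL a) /x0 subnK.
have nest : nested_pumps rs.
  move=> r r' /map_In[y /rslP[yrs yl] ->] /map_In[y' /rslP[yrs' yl'] ->] /=.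
  have [_ _ /(_ yl)[si1 sj1 _ _ _]] := tP y yrs; have [_ _ /(_ yl')[si2 sj2 _ _ _]] := tP y' yrs'.
  have [ij _ _ _] := gs y yrs; have := inv_nested I' yrs yrs'.
  have ev s : side_lin s -> s = 2 * s./2.
    by move=> /and3P[os _ _]; have := odd_double_half s; rewrite (negbTE os) add0n -mul2n.
  move: (ev _ si1) (ev _ sj1) (ev _ si2) (ev _ sj2) ij; rewrite /pair_nested.
  move: (si y) (sj y) (si y') (sj y') => s1 s2 s3 s4 e1 e2 e3 e4 ij [h1 h2]; clear - e1 e2 e3 e4 ij h1 h2.
  move: e1 e2 e3 e4 ij h1 h2; move: s1./2 s2./2 s3./2 s4./2 => a1 a2 a3 a4 -> -> -> -> ij h1 h2.
  by split; [lia | split=> h; [have := h1 | have := h2]; lia].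
have sub : {subset ts <= rs} := @mem_flatten_nseq _ _ pm (fun r => (t r).2) rsl.
have okx r : r \in rs -> [/\ r.1.1.2 < k, r.1.2 <= M, r.2 <= M & pump_ok u v x r].
  by move=> /map_In[y /rslP[yrs yl] ->]; have [_ _ /(_ yl)[_ /and3P[_ ? _] ? ? ?]] := tP y yrs; split.
exists x0, rs, ts; split=> //.
  move=> r rrs; have [h1 h2 h3 h4] := okx r rrs; split=> //.
  have := (pump_ok_add_pumps u v x0 nest sub).1; apply=> // r' r'rs.
  by rewrite -xE; have [] := okx r' r'rs.
move=> i ik; have [le1 le2] := SLw i; have := wE i ik; have := stw (2 * i); have := inv_size I'.
rewrite -/e /x0; case: (boolP (lin i)) => li size_e sw wi; last first.
  by apply: leq_trans (leq_subr _ _) _; apply: leq_trans (nlinP ik li) _; apply: leq_addr.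
have h1 : size rs0 * (2 * R) + size st * (J * (2 * A + n)) <= 2 * n * (2 * R + J * (2 * A + n)).
  rewrite (mulnDr (2 * n)) leq_add //; rewrite leq_mul2r; apply/orP; right; have := e_n; lia.
move: h1 le1 sw wi; set X := size rs0 * _; set Y := size st * _; set Z := 2 * n * _; lia.
Qed.

End Linear.

End Solutions.

Section PumpedSolutions.
Variables (G : groupType) (l : G -> nat) (K : nat).
Hypothesis hypl : hyp_length l K.

(** The torsion coordinates join here: they are reduced modulo a period of [u i], and the period
    becomes a relation of its own. Lists qs may repeat entries, so the last clause covers all
    multiplicities. *)
Lemma pumped_solutions : exists2 F, poly_bounded F & forall k (u v : nat -> G) n x,
  \sum_(i < k) (l (u i) + l (v i)) <= n -> prefix_val u v x k = gone G ->
  exists (x0 : nat -> nat) (rs ts : seq pump), [/\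
    forall r, r \in rs -> [/\ r.1.1.1 < k, r.1.1.2 < k, r.1.2 <= F n & r.2 <= F n],
    {subset ts <= rs}, forall i, x i = add_pumps ts x0 i,
    forall i, i < k -> x0 i <= F n &
    forall qs : seq pump, {subset qs <= rs} -> prefix_val u v (add_pumps qs x0) k = gone G].
Proof.
have [J [J0 JP]] := torsion_or_linear_growth hypl.
have [A Apoly AP] := orbit_geodesic_exists hypl J.
have [ball ballP] := hl_fin hypl (3 * K).
pose M n := pump_bound K J (size ball) (A n) (strip_error K n) n.
pose R n := residue_bound K J (size ball) (A n) (strip_error K n) n.
exists (fun n => J + M n + (J + 2 * n * (2 * R n + J * (2 * A n + n)))).
  rewrite /M /R /residue_bound /long_threshold /strip_long /strip_move /pump_bound
    /strip_exponent /strip_error; poly_bound.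
move=> k u v n x size_uv sol; pose lin i := `[< linear_growth l J (u i) >].
have exp i : exists q : nat, ~~ lin i -> 0 < q <= J /\ u i ^^ q = gone G.
  case: (JP (u i)) => [[q qP]|li]; first by exists q.
  by exists 0; move/negP; case; apply/asboolP.
have [p pP] := choice exp.
pose x1 i := if (i < k) && ~~ lin i then x i %% p i else x i.
have pv1 a : prefix_val u v x1 a = prefix_val u v x a.
  elim: a => //= a ->; congr (_ ** _ ** _); rewrite /x1; case: ifP => // /andP[_ /pP[_ up]].
  rewrite [in RHS](divn_eq (x a) (p a)) gpowD mulnC gpowM up gpow_one g1mul //.
have sol1 : prefix_val u v x1 k = gone G by rewrite pv1.
have linP i : i < k -> lin i -> linear_growth l J (u i) by move=> _ /asboolP.
have nlinP i : i < k -> ~~ lin i -> x1 i <= J.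
  move=> ik nl; rewrite /x1 ik nl /=; have [/andP[p0 pJ] _] := pP i nl.
  by apply: leq_trans pJ; apply/ltnW/ltn_pmod.
have [x0 [rs [ts [nest rsP sub x1E x0F]]]] := linear_solutions hypl size_uv sol1 linP nlinP ballP
  (fun h P x c L lin hn => AP h P n x c L lin hn).
pose tors := [seq i <- iota 0 k | ~~ lin i].
(* With both ends at i there is nothing strictly between them, so a torsion relation is nested with
   every other relation. *)
pose pm i : pump := (i, i, p i, 0).
pose rs' := rs ++ map pm tors.
have torsP r : r \in map pm tors -> exists2 i, (i < k) && ~~ lin i & r = pm i.
  by move=> /mapP[i]; rewrite mem_filter mem_iota => /andP[nl ik] ->; exists i; rewrite ?nl ?andbT.
pose ts' := ts ++ flatten [seq nseq (x i %/ p i) (pm i) | i <- tors].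
have sub' : {subset ts' <= rs'}.
  move=> r; rewrite !mem_cat => /orP[/sub -> //|/mem_flatten_nseq ->]; exact: orbT.
have nest' : nested_pumps rs'.
  move=> r r'; rewrite !mem_cat => /orP[rr|/torsP[i _ ->]] /orP[rr'|/torsP[j _ ->]] /=.
  - exact: nest.
  - have [h _] := nest r r rr rr; split=> //; rewrite /pair_nested; lia.
  - by split=> //; rewrite /pair_nested; lia.
  - by split=> //; rewrite /pair_nested; lia.
have rsP' r : r \in rs' -> r.1.1.2 < k /\ pump_ok u v x0 r.
  rewrite mem_cat => /orP[/rsP[]//|/torsP[i /andP[ik nl] ->]]; split=> //=.
  have [_ up] := pP i nl.
  by rewrite /pump_ok /axis !gconj_pow up gpow0 gconj_mul gmul1; apply/gconj_eq1.
exists x0, rs', ts'; split=> //.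
- move=> r rr; have [h1 _] := nest' r r rr rr; have [h2 _] := rsP' r rr.
  split=> //; first exact: leq_ltn_trans h1 h2.
    move: rr; rewrite mem_cat => /orP[/rsP[_ h _ _]|/torsP[i /andP[ik /pP[/andP[_ pJ] _]] ->] /=]; last by lia.
    by apply: leq_trans h _; rewrite -/(M n); lia.
  move: rr; rewrite mem_cat => /orP[/rsP[_ _ h _]|/torsP[i _ ->] //].
  by apply: leq_trans h _; rewrite -/(M n); lia.
- move=> a; rewrite add_pumpsE map_cat sumn_cat addnA sumn_flatten_nseq -add_pumpsE -x1E /x1.
  rewrite (_ : sumn _ = if (a < k) && ~~ lin a then x a %/ p a * p a else 0).
    by case: ifP; rewrite ?addn0 // => _; rewrite addnC -divn_eq.
  have -> : (a < k) && ~~ lin a = (a \in tors) by rewrite mem_filter mem_iota andbC.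
  have : uniq tors by rewrite filter_uniq ?iota_uniq.
  elim: tors {rs' ts' torsP sub' nest' rsP'} => //= i tors IH /andP[itors utors].
  rewrite IH // inE /pump_vec /= muln0 addn0; case: (a =P i) => [->|_] /=.
    by rewrite (negbTE itors) mul1n addn0.
  by rewrite mul0n muln0.
- move=> i ik; apply: leq_trans (x0F i ik) _; rewrite -/(R n); lia.
move=> qs subq; rewrite (prefix_add_pumps nest' subq rsP').
have := prefix_add_pumps (x := x0) nest' (_ : {subset ts <= rs'}) rsP'.
by rewrite -x1E sol1 => <- // r /sub rr; rewrite mem_cat rr.
Qed.

End PumpedSolutions.

(** * Recursive functions *)

Section Recursive.

Lemma recursive_ext n (f g : n.-tuple nat -> nat) : f =1 g -> recursive f -> recursive g.
Proof. by move=> /funext ->. Qed.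

Definition recursive2 (f : nat -> nat -> nat) :=
  @recursive 2 (fun x => f (tnth x ord0) (tnth x (lift ord0 ord0))).

Lemma recursive_comp1 n (f : nat -> nat) (F : n.-tuple nat -> nat) :
  computable f -> recursive F -> recursive (fun x => f (F x)).
Proof.
move=> rf rF; have := @rec_comp 1 n _ (fun=> F) rf (fun=> rF).
by apply: recursive_ext => x; rewrite /thead tnth_mktuple.
Qed.

Lemma recursive_comp2 n (f : nat -> nat -> nat) (F F' : n.-tuple nat -> nat) :
  recursive2 f -> recursive F -> recursive F' -> recursive (fun x => f (F x) (F' x)).
Proof.
move=> rf rF rF'.
have := @rec_comp 2 n _ (fun i => if i == ord0 then F else F') rf.
have H (i : 'I_2) : recursive (if i == ord0 then F else F') by case: ifP.
move/(_ H); apply: recursive_ext => x.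
by rewrite !tnth_mktuple /=.
Qed.

Lemma recursive2_computable (f : nat -> nat -> nat) F F' :
  recursive2 f -> computable F -> computable F' -> computable (fun x => f (F x) (F' x)).
Proof. by move=> rf rF rF'; exact: (recursive_comp2 rf rF rF'). Qed.

Lemma computable_id : computable id.
Proof.
apply: recursive_ext (rec_proj (ord0 : 'I_1)) => x.
by rewrite (tnth_nth 0) /thead (tnth_nth 0).
Qed.

Lemma computable_comp f g : computable f -> computable g -> computable (fun x => f (g x)).
Proof. by move=> cf cg; exact: (recursive_comp1 cf cg). Qed.

Lemma computable_succ : computable S. Proof. exact: rec_succ. Qed.

Lemma computable_const c : computable (fun=> c).
Proof.
elim: c => [|c IH]; first exact: rec_zero.
exact: (computable_comp computable_succ IH).
Qed.

Lemma recursive_const n c : recursive (fun _ : n.-tuple nat => c).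
Proof.
elim: c => [|c IH]; first exact: rec_zero.
exact: (recursive_comp1 computable_succ IH).
Qed.

Lemma recursive2_rec (f : nat -> nat) (g : nat -> nat -> nat) (h : nat -> nat -> nat) :
  computable f -> recursive2 g -> (forall x, h 0 x = f x) ->
  (forall y x, h y.+1 x = g (h y x) x) -> recursive2 h.
Proof.
move=> cf rg h0 hS.
have G : @recursive 3 (fun t => g (tnth t (lift ord0 ord0)) (tnth t (lift ord0 (lift ord0 ord0)))).
  by apply: recursive_comp2 => //; exact: rec_proj.
apply: (@rec_prim 1 _ _ _ cf G) => [x|y x].
  by rewrite !(tnth_nth 0) /= h0 /thead (tnth_nth 0).
by rewrite !(tnth_nth 0) /= hS.
Qed.

Lemma recursive2_flip f : recursive2 f -> recursive2 (fun x y => f y x).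
Proof. by move=> rf; apply: recursive_comp2 rf _ _; exact: rec_proj. Qed.

Lemma recursive2_left f : computable f -> recursive2 (fun x _ => f x).
Proof. by move=> cf; apply: recursive_comp1 cf _; exact: rec_proj. Qed.

Lemma recursive2_right f : computable f -> recursive2 (fun _ x => f x).
Proof. by move=> cf; apply: recursive_comp1 cf _; exact: rec_proj. Qed.

Lemma recursive2_comp (f g h : nat -> nat -> nat) : recursive2 f -> recursive2 g -> recursive2 h ->
  recursive2 (fun x y => f (g x y) (h x y)).
Proof. by move=> rf rg rh; exact: (recursive_comp2 rf rg rh). Qed.

Lemma recursive2_comp1 f (g : nat -> nat -> nat) : computable f -> recursive2 g ->
  recursive2 (fun x y => f (g x y)).
Proof. by move=> cf rg; exact: (recursive_comp1 cf rg). Qed.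

Lemma computable_rec c f g : recursive2 g -> f 0 = c -> (forall n, f n.+1 = g n (f n)) -> computable f.
Proof.
move=> rg f0 fS.
have : @recursive 1 (fun x => f (tnth x ord0)).
  apply: (@rec_prim 0 (fun=> c) (fun t => g (tnth t ord0) (tnth t (lift ord0 ord0)))) => [||x|y x].
  - exact: recursive_const.
  - exact: rg.
  - by rewrite (tnth_nth 0).
  - by rewrite !(tnth_nth 0) /= fS.
by apply: recursive_ext => x.
Qed.

Lemma recursive2_add : recursive2 addn.
Proof.
apply: (@recursive2_rec id (fun a _ => a.+1)) => //; first exact: computable_id.
exact: recursive2_left computable_succ.
Qed.

Lemma recursive2_mul : recursive2 muln.
Proof.
apply: (@recursive2_rec (fun=> 0) (fun a b => b + a)) => //; first exact: computable_const.
exact: recursive2_flip recursive2_add.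
Qed.

Lemma computable_pred : computable predn.
Proof.
apply: (@computable_rec 0 _ (fun n _ => n)) => //.
exact: recursive2_left computable_id.
Qed.

Lemma recursive2_sub : recursive2 subn.
Proof.
apply: recursive2_flip; apply: (@recursive2_rec id (fun a _ => a.-1)) => [||x|y x].
- exact: computable_id.
- exact: recursive2_left computable_pred.
- exact: subn0.
- exact: subnS.
Qed.

Lemma computable_eq0 : computable (fun n => n == 0).
Proof.
apply: (@computable_rec 1 _ (fun _ _ => 0)) => //.
exact: recursive2_left (computable_const 0).
Qed.

Lemma computable_odd : computable (fun n => odd n).
Proof.
apply: (@computable_rec 0 _ (fun _ b => b == 0)) => // [|n].
  exact: recursive2_right computable_eq0.
by rewrite oddS; case: (odd n).
Qed.

Lemma computable_half : computable half.
Proof.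
apply: (@computable_rec 0 _ (fun n b => odd n + b)) => // [|n].
  apply: recursive2_comp recursive2_add _ _.
    exact: recursive2_left computable_odd.
  exact: recursive2_right computable_id.
by rewrite [LHS]/= uphalf_half.
Qed.

Lemma computable_exp2 : computable (expn 2).
Proof.
apply: (@computable_rec 1 _ (fun _ b => b + b)) => // [|n].
  by apply: recursive2_comp recursive2_add _ _; exact: recursive2_right computable_id.
by rewrite expnS mul2n addnn.
Qed.

Lemma recursive2_iter f : computable f -> recursive2 (fun n x => iter n f x).
Proof.
move=> cf; apply: (@recursive2_rec id (fun a _ => f a)) => //; first exact: computable_id.
exact: recursive2_left.
Qed.

End Recursive.

(* A list is coded by 0 if it is empty, and by cons_code of the codes of its
   head and of its tail otherwise. *)
Definition cons_code (n m : nat) := 2 ^ n * m.*2.+1.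
Definition head_code c := head 0 (CodeSeq.decode c).
Definition tail_code c := CodeSeq.code (behead (CodeSeq.decode c)).

Lemma head_cons_code n m : head_code (cons_code n m) = n.
Proof.
rewrite /head_code -[m]CodeSeq.decodeK.
by rewrite -[cons_code _ _]/(CodeSeq.code (n :: CodeSeq.decode m)) CodeSeq.codeK.
Qed.

Lemma tail_cons_code n m : tail_code (cons_code n m) = m.
Proof.
rewrite /tail_code -{1}[m]CodeSeq.decodeK.
rewrite -[cons_code _ _]/(CodeSeq.code (n :: CodeSeq.decode m)) CodeSeq.codeK.
exact: CodeSeq.decodeK.
Qed.

Lemma cons_code_surj c : c = 0 \/ c = cons_code (head_code c) (tail_code c).
Proof.
rewrite -[c]CodeSeq.decodeK; case: (CodeSeq.decode c) => [|n s]; [by left | right].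
by rewrite -[CodeSeq.code (n :: s)]/(cons_code n (CodeSeq.code s)) head_cons_code tail_cons_code.
Qed.

Lemma computable_cons F F' : computable F -> computable F' ->
  computable (fun x => cons_code (F x) (F' x)).
Proof.
move=> cF cF'; apply: recursive2_computable recursive2_mul _ _.
  exact: computable_comp computable_exp2 cF.
apply: (computable_comp computable_succ).
have := recursive2_computable recursive2_add cF' cF'.
by apply: recursive_ext => x; rewrite addnn.
Qed.

Lemma iter_half n m : iter n half (2 ^ n * m) = m.
Proof. by elim: n m => [|n IH] m; rewrite ?mul1n // iterSr expnS -mulnA mul2n doubleK. Qed.

(** The head of a nonempty list is the exponent of 2 in its code, the least y such that halving y
    times gives an odd number. The factor c makes 0 the answer for the code c = 0 of the empty
    list. *)
Lemma computable_head : computable head_code.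
Proof.
have H : @recursive 2 (fun t => (nat_of_bool (odd (iter (tnth t ord0) half (tnth t (lift ord0 ord0)))) == 0) *
     tnth t (lift ord0 ord0)).
  apply: recursive_comp2 recursive2_mul _ _; last exact: rec_proj.
  apply: (recursive_comp1 computable_eq0); apply: (recursive_comp1 computable_odd).
  exact: recursive2_iter computable_half.
apply: (@rec_min 1 _ _ H) => [x|x y]; rewrite !(tnth_nth 0) /= /thead (tnth_nth 0).
  case: (cons_code_surj (nth 0 x 0)) => ->; first by rewrite muln0.
  by rewrite head_cons_code iter_half /= odd_double.
case: (cons_code_surj (nth 0 x 0)) => ->; first by rewrite /head_code.
rewrite head_cons_code => yx; rewrite muln_eq0 negb_or eqb0 negbK eqb0.
rewrite muln_eq0 expn_eq0 /= andbT.
rewrite -(subnKC (ltnW yx)) /cons_code expnD -mulnA iter_half oddM oddX.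
by rewrite subn_eq0 leqNgt yx.
Qed.

Lemma computable_tail : computable tail_code.
Proof.
have H : computable (fun c => half (iter (head_code c) half c)).
  apply: (computable_comp computable_half).
  by apply: recursive2_computable (recursive2_iter computable_half) computable_head computable_id.
apply: recursive_ext H => x; case: (cons_code_surj (thead x)) => ->.
  by rewrite /tail_code /head_code /=.
by rewrite head_cons_code tail_cons_code iter_half /= uphalf_double.
Qed.

Lemma computable_if F F' F'' : computable F -> computable F' -> computable F'' ->
  computable (fun x => if F x == 0 then F' x else F'' x).
Proof.
move=> cF cF' cF''.
have c1 : computable (fun x => (F x == 0) * F' x).
  by apply: recursive2_computable recursive2_mul _ cF'; apply: (computable_comp computable_eq0).
have c2 : computable (fun x => ((F x == 0) == 0 :> nat) * F'' x).
  apply: recursive2_computable recursive2_mul _ cF''; apply: (computable_comp computable_eq0).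
  by apply: (computable_comp computable_eq0).
have := recursive2_computable recursive2_add c1 c2.
by apply: recursive_ext => x; case: ifP => _; rewrite /= ?mul1n ?mul0n ?addn0.
Qed.

Definition pair_code a b := cons_code a (cons_code b 0).
Definition snd_code c := head_code (tail_code c).

Lemma fst_pair_code a b : head_code (pair_code a b) = a. Proof. exact: head_cons_code. Qed.
Lemma snd_pair_code a b : snd_code (pair_code a b) = b.
Proof. by rewrite /snd_code tail_cons_code head_cons_code. Qed.

Lemma computable_pair F F' : computable F -> computable F' ->
  computable (fun x => pair_code (F x) (F' x)).
Proof. by move=> cF cF'; do 2!apply: computable_cons => //; exact: computable_const. Qed.

Lemma computable_snd : computable snd_code.
Proof. exact: computable_comp computable_head computable_tail. Qed.

Lemma computable_iter N F s : computable N -> computable F -> computable s ->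
  computable (fun x => iter (N x) (fun a => F (pair_code a x)) (s x)).
Proof.
move=> cN cF cs.
have H : recursive2 (fun n x => iter n (fun a => F (pair_code a x)) (s x)).
  apply: (@recursive2_rec s (fun a x => F (pair_code a x))) => //.
  apply: recursive2_comp1 cF _; rewrite /pair_code /cons_code.
  have cons2 (f g : nat -> nat -> nat) : recursive2 f -> recursive2 g -> recursive2 (fun x y => cons_code (f x y) (g x y)).
    move=> rf rg; apply: recursive2_comp recursive2_mul _ _.
      exact: recursive2_comp1 computable_exp2 rf.
    apply: (recursive2_comp1 computable_succ).
    have := recursive2_comp recursive2_add rg rg.
    by apply: recursive_ext => x; rewrite addnn.
  apply: (cons2 (fun a _ => a) (fun _ x => cons_code x 0)).
    exact: recursive2_left computable_id.
  by apply: recursive2_right; apply: computable_cons computable_id (computable_const 0).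
exact: recursive2_computable H cN computable_id.
Qed.

(** * Computable functions on countable types *)

Notation pickle := choice.pickle.

(** Nothing is asked of g off the codes of T. The codes of pairs and lists unfold to [cons_code], so
    the constructors of these types become arithmetic operations. *)
Definition Comp (T U : countType) (f : T -> U) :=
  exists g, computable g /\ forall x, g (pickle x) = pickle (f x).

Section Combinators.
Implicit Types (T U V X A B : countType).

Lemma Comp_id T : Comp (fun x : T => x).
Proof. by exists id; split=> //; exact: computable_id. Qed.

Lemma Comp_comp T U V (f : U -> V) (g : T -> U) : Comp f -> Comp g -> Comp (fun x => f (g x)).
Proof.
move=> [f' [cf fE]] [g' [cg gE]]; exists (fun x => f' (g' x)); split.
  exact: computable_comp cf cg.
by move=> x; rewrite gE fE.
Qed.

Lemma Comp_const T U (u : U) : Comp (fun _ : T => u).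
Proof. by exists (fun=> pickle u); split=> //; exact: computable_const. Qed.

Lemma Comp_pair X T U (f : X -> T) (g : X -> U) : Comp f -> Comp g -> Comp (fun x => (f x, g x)).
Proof.
move=> [f' [cf fE]] [g' [cg gE]]; exists (fun x => pair_code (f' x) (g' x)); split.
  exact: computable_pair.
by move=> x; rewrite fE gE.
Qed.

Lemma Comp_fst X T U (f : X -> T * U) : Comp f -> Comp (fun x => (f x).1).
Proof.
move=> cf; apply: (@Comp_comp X _ T fst f) => //; exists head_code; split; first exact: computable_head.
by case=> a b; exact: fst_pair_code.
Qed.

Lemma Comp_snd X T U (f : X -> T * U) : Comp f -> Comp (fun x => (f x).2).
Proof.
move=> cf; apply: (@Comp_comp X _ U snd f) => //; exists snd_code; split; first exact: computable_snd.
by case=> a b; exact: snd_pair_code.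
Qed.

Lemma Comp_cons X T (f : X -> T) (g : X -> seq T) : Comp f -> Comp g -> Comp (fun x => f x :: g x).
Proof.
move=> [f' [cf fE]] [g' [cg gE]]; exists (fun x => cons_code (f' x) (g' x)); split.
  exact: computable_cons.
by move=> x; rewrite fE gE.
Qed.

Lemma Comp_if X T (b : X -> bool) (f g : X -> T) : Comp b -> Comp f -> Comp g ->
  Comp (fun x => if b x then f x else g x).
Proof.
move=> [b' [cb bE]] [f' [cf fE]] [g' [cg gE]].
exists (fun x => if b' x == 0 then g' x else f' x); split; first exact: computable_if.
by move=> x; rewrite bE fE gE; case: (b x).
Qed.

Lemma Comp_case X T U (l : X -> seq T) (z : X -> U) (F : T * seq T * X -> U) :
  Comp l -> Comp z -> Comp F ->
  Comp (fun x => if l x is a :: s then F (a, s, x) else z x).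
Proof.
move=> [l' [cl lE]] [z' [cz zE]] [F' [cF FE]].
exists (fun x => if l' x == 0 then z' x else
   F' (pair_code (pair_code (head_code (l' x)) (tail_code (l' x))) x)); split.
  apply: computable_if => //; apply: (computable_comp cF); apply: computable_pair.
    by apply: computable_pair; [exact: computable_comp computable_head cl | exact: computable_comp computable_tail cl].
  exact: computable_id.
move=> x; rewrite lE; case: (l x) => [|a s]; first by rewrite /= zE.
rewrite -[pickle (a :: s)]/(cons_code (pickle a) (pickle s)) head_cons_code tail_cons_code.
by rewrite muln_eq0 expn_eq0 /= -FE.
Qed.

Lemma size_le_code s : size s <= CodeSeq.code s.
Proof.
elim: s => //= n s IH; apply: leq_trans (leq_pmull _ (expn_gt0 2 n)).
by rewrite ltnS -addnn (leq_trans IH) // leq_addr.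
Qed.

(** The state is the accumulator paired with the rest of the list. The loop is run as many times as
    the code of the list says, which is at least its length, and it idles once the list is empty. *)
Lemma Comp_foldl X T U (l : X -> seq T) (z : X -> U) (F : T -> U -> X -> U) :
  Comp l -> Comp z -> Comp (fun y : T * U * X => F y.1.1 y.1.2 y.2) ->
  Comp (fun x => foldl (fun acc a => F a acc x) (z x) (l x)).
Proof.
move=> [l' [cl lE]] [z' [cz zE]] [F' [cF FE]].
pose st y := head_code y.
pose step y := if snd_code (st y) == 0 then st y else
  pair_code (F' (pair_code (pair_code (head_code (snd_code (st y))) (head_code (st y))) (snd_code y)))
   (tail_code (snd_code (st y))).
have cst : computable st by exact: computable_head.
have crest : computable (fun y => snd_code (st y)) by exact: computable_comp computable_snd cst.
have cstep : computable step.
  apply: computable_if => //; apply: computable_pair.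
    apply: (computable_comp cF); apply: computable_pair; last exact: computable_snd.
    by apply: computable_pair; apply: (computable_comp computable_head).
  exact: computable_comp computable_tail crest.
exists (fun x => head_code (iter (l' x) (fun a => step (pair_code a x)) (pair_code (z' x) (l' x)))); split.
  apply: (computable_comp computable_head); apply: computable_iter => //.
  exact: computable_pair.
move=> x; rewrite lE zE.
suff E n s acc : size s <= n -> iter n (fun a => step (pair_code a (pickle x))) (pair_code (pickle acc) (pickle s)) =
    pair_code (pickle (foldl (fun acc a => F a acc x) acc s)) 0.
  rewrite E ?fst_pair_code //; apply: leq_trans (size_le_code _); by rewrite size_map.
elim: n s acc => [|n IH] [|a s] acc // sn; rewrite iterSr {2}/step /st fst_pair_code !snd_pair_code fst_pair_code.
  exact: (IH [::] acc isT).
rewrite -[pickle (a :: s)]/(cons_code (pickle a) (pickle s)) head_cons_code tail_cons_code.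
rewrite muln_eq0 expn_eq0 /= -IH //; congr (iter _ _ (pair_code _ _)).
exact: (FE (a, acc, x)).
Qed.

Lemma Comp_rev X T (l : X -> seq T) : Comp l -> Comp (fun x => rev (l x)).
Proof.
move=> cl; have -> : (fun x => rev (l x)) = fun x => foldl (fun acc a => a :: acc) [::] (l x).
  apply: funext => x; rewrite -[RHS]cats0; move: (l x) => s.
  suff E acc : foldl (fun acc a => a :: acc) acc s = rev s ++ acc by rewrite E !cats0.
  by elim: s acc => //= a s IH acc; rewrite IH rev_cons cat_rcons.
apply: (@Comp_foldl _ _ _ l (fun=> [::]) (fun a acc _ => a :: acc)) => //; first exact: Comp_const.
by apply: Comp_cons; [apply/Comp_fst/Comp_fst/Comp_id | apply/Comp_snd/Comp_fst/Comp_id].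
Qed.

Lemma Comp_foldr X T U (l : X -> seq T) (z : X -> U) (F : T -> U -> X -> U) :
  Comp l -> Comp z -> Comp (fun y : T * U * X => F y.1.1 y.1.2 y.2) ->
  Comp (fun x => foldr (fun a acc => F a acc x) (z x) (l x)).
Proof.
move=> cl cz cF.
have -> : (fun x => foldr (fun a acc => F a acc x) (z x) (l x)) =
   fun x => foldl (fun acc a => F a acc x) (z x) (rev (l x)).
  by apply: funext => x; rewrite foldl_rev.
by apply: Comp_foldl => //; exact: Comp_rev.
Qed.

Lemma Comp_cat X T (f g : X -> seq T) : Comp f -> Comp g -> Comp (fun x => f x ++ g x).
Proof.
move=> cf cg; have -> : (fun x => f x ++ g x) = fun x => foldr (fun a acc => a :: acc) (g x) (f x).
  by apply: funext => x; elim: (f x) => //= a s ->.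
apply: (@Comp_foldr _ _ _ f g (fun a acc _ => a :: acc)) => //.
by apply: Comp_cons; [apply/Comp_fst/Comp_fst/Comp_id | apply/Comp_snd/Comp_fst/Comp_id].
Qed.

(* The variables of the body are the projections of the pair (element, context). *)
Lemma Comp_map X T U (l : X -> seq T) (F : T -> X -> U) : Comp l ->
  Comp (fun y : T * X => F y.1 y.2) -> Comp (fun x => [seq F a x | a <- l x]).
Proof.
move=> cl cF; apply: (@Comp_foldr _ _ _ l (fun=> [::]) (fun a acc x => F a x :: acc)) => //.
  exact: Comp_const.
apply: Comp_cons; last by apply/Comp_snd/Comp_fst/Comp_id.
apply: (@Comp_comp _ _ _ (fun y : T * X => F y.1 y.2) (fun y : T * seq U * X => (y.1.1, y.2))) => //.
by apply: Comp_pair; [apply/Comp_fst/Comp_fst/Comp_id | apply/Comp_snd/Comp_id].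
Qed.

Lemma Comp_flatten X T (l : X -> seq (seq T)) : Comp l -> Comp (fun x => flatten (l x)).
Proof.
move=> cl; apply: (@Comp_foldr _ _ _ l (fun=> [::]) (fun a acc _ => a ++ acc)) => //.
  exact: Comp_const.
by apply: Comp_cat; [apply/Comp_fst/Comp_fst/Comp_id | apply/Comp_snd/Comp_fst/Comp_id].
Qed.

Lemma Comp_nat2 X (f : nat -> nat -> nat) (a b : X -> nat) : recursive2 f -> Comp a -> Comp b ->
  Comp (fun x => f (a x) (b x)).
Proof.
move=> rf [a' [ca aE]] [b' [cb bE]]; exists (fun x => f (a' x) (b' x)); split.
  exact: recursive2_computable.
by move=> x; rewrite aE bE.
Qed.

Lemma Comp_eq0 X (a : X -> nat) : Comp a -> Comp (fun x => a x == 0).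
Proof.
move=> [a' [ca aE]]; exists (fun x => a' x == 0); split.
  exact: computable_comp computable_eq0 ca.
by move=> x; rewrite aE.
Qed.

Lemma Comp_leq X (a b : X -> nat) : Comp a -> Comp b -> Comp (fun x => a x <= b x).
Proof. by move=> ca cb; apply/Comp_eq0/Comp_nat2 => //; exact: recursive2_sub. Qed.

Lemma Comp_neg X (b : X -> bool) : Comp b -> Comp (fun x => ~~ b x).
Proof. by move=> cb; apply: (@Comp_if _ bool b (fun=> false) (fun=> true)) => //; exact: Comp_const. Qed.

Lemma Comp_and X (b c : X -> bool) : Comp b -> Comp c -> Comp (fun x => b x && c x).
Proof. by move=> cb cc; apply: Comp_if => //; exact: Comp_const. Qed.

Lemma Comp_eq X T (a b : X -> T) : Comp a -> Comp b -> Comp (fun x => a x == b x).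
Proof.
move=> [a' [ca aE]] [b' [cb bE]].
exists (fun x => (a' x - b' x) + (b' x - a' x) == 0); split.
  apply: (computable_comp computable_eq0); apply: recursive2_computable recursive2_add _ _;
    exact: recursive2_computable recursive2_sub _ _.
move=> x; rewrite aE bE addn_eq0 !subn_eq0 -eqn_leq.
by rewrite (inj_eq (pcan_inj choice.pickleK)).
Qed.

(** A finite table is computable whatever f is. This admits the rewriting rule of Dehn's algorithm,
    which is obtained by choice. *)
Lemma Comp_finite T U (s : seq T) (f : T -> U) u :
  Comp (fun x => if x \in s then f x else u).
Proof.
elim: s => [|a s IH]; first exact: Comp_const.
have -> : (fun x => if x \in a :: s then f x else u) =
   fun x => if x == a then f a else if x \in s then f x else u.
  by apply: funext => x; rewrite inE; case: eqP => [->|].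
apply: Comp_if => //; last exact: Comp_const.
by apply: Comp_eq; [exact: Comp_id | exact: Comp_const].
Qed.

Lemma Comp_iter X U (n : X -> nat) (z : X -> U) (F : U -> X -> U) : Comp n -> Comp z ->
  Comp (fun y : U * X => F y.1 y.2) -> Comp (fun x => iter (n x) (fun a => F a x) (z x)).
Proof.
move=> [n' [cn nE]] [z' [cz zE]] [F' [cF FE]].
exists (fun x => iter (n' x) (fun a => F' (pair_code a x)) (z' x)); split.
  exact: computable_iter.
move=> x; rewrite nE zE -[pickle (n x)]/(n x); elim: (n x) (z x) => [//|m IH] a.
by rewrite !iterSr (FE (a, x)) IH.
Qed.

Lemma Comp_all X T (l : X -> seq T) (b : T -> X -> bool) : Comp l ->
  Comp (fun y : T * X => b y.1 y.2) -> Comp (fun x => all (fun a => b a x) (l x)).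
Proof.
move=> cl cb; apply: (@Comp_foldr _ _ _ l (fun=> true) (fun a acc x => b a x && acc)) => //.
  exact: Comp_const.
apply: Comp_and; last by apply/Comp_snd/Comp_fst/Comp_id.
apply: (@Comp_comp _ _ _ (fun y : T * X => b y.1 y.2) (fun y : T * bool * X => (y.1.1, y.2))) => //.
by apply: Comp_pair; [apply/Comp_fst/Comp_fst/Comp_id | apply/Comp_snd/Comp_id].
Qed.

Lemma Comp_filter X T (l : X -> seq T) (b : T -> X -> bool) : Comp l ->
  Comp (fun y : T * X => b y.1 y.2) -> Comp (fun x => [seq a <- l x | b a x]).
Proof.
move=> cl cb; apply: (@Comp_foldr _ _ _ l (fun=> [::]) (fun a acc x => if b a x then a :: acc else acc)) => //.
  exact: Comp_const.
apply: Comp_if; last by apply/Comp_snd/Comp_fst/Comp_id.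
  apply: (@Comp_comp _ _ _ (fun y : T * X => b y.1 y.2) (fun y : T * seq T * X => (y.1.1, y.2))) => //.
  by apply: Comp_pair; [apply/Comp_fst/Comp_fst/Comp_id | apply/Comp_snd/Comp_id].
by apply: Comp_cons; [apply/Comp_fst/Comp_fst/Comp_id | apply/Comp_snd/Comp_fst/Comp_id].
Qed.

Lemma Comp_size X T (l : X -> seq T) : Comp l -> Comp (fun x => size (l x)).
Proof.
move=> cl; apply: (@Comp_foldr _ _ _ l (fun=> 0) (fun _ n _ => n.+1)) => //; first exact: Comp_const.
have : Comp (fun y : T * nat * X => 1 + y.1.2); last by [].
by apply: Comp_nat2; [exact: recursive2_add | exact: Comp_const | apply/Comp_snd/Comp_fst/Comp_id].
Qed.

Lemma Comp_head X T (u : T) (l : X -> seq T) : Comp l -> Comp (fun x => head u (l x)).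
Proof.
move=> cl; apply: (@Comp_case _ _ _ l (fun=> u) (fun y => y.1.1)) => //; first exact: Comp_const.
by apply/Comp_fst/Comp_fst/Comp_id.
Qed.

Lemma Comp_behead X T (l : X -> seq T) : Comp l -> Comp (fun x => behead (l x)).
Proof.
move=> cl.
have : Comp (fun x => if l x is _ :: s then s else [::]).
  apply: (@Comp_case _ _ _ l (fun=> [::]) (fun y => y.1.2)) => //; first exact: Comp_const.
  by apply/Comp_snd/Comp_fst/Comp_id.
by congr Comp; apply: funext => x; case: (l x).
Qed.

Lemma Comp_take X T n (l : X -> seq T) : Comp l -> Comp (fun x => take n (l x)).
Proof.
elim: n X l => [|n IH] X l cl.
  have -> : (fun x => take 0 (l x)) = fun=> [::] by apply: funext => x; rewrite take0.
  exact: Comp_const.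
have : Comp (fun x => if l x is a :: s then a :: take n s else [::]).
  apply: (@Comp_case _ _ _ l (fun=> [::]) (fun y => y.1.1 :: take n y.1.2)) => //; first exact: Comp_const.
  apply: Comp_cons; first by apply/Comp_fst/Comp_fst/Comp_id.
  by apply: IH; apply/Comp_snd/Comp_fst/Comp_id.
by congr Comp; apply: funext => x; case: (l x).
Qed.

Lemma Comp_drop X T n (l : X -> seq T) : Comp l -> Comp (fun x => drop n (l x)).
Proof.
elim: n l => [|n IH] l cl.
  by have -> : (fun x => drop 0 (l x)) = l by apply: funext => x; rewrite drop0.
have -> : (fun x => drop n.+1 (l x)) = fun x => drop n (behead (l x)).
  by apply: funext => x; case: (l x).
exact/IH/Comp_behead.
Qed.

Lemma Comp_expn X n (a : X -> nat) : Comp a -> Comp (fun x => a x ^ n).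
Proof.
move=> ca; elim: n => [|n IH]; first exact: Comp_const.
have -> : (fun x => a x ^ n.+1) = fun x => a x * a x ^ n by apply: funext => x; rewrite expnS.
by apply: Comp_nat2 => //; exact: recursive2_mul.
Qed.

End Combinators.

(** * Dehn's algorithm *)

Section WordProblem.
Variables (G : groupType) (S : {fset G}).
Hypothesis genS : generating_set S.
Variable K : nat.
Hypothesis hypl : hyp_length (wlen genS) K.
Local Notation wlen := (wlen genS).
Implicit Types (w : word S).

Variable C : nat.
Hypothesis CE : C = 2 * K + 2.

Lemma short_words_list n : exists s : seq (word S), forall w, size w <= n -> w \in s.
Proof.
elim: n => [|n [s sP]].
  by exists [:: [::]] => w; rewrite leqn0 => /nilP ->; rewrite inE.
exists ([::] :: [seq a :: w | a <- enum (fset_sub_type S), w <- s]) => -[|a w] // wn.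
rewrite inE; apply/orP; right; apply/allpairsP; exists (a, w); split=> //.
  by rewrite mem_enum.
exact: sP.
Qed.

(** Geodesic words are fixed so that a pass which does not shorten a word leaves it unchanged, and
    then all its windows are geodesic. *)
Lemma shortening_rule : exists rule : word S -> word S, forall w,
  [/\ word_val (rule w) = word_val w, size (rule w) = wlen (word_val w) &
      geodesic_word genS w -> rule w = w].
Proof.
have ex w : exists v : word S, [/\ word_val v = word_val w, size v = wlen (word_val w) &
      geodesic_word genS w -> v = w].
  case: (pselect (geodesic_word genS w)) => [gw|ngw]; first by exists w.
  by have [v vE vs] := wlen_word genS (word_val w); exists v; split.
by have [rule ruleP] := choice ex; exists rule.
Qed.

Variables (rule : word S -> word S) (short : seq (word S)).
Hypothesis ruleP : forall w,
  [/\ word_val (rule w) = word_val w, size (rule w) = wlen (word_val w) &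
      geodesic_word genS w -> rule w = w].
Hypothesis shortP : forall w, size w <= C -> w \in short.

(** The membership test presents the rule as a finite table, to which [Comp_finite] applies. *)
Definition rewrite_prefix w :=
  (if take C w \in short then rule (take C w) else [::]) ++ drop C w.

Definition dehn_pass w := foldr (fun a acc => rewrite_prefix (a :: acc)) [::] w.

Definition is_trivial_word w := nilp (iter (size w) dehn_pass w).

Lemma rewrite_prefixE w : rewrite_prefix w = rule (take C w) ++ drop C w.
Proof. by rewrite /rewrite_prefix shortP // size_take; case: ltnP. Qed.

Lemma rewrite_prefix_val w : word_val (rewrite_prefix w) = word_val w.
Proof.
rewrite rewrite_prefixE word_val_cat; have [-> _ _] := ruleP (take C w).
by rewrite -word_val_cat cat_take_drop.
Qed.

Lemma dehn_pass_val w : word_val (dehn_pass w) = word_val w.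
Proof.
elim: w => //= a w IH; rewrite -/(dehn_pass w) rewrite_prefix_val.
by rewrite !word_val_cons IH.
Qed.

Definition locally_geodesic w := forall i, geodesic_word genS (take C (drop i w)).

Lemma rewrite_prefix_size w : size (rewrite_prefix w) <= size w ?= iff
  `[< geodesic_word genS (take C w) >].
Proof.
have [_ s r] := ruleP (take C w).
have -> : size w = size (take C w) + size (drop C w) by rewrite -size_cat cat_take_drop.
rewrite rewrite_prefixE size_cat s.
split; first by rewrite leq_add2r wlen_le.
by rewrite eqn_add2r; apply/eqP/asboolP.
Qed.

Lemma dehn_pass_size w : size (dehn_pass w) < size w \/ (dehn_pass w = w /\ locally_geodesic w).
Proof.
elim: w => [|a w IH].
  by right; split=> // i; rewrite /= /geodesic_word /= word_val_nil (wlen1 genS).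
rewrite /= -/(dehn_pass w); case: IH => [lt|[-> loc]].
  by left; apply: leq_ltn_trans (rewrite_prefix_size _) _.
have [le r] := rewrite_prefix_size (a :: w).
case: (pselect (geodesic_word genS (take C (a :: w)))) => [ga|na]; last first.
  by left; rewrite ltn_neqAle r le andbT; apply/asboolP.
right; split; last by case.
by rewrite rewrite_prefixE; have [_ _ ->] := ruleP (take C (a :: w)); rewrite ?cat_take_drop.
Qed.

Lemma locally_geodesic_trivial w : locally_geodesic w -> word_val w = 1%g -> w = [::].
Proof.
move=> loc w1; apply: size0nil.
apply: (@local_geodesic_loop _ _ _ hypl (fun i => word_val (take i w))).
  by rewrite take_size take0 w1 word_val_nil.
move=> i j /andP[ij jw] ji.
have -> : take j w = take i w ++ take (j - i) (drop i w).
  by rewrite take_drop subnK // -{1}(take_takel w ij) cat_take_drop.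
have := @geodesic_take _ _ genS (take C (drop i w)) 0 (j - i) (loc i).
rewrite take0 take_takel ?CE // word_val_nil invg1 mul1g subn0 size_take size_drop.
rewrite /dist /gmul /ginv word_val_cat mulKg => -> //.
by rewrite -CE in ji; case: ifP => _; lia.
Qed.

(** For a trivial word each pass shortens it or finds it locally geodesic, hence empty; so [size w]
    passes are enough. *)
Lemma is_trivial_wordP w : reflect (word_val w = 1%g) (is_trivial_word w).
Proof.
rewrite /is_trivial_word; have it n : word_val (iter n dehn_pass w) = word_val w.
  by elim: n => //= n <-; rewrite dehn_pass_val.
apply: (iffP nilP) => [E|w1]; first by rewrite -(it (size w)) E word_val_nil.
apply: size0nil; apply/eqP; rewrite -leqn0.
suff H n : size (iter n dehn_pass w) <= size w - n by rewrite -(subnn (size w)).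
elim: n => [|n IH]; first by rewrite subn0.
rewrite iterS; case: (dehn_pass_size (iter n dehn_pass w)) => [lt|[-> loc]].
  by rewrite subnS; lia.
by rewrite (locally_geodesic_trivial loc) ?it.
Qed.

Lemma Comp_rewrite_prefix (X : countType) (f : X -> word S) : Comp f -> Comp (fun x => rewrite_prefix (f x)).
Proof.
move=> cf; apply: Comp_cat; last exact: Comp_drop.
apply: (@Comp_comp _ _ _ (fun w => if w \in short then rule w else [::]) (fun x => take C (f x))).
  exact: Comp_finite.
exact: Comp_take.
Qed.

Lemma Comp_is_trivial_word (X : countType) (f : X -> word S) : Comp f -> Comp (fun x => is_trivial_word (f x)).
Proof.
move=> cf; apply: (@Comp_comp _ _ _ is_trivial_word f) => //.
apply: Comp_eq0; apply: Comp_size.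
apply: (@Comp_iter _ _ size id (fun a _ => dehn_pass a)); [exact/Comp_size/Comp_id | exact: Comp_id |].
apply: (@Comp_foldr _ _ _ (fun y : word S * word S => y.1) (fun=> [::]) (fun a acc _ => rewrite_prefix (a :: acc))).
- exact/Comp_fst/Comp_id.
- exact: Comp_const.
apply: Comp_rewrite_prefix.
by apply: Comp_cons; [apply/Comp_fst/Comp_fst/Comp_id | apply/Comp_snd/Comp_fst/Comp_id].
Qed.

End WordProblem.

Definition sublists (T : Type) (s : seq T) : seq (seq T) :=
  foldr (fun a acc => acc ++ [seq a :: t | t <- acc]) [:: [::]] s.

Lemma sublists_cons (T : Type) (a : T) s :
  sublists (a :: s) = sublists s ++ [seq a :: t | t <- sublists s].
Proof. by []. Qed.

Lemma mem_sublists (T : eqType) (s t : seq T) : t \in sublists s -> {subset t <= s}.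
Proof.
elim: s t => [|a s IH] t; first by rewrite inE => /eqP ->.
rewrite sublists_cons mem_cat => /orP[/IH H|/mapP[t' /IH H ->]] b.
  by rewrite inE => /H ->; rewrite orbT.
by rewrite !inE => /orP[->//|/H ->]; rewrite orbT.
Qed.

Lemma filter_sublists (T : eqType) (p : pred T) (s : seq T) : filter p s \in sublists s.
Proof.
elim: s => //= a s IH; rewrite -/(sublists s) mem_cat.
by case: ifP => _; rewrite ?IH // map_f ?orbT.
Qed.

Definition upto m := iter m.+1 (fun s => size s :: s) [::].

Lemma mem_upto m x : (x \in upto m) = (x <= m).
Proof.
have sz n : size (iter n (fun s => size s :: s) [::]) = n by elim: n => //= n ->.
rewrite -ltnS /upto; elim: m.+1 => //= n IH; rewrite inE IH sz ltnS.
by rewrite [in RHS]leq_eqVlt.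
Qed.

Definition nonzeros (v : seq nat) := foldr (fun x n => (x != 0) + n) 0 v.

(** E is passed for its length only, the number of coordinates. *)
Definition bounded_vectors (T : Type) (E : seq T) (m : nat) : seq (seq nat) :=
  foldr (fun _ acc => flatten [seq [seq x :: v | x <- upto m] | v <- acc]) [:: [::]] E.

Lemma mem_bounded_vectors (T : Type) (E : seq T) m v :
  (v \in bounded_vectors E m) = (size v == size E) && all (leq^~ m) v.
Proof.
elim: E v => [|e E IH] v; first by rewrite inE; case: v.
rewrite -[bounded_vectors _ _]/(flatten [seq [seq x :: v | x <- upto m] | v <- bounded_vectors E m]).
apply/flatten_mapP/idP => [[v' v'E /mapP[x xm ->]]|].
  by move: xm v'E; rewrite mem_upto IH /= eqSS => -> /andP[-> ->].
case: v => // x v.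
rewrite -[_ && _]/(((size v).+1 == (size E).+1) && ((x <= m) && all (leq^~ m) v)) eqSS => /and3P[vE xm vm].
exists v; first by rewrite IH vE.
by apply: map_f; rewrite mem_upto.
Qed.

Lemma nonzerosE v : nonzeros v = count (fun x => x != 0) v.
Proof. by elim: v => //= x v <-. Qed.

(** * Computing a semilinear representation *)

Section TwoEntries.

Lemma no_entry v a : nonzeros v = 0 -> nth 0 v a = 0.
Proof.
rewrite nonzerosE; elim: v a => [|x v IH] [|a] //=; first by case: x.
by move/eqP; rewrite addn_eq0 => /andP[_ /eqP /IH].
Qed.

Lemma one_entry v : nonzeros v <= 1 -> exists i p, forall a, nth 0 v a = (a == i) * p.
Proof.
elim: v => [|x v IH] /=; first by exists 0, 0 => a; rewrite muln0 nth_nil.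
case: (posnP x) => [->|x0] /=.
  by move/IH => [i [p H]]; exists i.+1, p => -[|a] /=; rewrite ?H.
rewrite add1n ltnS leqn0 => /eqP v0; exists 0, x => -[|a] /=; first by rewrite mul1n.
by rewrite no_entry.
Qed.

Lemma two_entries v : nonzeros v <= 2 ->
  exists r : pump, r.1.1.1 <= r.1.1.2 /\ forall a, nth 0 v a = pump_vec r a.
Proof.
elim: v => [|x v IH] /=.
  by exists (0, 0, 0, 0); split=> // a; rewrite /pump_vec /= !muln0 nth_nil.
case: (posnP x) => [->|x0] /=.
  by move/IH => [[[[i j] p] q] [ij H]]; exists (i.+1, j.+1, p, q); split=> // -[|a] //=.
rewrite add1n ltnS => /one_entry[j [q H]]; exists (0, j.+1, x, q); split=> // -[|a] /=.
  by rewrite /pump_vec /= mul1n addn0.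
by rewrite H /pump_vec.
Qed.

End TwoEntries.

Section ZeroOne.
Variables (G : groupType) (u v : nat -> G) (k : nat).
Local Notation pv x := (prefix_val u v x k).

Definition sum_at (vs : seq (seq nat)) (i : nat) := sumn [seq nth 0 w i | w <- vs].

(** By [prefix_add_pump], adding w multiplies the trivial product by h g with h and g powers of two
    fixed axes. If this is 1 then g and h are inverse, and m w contributes h^m g^m = 1. *)
Lemma two_entries_line (x : nat -> nat) w m : nonzeros w <= 2 ->
  pv x = gone G -> pv (fun i => x i + nth 0 w i) = gone G ->
  pv (fun i => x i + m * nth 0 w i) = gone G.
Proof.
move=> /two_entries[[[[i j] p] q] [/= ij wE]] x1.
have -> : (fun a => x a + nth 0 w a) = add_pump (i, j, p, q) x by apply: funext => a; rewrite wE.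
have -> : (fun a => x a + m * nth 0 w a) = add_pump (i, j, m * p, m * q) x.
  by apply: funext => a; rewrite wE /pump_vec /add_pump /= mulnDr !(mulnCA m).
rewrite !prefix_add_pump // x1 !gmul1.
have -> : (if i < k then axis u v x i ^^ (m * p) else gone G) =
    (if i < k then axis u v x i ^^ p else gone G) ^^ m.
  by case: ifP; rewrite ?gpow_one // mulnC gpowM.
have -> : (if j < k then axis u v x j ^^ (m * q) else gone G) =
    (if j < k then axis u v x j ^^ q else gone G) ^^ m.
  by case: ifP; rewrite ?gpow_one // mulnC gpowM.
move: (if i < k then _ else _) (if j < k then _ else _) => g h gh.
have -> : h = ginv g by apply: (@gmul_inj _ g); rewrite gh gmulV.
by rewrite /gmul /gpow /ginv expVgn mulgV.
Qed.

(* A relation between two coordinates says that a power commutes past a fixed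
   element, so if it can be applied once it can be applied any number of times. *)
Lemma zero_one_combinations (x : nat -> nat) ps : (forall w, w \in ps -> nonzeros w <= 2) ->
  (forall qs, qs \in sublists ps -> pv (fun i => x i + sum_at qs i) = gone G) ->
  forall lambda : nat -> nat,
  pv (fun i => x i + \sum_(j < size ps) lambda j * nth 0 (nth [::] ps j) i) = gone G.
Proof.
elim: ps x => [|w ps IH] x two sol lambda.
  rewrite -(sol [::]) ?inE //; congr prefix_val; apply: funext => i.
  by rewrite big_ord0.
have two' w' : w' \in ps -> nonzeros w' <= 2 by move=> H; apply: two; rewrite inE H orbT.
have := IH (fun i => x i + lambda 0 * nth 0 w i) two' _ (fun j => lambda j.+1).
rewrite (_ : (fun i => _) = (fun i => x i + \sum_(j < size (w :: ps)) lambda j * nth 0 (nth [::] (w :: ps) j) i)).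
  apply=> qs qps; pose y i := x i + sum_at qs i.
  have -> : (fun i => x i + lambda 0 * nth 0 w i + sum_at qs i) = (fun i => y i + lambda 0 * nth 0 w i).
    by apply: funext => i; rewrite /y addnAC.
  apply: two_entries_line; first by apply: two; rewrite inE eqxx.
    by apply: sol; rewrite sublists_cons mem_cat qps.
  rewrite -(sol (w :: qs)); last by rewrite sublists_cons mem_cat map_f ?orbT.
  by congr prefix_val; apply: funext => i; rewrite /y /sum_at /=; lia.
by apply: funext => i; rewrite /= big_ord_recl addnA.
Qed.

End ZeroOne.

Ltac comp_proj := solve [repeat first [exact: Comp_id | apply: Comp_fst | apply: Comp_snd]].

Lemma Comp_sublists (X T : countType) (f : X -> seq T) : Comp f -> Comp (fun x => sublists (f x)).
Proof.
move=> cf; apply: (@Comp_foldr _ _ _ f (fun=> [:: [::]]) (fun a acc _ => acc ++ [seq a :: t | t <- acc])) => //.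
  exact: Comp_const.
apply: Comp_cat; first comp_proj.
apply: (@Comp_map _ _ _ (fun y : T * seq (seq T) * X => y.1.2) (fun t y => y.1.1 :: t)); first comp_proj.
by apply: Comp_cons; comp_proj.
Qed.

Lemma Comp_upto (X : countType) (f : X -> nat) : Comp f -> Comp (fun x => upto (f x)).
Proof.
move=> cf; apply: (@Comp_iter _ _ (fun x => (f x).+1) (fun=> [::]) (fun s _ => size s :: s)).
- apply: (@Comp_nat2 _ (fun a b => a + b) (fun=> 1) f) => //; first exact: recursive2_add.
  exact: Comp_const.
- exact: Comp_const.
by apply: Comp_cons; [apply: Comp_size|]; comp_proj.
Qed.

Lemma Comp_nonzeros (X : countType) (f : X -> seq nat) : Comp f -> Comp (fun x => nonzeros (f x)).
Proof.
move=> cf; apply: (@Comp_foldr _ _ _ f (fun=> 0) (fun a n _ => (a != 0) + n)) => //.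
  exact: Comp_const.
apply: Comp_nat2; [exact: recursive2_add | | comp_proj].
apply: (@Comp_if _ nat (fun y : nat * nat * X => y.1.1 != 0) (fun=> 1) (fun=> 0)); try exact: Comp_const.
by apply: Comp_neg; apply: Comp_eq0; comp_proj.
Qed.

Lemma Comp_bounded_vectors (X T : countType) (f : X -> seq T) (m : X -> nat) :
  Comp f -> Comp m -> Comp (fun x => bounded_vectors (f x) (m x)).
Proof.
move=> cf cm.
apply: (@Comp_foldr _ _ _ f (fun=> [:: [::]])
  (fun _ acc x => flatten [seq [seq a :: v | a <- upto (m x)] | v <- acc])) => //.
  exact: Comp_const.
apply: Comp_flatten.
apply: (@Comp_map _ _ _ (fun y : T * seq (seq nat) * X => y.1.2) (fun v y => [seq a :: v | a <- upto (m y.2)])).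
  comp_proj.
apply: (@Comp_map _ _ _ (fun z : seq nat * (T * seq (seq nat) * X) => upto (m z.2.2)) (fun a z => a :: z.1)).
  by apply: Comp_upto; apply: (Comp_comp cm); comp_proj.
by apply: Comp_cons; comp_proj.
Qed.

(** * The search and its correctness *)

Section Program.
Variables (G : groupType) (S : {fset G}).
Hypothesis genS : generating_set S.
Variables (K : nat) (F : nat -> nat) (c : nat).
Hypothesis hypl : hyp_length (wlen genS) K.
Hypothesis FP : forall k (u v : nat -> G) n x,
  \sum_(i < k) (wlen genS (u i) + wlen genS (v i)) <= n -> prefix_val u v x k = gone G ->
  exists (x0 : nat -> nat) (rs ts : seq pump), [/\
    forall r, r \in rs -> [/\ r.1.1.1 < k, r.1.1.2 < k, r.1.2 <= F n & r.2 <= F n],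
    {subset ts <= rs}, forall i, x i = add_pumps ts x0 i,
    forall i, i < k -> x0 i <= F n &
    forall qs : seq pump, {subset qs <= rs} -> prefix_val u v (add_pumps qs x0) k = gone G].
Hypothesis Fc : forall n, F n + F n <= c * n.+1 ^ c.
Variables (rule : word S -> word S) (short : seq (word S)).
Local Notation C := (2 * K + 2).
Hypothesis ruleP : forall w,
  [/\ word_val (rule w) = word_val w, size (rule w) = wlen genS (word_val w) &
      geodesic_word genS w -> rule w = w].
Hypothesis shortP : forall w : word S, size w <= C -> w \in short.
Implicit Types (E : seq (word S * word S)).

Definition repeat_word n (w : word S) : word S := iter n (cat w) [::].

Definition eval_step (st : word S * seq (seq nat)) (e : word S * word S) :=
  (st.1 ++ (repeat_word (sumn [seq head 0 w | w <- st.2]) e.1 ++ e.2), [seq behead w | w <- st.2]).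

Definition eval_expr E (vs : seq (seq nat)) : word S := (foldl eval_step ([::], vs) E).1.

Definition expr_size E := foldr (fun e n => size e.1 + size e.2 + n) 0 E.

(** F itself is only known to exist, while this majorant of 2 F is computable and is the value of
    the final polynomial. The factor 2 allows for a pump with equal ends, whose single entry is p +
    q. *)
Definition expr_bound E := c * (expr_size E).+1 ^ c.

Definition valid_repr E (L : seq nat * seq (seq nat)) :=
  all (fun qs => is_trivial_word C rule short (eval_expr E (L.1 :: qs))) (sublists L.2).

(** Exhaustive, so that no relation has to be computed; only computability and the magnitude are at
    stake, not the running time. *)
Definition candidates E : seq (seq nat * seq (seq nat)) :=
  let V := bounded_vectors E (expr_bound E) in
  flatten [seq [seq (v0, ps) | ps <- sublists [seq w <- V | nonzeros w <= 2]] | v0 <- V].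

Definition solution_repr E := [seq L <- candidates E | valid_repr E L].

Lemma Comp_solution_repr : Comp solution_repr.
Proof.
pose eT := (word S * word S)%type.
have crep (X : countType) (n : X -> nat) (w : X -> word S) : Comp n -> Comp w ->
    Comp (fun x => repeat_word (n x) (w x)).
  move=> cn cw; apply: (@Comp_iter _ _ n (fun=> [::]) (fun a x => w x ++ a)) => //; first exact: Comp_const.
  by apply: Comp_cat; [apply: (Comp_comp cw)|]; comp_proj.
have ceval (X : countType) (E : X -> seq eT) vs : Comp E -> Comp vs -> Comp (fun x => eval_expr (E x) (vs x)).
  move=> cE cvs; apply: Comp_fst.
  apply: (@Comp_foldl _ _ _ E (fun x => ([::], vs x)) (fun e st _ => eval_step st e)) => //.
    by apply: Comp_pair => //; exact: Comp_const.
  rewrite /eval_step; apply: Comp_pair; last first.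
    apply: (@Comp_map _ _ _ (fun y : eT * (word S * seq (seq nat)) * X => y.1.2.2) (fun w _ => behead w)).
      comp_proj.
    by apply: Comp_behead; comp_proj.
  apply: Comp_cat; first comp_proj.
  apply: Comp_cat; last comp_proj.
  apply: crep; last comp_proj.
  apply: (@Comp_foldr _ _ _ (fun y : eT * (word S * seq (seq nat)) * X => [seq head 0 w | w <- y.1.2.2])
    (fun=> 0) (fun a n _ => a + n)).
  - apply: (@Comp_map _ _ _ (fun y : eT * (word S * seq (seq nat)) * X => y.1.2.2) (fun w _ => head 0 w)).
      comp_proj.
    by apply: Comp_head; comp_proj.
  - exact: Comp_const.
  by apply: Comp_nat2; [exact: recursive2_add | comp_proj | comp_proj].
have csize : Comp (fun E : seq eT => expr_size E).
  apply: (@Comp_foldr _ _ _ id (fun=> 0) (fun (e : eT) n _ => size e.1 + size e.2 + n)).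
  - exact: Comp_id.
  - exact: Comp_const.
  apply: Comp_nat2; [exact: recursive2_add | | comp_proj].
  by apply: Comp_nat2; [exact: recursive2_add | |]; apply: Comp_size; comp_proj.
have cbound : Comp (fun E : seq eT => expr_bound E).
  apply: Comp_nat2; [exact: recursive2_mul | exact: Comp_const | apply: Comp_expn].
  apply: (@Comp_nat2 _ (fun a b => a + b) (fun=> 1) expr_size) => //; first exact: recursive2_add.
  exact: Comp_const.
have cV : Comp (fun E : seq eT => bounded_vectors E (expr_bound E)).
  by apply: Comp_bounded_vectors => //; exact: Comp_id.
apply: (@Comp_filter _ _ candidates (fun L E => valid_repr E L)).
  apply: Comp_flatten.
  apply: (@Comp_map _ _ _ (fun E : seq eT => bounded_vectors E (expr_bound E))
    (fun v0 E => [seq (v0, ps) | ps <- sublists [seq w <- bounded_vectors E (expr_bound E) | nonzeros w <= 2]])) => //.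
  apply: (@Comp_map _ _ _ (fun y : seq nat * seq eT =>
     sublists [seq w <- bounded_vectors y.2 (expr_bound y.2) | nonzeros w <= 2]) (fun ps y => (y.1, ps))).
    apply: Comp_sublists.
    apply: (@Comp_filter _ _ (fun y : seq nat * seq eT => bounded_vectors y.2 (expr_bound y.2)) (fun w _ => nonzeros w <= 2)).
      by apply: (Comp_comp cV); comp_proj.
    by apply: Comp_leq; [apply: Comp_nonzeros; comp_proj | exact: Comp_const].
  by apply: Comp_pair; comp_proj.
apply: (@Comp_all _ _ (fun y : seq nat * seq (seq nat) * seq eT => sublists y.1.2)
  (fun qs y => is_trivial_word C rule short (eval_expr y.2 (y.1.1 :: qs)))).
  by apply: Comp_sublists; comp_proj.
apply: Comp_is_trivial_word; apply: ceval; first comp_proj.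
by apply: Comp_cons; comp_proj.
Qed.

Lemma mem_bounded (E : seq (word S * word S)) (L : seq nat * seq (seq nat)) :
  L \in solution_repr E ->
  [/\ L.1 \in bounded_vectors E (expr_bound E),
      forall w, w \in L.2 -> w \in bounded_vectors E (expr_bound E) /\ nonzeros w <= 2 &
      valid_repr E L].
Proof.
rewrite mem_filter => /andP[ok /flatten_mapP[v0 v0V /mapP[ps psV E']]].
rewrite E' in ok *; split=> // w /(mem_sublists psV).
by rewrite mem_filter => /andP[].
Qed.

Definition expr_u E i := word_val (nth ([::], [::]) E i).1.
Definition expr_v E i := word_val (nth ([::], [::]) E i).2.

Lemma prefix_val_prod (u v : nat -> G) x k :
  prefix_val u v x k = (\prod_(i < k) (u i ^+ x i * v i))%g.
Proof.
elim: k => [|k IH]; first by rewrite big_ord0.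
by rewrite big_ord_recr /= IH /gmul /gpow -mulgA.
Qed.

Lemma repeat_word_val n w : word_val (repeat_word n w) = (word_val w ^+ n)%g.
Proof.
elim: n => [|n IH]; first by rewrite word_val_nil.
by rewrite /repeat_word iterS word_val_cat -/(repeat_word n w) IH expgS.
Qed.

Lemma eval_expr_val E vs :
  word_val (eval_expr E vs) = prefix_val (expr_u E) (expr_v E) (sum_at vs) (size E).
Proof.
rewrite prefix_val_prod /eval_expr.
suff H w : word_val (foldl eval_step (w, vs) E).1 =
    (word_val w * \prod_(i < size E) (expr_u E i ^+ sum_at vs i * expr_v E i))%g.
  by rewrite H word_val_nil mul1g.
elim: E w vs => [|e E IH] w vs; first by rewrite big_ord0 mulg1.
rewrite [foldl _ _ _]/= IH big_ord_recl !word_val_cat repeat_word_val -!mulgA.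
congr (_ * (_ ^+ _ * (_ * _)))%g.
apply: eq_bigr => i _; rewrite lift0.
suff -> : sum_at [seq behead w | w <- vs] i = sum_at vs i.+1 by [].
by rewrite /sum_at -map_comp; congr sumn; apply: eq_map => s; rewrite /= nth_behead.
Qed.

Lemma valid_repr_sound E v0 ps : (v0, ps) \in solution_repr E ->
  forall lambda : nat -> nat, prefix_val (expr_u E) (expr_v E)
    (fun i => nth 0 v0 i + \sum_(j < size ps) lambda j * nth 0 (nth [::] ps j) i) (size E) = gone G.
Proof.
move=> /mem_bounded[_ two /allP ok]; apply: zero_one_combinations => [w /two[]//|qs /ok].
by move/(is_trivial_wordP hypl erefl ruleP shortP); rewrite eval_expr_val.
Qed.

(** Turns a list with repetitions into coefficients. Different pumps may have the same vector, and
    [index] sends them to one common period. *)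
Lemma count_index_sum (T U : eqType) (f : U -> T) (ps : seq T) (g : T -> nat) d (ts : seq U) :
  (forall t, t \in ts -> f t \in ps) ->
  \sum_(j < size ps) count (fun t => index (f t) ps == j) ts * g (nth d ps j) =
  sumn [seq g (f t) | t <- ts].
Proof.
elim: ts => [|t ts IH] sub; first by rewrite big1.
rewrite /= -IH; last by move=> t' H; apply: sub; rewrite inE H orbT.
have ti : index (f t) ps < size ps by rewrite index_mem sub ?inE ?eqxx.
under eq_bigr do rewrite mulnDl.
rewrite big_split /=; congr (_ + _).
rewrite (bigD1 (Ordinal ti)) //= eqxx mul1n nth_index ?sub ?inE ?eqxx // big1 ?addn0 // => j jt.
by rewrite (_ : _ == _ = false) // eq_sym; apply: negbTE; apply: contra jt => /eqP jE; apply/eqP/val_inj.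
Qed.

Lemma pump_vec_nonzeros r k : nonzeros (mkseq (pump_vec r) k) <= 2.
Proof.
rewrite nonzerosE count_map.
apply: leq_trans (_ : count (predU (pred1 r.1.1.1) (pred1 r.1.1.2)) (iota 0 k) <= _).
  apply: sub_count => a /=; apply: contraNT; rewrite negb_or /pump_vec => /andP[/negbTE -> /negbTE ->].
  by [].
apply: leq_trans (_ : count_mem r.1.1.1 (iota 0 k) + count_mem r.1.1.2 (iota 0 k) <= _).
  by rewrite -count_predUI leq_addr.
by rewrite !count_uniq_mem ?iota_uniq //; do 2!case: (_ \in _).
Qed.

Lemma solution_repr_complete E (x : nat -> nat) :
  prefix_val (expr_u E) (expr_v E) x (size E) = gone G ->
  exists v0 ps (lambda : nat -> nat), (v0, ps) \in solution_repr E /\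
    forall i, i < size E -> x i = nth 0 v0 i + \sum_(j < size ps) lambda j * nth 0 (nth [::] ps j) i.
Proof.
set k := size E; set n := expr_size E => sol.
have size_le : \sum_(i < k) (wlen genS (expr_u E i) + wlen genS (expr_v E i)) <= n.
  rewrite /n /k {sol k n}; elim: E => [|e E IH]; first by rewrite big_ord0.
  rewrite big_ord_recl /= leq_add // leq_add //; exact: wlen_le.
have [x0 [rs [ts [rsP sub xE x0F qsP]]]] := FP size_le sol.
have bnd a : a <= F n -> a <= expr_bound E.
  by move=> aF; apply: leq_trans aF (leq_trans _ (Fc n)); apply: leq_addr.
pose v0 := mkseq x0 k; pose vec r := mkseq (pump_vec r) k.
set V := bounded_vectors E (expr_bound E).
have v0V : v0 \in V.
  rewrite mem_bounded_vectors size_mkseq eqxx /=; apply/allP => y /mapP[i].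
  by rewrite mem_iota => /andP[_ ik] ->; apply/bnd/x0F.
have vecV r : r \in rs -> vec r \in V.
  move=> /rsP[_ _ p q]; rewrite mem_bounded_vectors size_mkseq eqxx /=; apply/allP => y /mapP[i _ ->].
  apply: leq_trans (Fc n); apply: leq_add; [apply: leq_trans p | apply: leq_trans q];
    by case: (_ == _); rewrite ?mul1n.
(* The periods are taken in the order of V, which makes their list one of the enumerated
   sublists. *)
pose ps := [seq w <- [seq w <- V | nonzeros w <= 2] | w \in map vec rs].
have vecps r : r \in rs -> vec r \in ps.
  by move=> rr; rewrite !mem_filter map_f // pump_vec_nonzeros vecV.
exists v0, ps, (fun j => count (fun t => index (vec t) ps == j) ts); split; last first.
  move=> i ik; rewrite (count_index_sum (fun w => nth 0 w i)); last by move=> t /sub /vecps.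
  rewrite xE add_pumpsE nth_mkseq //; congr (_ + sumn _); apply: eq_map => r.
  by rewrite nth_mkseq.
rewrite mem_filter; apply/andP; split; last first.
  apply/flatten_mapP; exists v0 => //; apply: map_f; exact: filter_sublists.
apply/allP => qs qsps; apply/(is_trivial_wordP hypl erefl ruleP shortP).
have ex q : exists r, q \in ps -> r \in rs /\ q = vec r.
  case: (boolP (q \in map vec rs)) => [/mapP[r rr qE]|nq]; first by exists r.
  by exists (0, 0, 0, 0); rewrite mem_filter (negbTE nq).
have [g gP] := choice ex.
(* Each chosen period is the vector of a pump of rs, so the tested word is the product of a pumped
   solution. *)
rewrite eval_expr_val -[RHS](qsP [seq g q | q <- qs]); last first.
  by move=> r /mapP[q /(mem_sublists qsps) /gP[rr _] ->].
apply: prefix_val_ext => i ik; rewrite add_pumpsE /sum_at /= nth_mkseq // -map_comp.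
congr (_ + sumn _); apply/eq_in_map => q /(mem_sublists qsps) /gP[_ qE].
by rewrite {1}qE nth_mkseq.
Qed.

Lemma solution_repr_bound E v0 ps : (v0, ps) \in solution_repr E -> forall w, w \in v0 :: ps ->
  size w = size E /\ all (leq^~ (expr_bound E)) w.
Proof.
move=> /mem_bounded[h1 h2 _] w wL.
have : w \in bounded_vectors E (expr_bound E) by move: wL; rewrite inE => /orP[/eqP -> //|/h2[]].
by rewrite mem_bounded_vectors => /andP[/eqP].
Qed.

End Program.

Section Tuples.
Variable k : nat.

Definition to_tuple (v : seq nat) : k.-tuple nat := insubd (nseq_tuple k 0) v.

Lemma to_tupleK v : size v = k -> val (to_tuple v) = v.
Proof. by move=> vk; rewrite val_insubd vk eqxx. Qed.

Lemma tnth_to_tuple v (i : 'I_k) : size v = k -> tnth (to_tuple v) i = nth 0 v i.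
Proof. by move=> vk; rewrite (tnth_nth 0) to_tupleK. Qed.

Lemma map_to_tupleK (ps : seq (seq nat)) : (forall w, w \in ps -> size w = k) ->
  [seq val w | w <- map to_tuple ps] = ps.
Proof.
move=> psk; rewrite -map_comp -[RHS]map_id; apply/eq_in_map => w /psk; exact: to_tupleK.
Qed.

Lemma linear_set_to_tuple v0 (ps : seq (seq nat)) (x : k.-tuple nat) :
  (forall w, w \in v0 :: ps -> size w = k) ->
  linear_set (to_tuple v0, map to_tuple ps) x <->
  exists lambda : nat -> nat, forall i : 'I_k,
    tnth x i = nth 0 v0 i + \sum_(j < size ps) lambda j * nth 0 (nth [::] ps j) i.
Proof.
move=> sz; have v0k : size v0 = k by apply: sz; rewrite inE eqxx.
have psk w : w \in ps -> size w = k by move=> H; apply: sz; rewrite inE H orbT.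
set qs := map to_tuple ps.
have sum_eq (lambda : 'I_(size qs) -> nat) (mu : nat -> nat) (i : 'I_k) : (forall j, lambda j = mu j) ->
    \sum_(j < size qs) lambda j * tnth (tnth (in_tuple qs) j) i =
    \sum_(j < size ps) mu j * nth 0 (nth [::] ps j) i.
  move=> lm; have -> : \sum_(j < size ps) mu j * nth 0 (nth [::] ps j) i =
      \sum_(j < size qs) mu j * nth 0 (nth [::] ps j) i.
    by rewrite -(big_mkord xpredT (fun j => mu j * nth 0 (nth [::] ps j) i)) /qs size_map big_mkord.
  apply: eq_bigr => j _; rewrite lm; congr (_ * _).
  have js : j < size ps by rewrite -(size_map to_tuple).
  rewrite (tnth_nth (to_tuple [::])) /= (nth_map [::]) // tnth_to_tuple //.
  by apply: psk; apply: mem_nth.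
split=> [[lambda H]|[mu H]].
  pose mu j := if insub j is Some o then lambda o else 0.
  exists mu => i; rewrite H /= tnth_to_tuple // (sum_eq lambda mu i) // => j.
  rewrite /mu; case: insubP => [o _ oj|]; last by rewrite ltn_ord.
  by congr (lambda _); apply: val_inj; rewrite oj.
exists (fun j => mu j) => i; rewrite H /= tnth_to_tuple //.
by rewrite (sum_eq (fun j => mu j) mu i (fun=> erefl)).
Qed.

End Tuples.

Theorem theorem8p1 (R : realType) (G : groupType) (S : {fset G})
    (symS : symmetric_set S) (genS : generating_set S)
    (hypS : hyperbolic R S) :
  knapsack_tame S.
Proof.
have [K hypl] := hyperbolic_length symS genS hypS.
have [F Fpoly FP] := pumped_solutions hypl.
have [c Fc] := poly_bounded_add Fpoly Fpoly.
have [rule ruleP] := shortening_rule genS.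
have [short shortP] := short_words_list S (2 * K + 2).
have [f [cf fE]] := Comp_solution_repr K c rule short.
exists (c%:P * ('X + 1) ^+ c)%R, f; split=> // k E k0.
pose L := solution_repr K c rule short (val E).
have sizeE : size (val E) = k by rewrite size_tuple.
have bound L' w : L' \in L -> w \in L'.1 :: L'.2 -> size w = k /\ all (leq^~ (expr_bound c (val E))) w.
  by case: L' => v0 ps LL /(solution_repr_bound LL); rewrite sizeE.
pose tup (M : seq nat * seq (seq nat)) := (to_tuple k M.1, map (to_tuple k) M.2).
have solE (nu : k.-tuple nat) :
    knapsack_sol E nu <-> prefix_val (expr_u (val E)) (expr_v (val E)) (nth 0 nu) k = gone G.
  rewrite prefix_val_prod /knapsack_sol /= (_ : (\prod_(i < k) _)%g =
      (\prod_(i < k) (expr_u (val E) i ^+ nth 0 nu i * expr_v (val E) i))%g) //.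
  by apply: eq_bigr => i _; rewrite /expr_u /expr_v !(tnth_nth ([::], [::])) (tnth_nth 0).
exists (map tup L); split.
(* A tuple has the code of its underlying list, so one program on lists serves all k. *)
- rewrite -[choice.pickle E]/(choice.pickle (val E)) fE -/L.
  have : {in L, forall M : seq nat * seq (seq nat), choice.pickle M = choice.pickle (tup M)}.
    move=> [v0 ps] LL; rewrite /tup /=.
    have -> : choice.pickle (to_tuple k v0, map (to_tuple k) ps) =
        CodeSeq.code [:: choice.pickle (val (to_tuple k v0)); CodeSeq.code [seq choice.pickle (val w) | w <- map (to_tuple k) ps]] by [].
    rewrite to_tupleK; last by have [] := bound _ v0 LL (mem_head _ _).
    rewrite (map_comp choice.pickle val) map_to_tupleK // => w wps.
    by have [] := bound _ w LL _; rewrite ?inE ?wps ?orbT.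
  move=> H; rewrite /choice.pickle /=.
  have : map choice.pickle L = map choice.pickle (map tup L).
    by rewrite -map_comp; apply/eq_in_map.
  by move=> E'; apply: (congr1 CodeSeq.code E').
- rewrite predeqE => nu; rewrite solE; split=> [[L' /mapP[[v0 ps] LL ->]]|sol].
    move=> /linear_set_to_tuple[w /(bound _ _ LL)[] //|lambda H].
    rewrite -(valid_repr_sound hypl ruleP shortP LL lambda) sizeE.
    by apply: prefix_val_ext => i ik; have := H (Ordinal ik); rewrite (tnth_nth 0).
  have sol' : prefix_val (expr_u (val E)) (expr_v (val E)) (nth 0 nu) (size (val E)) = gone G.
    by rewrite sizeE.
  have [v0 [ps [lambda [LL H]]]] := solution_repr_complete hypl FP Fc ruleP shortP sol'.
  exists (tup (v0, ps)); first exact: map_f.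
  apply/linear_set_to_tuple => [w /(bound _ _ LL)[] //|]; exists lambda => i.
  by rewrite -H ?sizeE // (tnth_nth 0).
have pE : (c%:P * ('X + 1) ^+ c)%R.[knapsack_length E]%R = expr_bound c (val E).
  rewrite hornerM hornerC horner_exp hornerD hornerX hornerC.
  rewrite /expr_bound; congr (_ * (_ ^ _)).
  rewrite -[RHS]addn1; congr (_ + _).
  rewrite /knapsack_length -(big_tuple _ _ E xpredT (fun e : word S * word S => size e.1 + size e.2)).
  rewrite -[val E]/(tval E); elim: (tval E) => [|e s IH]; first by rewrite big_nil.
  by rewrite big_cons IH.
rewrite pE; apply/bigmax_leqP_seq => L' /mapP[[v0 ps] LL ->] _.
apply/bigmax_leqP_seq => w wL _; apply/bigmax_leqP => i _.
have : w \in map (to_tuple k) (v0 :: ps) by [].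
case/mapP => w' w'L ->; have [sw /all_nthP w'b] := bound _ w' LL w'L.
by rewrite tnth_to_tuple //; apply: (w'b 0); rewrite sw.
Qed.
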